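(* Let $T$ be a centered Gaussian, mean square continuous, isotropic random field on $\mathbb{S}^2$ with angular power spectrum $(C_l)_{l\ge 0}$. Assume there exist an integer $M>0$, a real $\alpha>2$, a sequence of functions $(g_j)_j$ on $[B^{-1},B]$, and positive numbers $c_1,c_2,k_0,\dots,k_M$ such that $C_l=l^{-\alpha}g_j\left(\frac{l}{B^j}\right)$ for every $j$ and every integer $l$ with $B^{j-1}<l<B^{j+1}$, $c_1l^{-\alpha}\le C_l\le c_2l^{-\alpha}$, and $\sup_j\sup_{B^{-1}\le u\le B}|g_j^{(r)}(u)|\le k_r$ for $r=0,\dots,M$. Then there is a constant $C_M$, independent of $j,k,k'$, such that for all $j$ and all $k,k'\in\{1,\dots,N_j^2\}$ the needlet coefficients $\beta_{j,k}=\int_{\mathbb{S}^2}T(x)\psi_{j,k}(x)\,dx$ satisfy $$|\operatorname{Cor}(\beta_{j,k},\beta_{j,k'})|\le\frac{C_M}{(1+B^jd(\xi_{j,k},\xi_{j,k'}))^M}.$$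
   Context: $\mathbb{S}^2$ is the unit sphere of $\mathbb{R}^3$, $dx$ the rotation-invariant measure of total mass $4\pi$, and $d(\xi,\eta)=\arccos\langle\xi,\eta\rangle$ the geodesic distance. $L_l$ denotes the Legendre polynomial of degree $l$ normalized so that $\int_{-1}^1L_l(t)L_k(t)\,dt=\frac{2k+1}{8\pi^2}\delta_{l,k}$ (so $L_l(\langle x,y\rangle)$ is the kernel of the orthogonal projection of $\mathbb{L}^2(\mathbb{S}^2)$ onto the spherical harmonics of degree $l$). Needlets: fix $B>1$ and a $C^\infty$ function $\phi$ on $\mathbb{R}$, symmetric, decreasing on $\mathbb{R}^+$, supported in $|\xi|\le1$, with $0\le\phi\le1$ and $\phi(\xi)=1$ for $|\xi|\le 1/B$. Put $b^2(\xi)=\phi(\xi/B)-\phi(\xi)\ge0$, with $b\geq 0$. For each $j$, $\mathcal{Z}_j=\{\xi_{j,k}:k=1,\dots,N_j^2\}\subset\mathbb{S}^2$ (with $N_j=\sqrt{\#\mathcal{Z}_j}$) is a finite set of cubature points with weights $\lambda_{j,k}>0$ such that $\int_{\mathbb{S}^2}f(x)\,dx=\sum_k\lambda_{j,k}f(\xi_{j,k})$ for every restriction $f$ to $\mathbb{S}^2$ of a polynomial of degree at most $[2B^{j+1}]$, and $\frac1cB^{2j}\le\#\mathcal{Z}_j\le cB^{2j}$ for some $c>0$ independent of $j$. The needlets are $\psi_{j,k}(x)=\sqrt{\lambda_{j,k}}\sum_{l\ge0}b\left(\frac{l}{B^j}\right)L_l(\langle x,\xi_{j,k}\rangle)$.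 Isotropic means $\mathrm{E}[T(x)T(y)]=K(\langle x,y\rangle)$ for a function $K$ on $[-1,1]$; the angular power spectrum is $C_l=\frac{8\pi^2}{2l+1}\int_{-1}^1K(u)L_l(u)\,du$, so that $K=\sum_{l\ge0}C_lL_l$. $\operatorname{Cor}(\beta_{j,k},\beta_{j,k'})=\mathrm{E}[\beta_{j,k}\beta_{j,k'}]/\sqrt{\mathrm{E}[\beta_{j,k}^2]\,\mathrm{E}[\beta_{j,k'}^2]}$ (considered for those $j$ for which the variances do not vanish). *)

(* Defs.v *)
From HB Require Import structures.
From mathcomp Require Import all_boot all_order all_algebra.
From mathcomp Require Import all_classical all_reals all_analysis.
From mathcomp Require mpoly.

Set Implicit Arguments.
Unset Strict Implicit.
Unset Printing Implicit Defensive.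

Import Order.TTheory GRing.Theory Num.Theory.
Import numFieldNormedType.Exports.

Local Open Scope classical_set_scope.
Local Open Scope ring_scope.

Definition dotp (R : realType) (x y : 'rV[R]_3) : R := \sum_i x 0 i * y 0 i.

Definition sphere (R : realType) : Type :=
  set_type [set x : 'rV[R]_3 | dotp x x = 1].

HB.instance Definition _ (R : realType) := Topological.copy (sphere R)
  (set_type [set x : 'rV[R]_3 | dotp x x = 1]).

Lemma north_pole_subproof (R : realType) :
  (delta_mx 0 ord_max : 'rV[R]_3) \in [set x : 'rV[R]_3 | dotp x x = 1].
Proof.
rewrite inE /= /dotp (bigD1 ord_max) //= big1 ?addr0 => [|i /negPf ni].
  by rewrite !mxE !eqxx mulr1.
by rewrite !mxE ni andbF mulr0.
Qed.

HB.instance Definition _ (R : realType) :=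
  isPointed.Build (sphere R) (SigSub (north_pole_subproof R)).

(* Borel sigma-algebra of the topology induced by R^3 *)
HB.instance Definition _ (R : realType) := Measurable.copy (sphere R)
  (g_sigma_algebraType (@open (sphere R))).

Definition sdot (R : realType) (x y : sphere R) : R :=
  dotp (set_val x) (set_val y).

Definition geodesic (R : realType) (x y : sphere R) : R := acos (sdot x y).

Definition is_rotation (R : realType) (Q : 'M[R]_3) : Prop :=
  Q *m Q^T = 1%:M /\ \det Q = 1.

Definition rotate_set (R : realType) (Q : 'M[R]_3) (A : set (sphere R)) :
    set (sphere R) :=
  [set x | exists2 y, A y & set_val x = set_val y *m Q].

(* These two properties determine the measure dx uniquely. *)
Definition is_surface_measure (R : realType)
    (sigma : {measure set (sphere R) -> \bar R}) : Prop :=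
  sigma [set: sphere R] = (4 * pi)%:E /\
  forall (Q : 'M[R]_3) (A : set (sphere R)),
    is_rotation Q -> measurable A -> sigma (rotate_set Q A) = sigma A.

(* Rodrigues' formula gives the classical Legendre polynomial P_l, for which
   P_l(1) = 1 and the integral of P_l^2 over [-1, 1] is 2 / (2 l + 1). *)
Definition legendreP (R : realType) (l : nat) : {poly R} :=
  (2 ^+ l * l`!%:R)^-1 *: derivn l (('X^2 - 1) ^+ l).

(* L_l = (2 l + 1) / (4 pi) P_l : the integral of L_l^2 over [-1, 1] is
   (2 l + 1) / (8 pi^2), and L_l(<x, y>) is the projection kernel onto the
   spherical harmonics of degree l, which fixes the sign. *)
Definition legendreL (R : realType) (l : nat) (t : R) : R :=
  (2 * l%:R + 1) / (4 * pi) * (legendreP R l).[t].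

Definition is_window (R : realType) (B : R) (phi : R -> R) : Prop :=
  [/\ forall n x, derivable (derive1n n phi) x 1,
      forall x, phi (- x) = phi x,
      forall x y, 0 <= x -> x <= y -> phi y <= phi x,
      forall x, 1 < `|x| -> phi x = 0 &
      (forall x, 0 <= phi x <= 1) /\ (forall x, `|x| <= B^-1 -> phi x = 1)].

Definition window_b (R : realType) (B : R) (phi : R -> R) (x : R) : R :=
  Num.sqrt (phi (x / B) - phi x).

(* Z j is the number of cubature points at level j (written N_j^2, where N_j
   need not be an integer). *)
Definition is_cubature (R : realType)
    (sigma : {measure set (sphere R) -> \bar R}) (B : R) (Z : nat -> nat)
    (xi : forall j, 'I_(Z j) -> sphere R) (lam : forall j, 'I_(Z j) -> R) :
    Prop :=
  [/\ forall j, injective (xi j),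
      forall j k, 0 < lam j k,
      forall j (p : mpoly.mpoly 3 R),
        all (fun m => mpoly.mdeg m <= Num.truncn (2 * B ^+ j.+1))%N
          (mpoly.msupp p) ->
        \int[sigma]_x mpoly.meval (fun i => (set_val x : 'rV[R]_3) 0 i) p =
        \sum_(k < Z j)
          lam j k * mpoly.meval (fun i => (set_val (xi j k) : 'rV[R]_3) 0 i) p &
      exists2 c : R, 0 < c &
        forall j, c^-1 * B ^+ (2 * j) <= (Z j)%:R <= c * B ^+ (2 * j)].

(* psi_{j,k} for the cubature point xi = xi_{j,k} and weight lam = lam_{j,k} *)
Definition needlet (R : realType) (B : R) (phi : R -> R) (j : nat)
    (xi : sphere R) (lam : R) (x : sphere R) : R :=
  Num.sqrt lam *
  limn (series (fun l =>
    window_b B phi (l%:R / B ^+ j) * legendreL l (sdot x xi))).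

Definition needlet_coef (R : realType)
    (sigma : {measure set (sphere R) -> \bar R}) (Omega : Type)
    (T : sphere R -> Omega -> R) (B : R) (phi : R -> R) (j : nat)
    (xi : sphere R) (lam : R) (w : Omega) : R :=
  \int[sigma]_x (T x w * needlet B phi j xi lam x).

(* The zero-variance case is a separate clause because the library's
   [normal_prob m 0] is not the Dirac mass at m. *)
Definition gaussian_rv (R : realType) (d : measure_display)
    (Omega : measurableType d) (P : probability Omega R) (X : Omega -> R) :
    Prop :=
  (exists m s : R, 0 < s /\
     forall A : set R, measurable A -> P (X @^-1` A) = normal_prob m s A) \/
  (exists m : R,
     forall A : set R, measurable A -> P (X @^-1` A) = \d_m A).

(* Joint measurability is what makes the pathwise integrals over the sphere
   meaningful random variables. *)
Definition measurable_field (R : realType) (d : measure_display)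
    (Omega : measurableType d) (P : probability Omega R)
    (T : sphere R -> {RV P >-> R}) : Prop :=
  measurable_fun [set: sphere R * Omega] (fun p => T p.1 p.2).

Definition centered_field (R : realType) (d : measure_display)
    (Omega : measurableType d) (P : probability Omega R)
    (T : sphere R -> {RV P >-> R}) : Prop :=
  forall x, 'E_P[T x]%E = 0%E.

Definition gaussian_field (R : realType) (d : measure_display)
    (Omega : measurableType d) (P : probability Omega R)
    (T : sphere R -> {RV P >-> R}) : Prop :=
  forall (n : nat) (x : 'I_n -> sphere R) (a : 'I_n -> R),
    gaussian_rv P (fun w => \sum_i a i * T (x i) w).

Definition mean_square_continuous (R : realType) (d : measure_display)
    (Omega : measurableType d) (P : probability Omega R)
    (T : sphere R -> {RV P >-> R}) : Prop :=
  forall x : sphere R,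
    'E_P[(fun w => (T y w - T x w) ^+ 2)%R]%E @[y --> x] --> 0%E.

(* K is only relevant on [-1, 1], where it is determined by T. *)
Definition isotropic (R : realType) (d : measure_display)
    (Omega : measurableType d) (P : probability Omega R)
    (T : sphere R -> {RV P >-> R}) (K : R -> R) : Prop :=
  forall x y, 'E_P[(fun w => T x w * T y w)%R]%E = (K (sdot x y))%:E.

Definition power_spectrum (R : realType) (K : R -> R) (l : nat) : R :=
  8 * pi ^+ 2 / (2 * l%:R + 1) *
  \int[lebesgue_measure]_(u in `[-1, 1]) (K u * legendreL l u).

Definition correlation (R : realType) (d : measure_display)
    (Omega : measurableType d) (P : probability Omega R) (X Y : Omega -> R) :
    R :=
  fine 'E_P[(fun w => X w * Y w)%R]%E /
  Num.sqrt (fine 'E_P[(fun w => X w ^+ 2)%R]%E *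
            fine 'E_P[(fun w => Y w ^+ 2)%R]%E).

(* Derivatives of a function given on a subset A of R only: one-sided at the
   endpoints when A is a compact interval. *)
Definition diff_quot (R : realType) (f : R -> R) (x y : R) : R :=
  (f y - f x) / (y - x).

Definition derivable_within (R : realType) (A : set R) (f : R -> R) (x : R) :
    Prop :=
  cvg (diff_quot f x @ within A x^').

Definition derive_within (R : realType) (A : set R) (f : R -> R) (x : R) : R :=
  lim (diff_quot f x @ within A x^').

Definition derive_withinn (R : realType) (A : set R) (r : nat) (f : R -> R) :
    R -> R :=
  iter r (derive_within A) f.

Definition n_derivable_within (R : realType) (A : set R) (n : nat)
    (f : R -> R) : Prop :=
  forall r x, (r < n)%N -> A x -> derivable_within A (derive_withinn A r f) x.

(* Main.v *)
Require Import Defs.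
From HB Require Import structures.
From mathcomp Require Import all_boot all_order all_algebra.
From mathcomp Require Import all_classical all_reals all_analysis.
From mathcomp Require Import measurable_realfun.
From mathcomp Require Import ring lra zify.

(** Needlet coefficients are linear functionals of the field, so Fubini's
theorem writes their covariance as a double integral of the covariance
function K against the two needlets.  All kernels involved are zonal.  The
Funk-Hecke formula says that the zonal operator of kernel K acts on spherical
harmonics of degree l as multiplication by C_l, and the reproducing property of
L_l then leaves a single sum, with n = B^j,

  E[beta_k beta_k'] = sqrt(lam_k lam_k') / (4 pi) *
    sum_l (2 l + 1) b(l / n)^2 C_l P_l(<xi_k, xi_k'>).

The variances are the values of the same sum at <xi, xi> = 1, so the weights
cancel and the correlation is the quotient of the sum at <xi_k, xi_k'> by the
sum at 1 (needlet_covariance, needlet_correlation).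

Numerator (level_sum_upper).  On the support of b(l / n) the spectrum is
C_l = n^(-alpha) (l / n)^(-alpha) g_j(l / n), so up to the factor n^(-alpha) the
coefficients of the sum are samples, at step 1 / n, of functions
b^2(t) t^(-alpha) g_j(t) with M derivatives bounded uniformly in j
(tame_window_term, tame_symbol).  The three-term recurrence of the Legendre
polynomials gives

  (1 - x) (2 m + 1) P_m = (m + 1) (P_m - P_(m+1)) - m (P_(m-1) - P_m),

an increment in m.  Two summations by parts therefore trade a factor 1 - x for
two finite differences of the coefficients, each of which gains 1 / n: the
result is a sum of the same kind, divided by n^2 (1 - x).  An odd M is finished
by a single summation by parts and the bound |P_l - P_(l+1)| <= 4 sqrt(1 - x).
Hence the sum at x = cos(theta) is at most C n^(2 - alpha) (1 + n theta)^(-M),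
because theta is at most a multiple of sqrt(1 - cos(theta))
(legendre_localization, acos_sqr_le).

Denominator (level_sum_lower).  All terms are nonnegative at x = 1; since
b(1) = 1 and b^2 is continuous, about n of them are of size n^(1 - alpha), so the
sum is at least c n^(2 - alpha) for all large j.  The finitely many remaining
levels contain finitely many pairs of points and are absorbed in the constant.

The facts about the sphere that this uses are obtained from rotation
invariance alone.  Invariance determines every integral of a monomial in two
orthogonal coordinates (moment_transfer); with Laplace's formula for P_l these
integrals give the orthogonality and reproducing properties of the zonal
kernels (sphint_legendreP_lt, sphint_legendreP_diag), hence the Funk-Hecke
formula for polynomial kernels, and Weierstrass approximation extends it to
continuous ones.  Mean square continuity of the field supplies the continuity of
K (continuous_covariance). *)

Set Implicit Arguments.
Unset Strict Implicit.
Unset Printing Implicit Defensive.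

Import Order.TTheory GRing.Theory Num.Theory.
Import numFieldNormedType.Exports.

Local Open Scope classical_set_scope.
Local Open Scope ring_scope.

(** * Legendre polynomials: recurrence, bounds, Laplace's formula *)

Lemma derivnMX (R : nzRingType) n (p : {poly R}) :
  derivn n.+1 ('X * p) = 'X * derivn n.+1 p + n.+1%:R *: derivn n p.
Proof.
elim: n p => [|n IH] p.
  by rewrite /derivn /= derivM derivX mul1r scale1r addrC.
rewrite [LHS]derivSn derivM derivX mul1r derivnD IH -2!derivSn.
have -> : n.+2%:R = n.+1%:R + 1 :> R by rewrite natr1.
by rewrite scalerDl scale1r addrCA [derivn _ _ + _]addrC.
Qed.

Lemma horner_inj (F : numFieldType) (p q : {poly F}) :
  (forall x, p.[x] = q.[x]) -> p = q.
Proof.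
move=> pq; apply/eqP; rewrite -subr_eq0; apply/eqP.
set r := p - q; pose s : seq F := [seq i%:R | i <- iota 0 (size r).+1].
apply: (@roots_geq_poly_eq0 _ r s).
- by apply/allP => x _; rewrite rootE /r !hornerE pq subrr.
- by rewrite map_inj_uniq ?iota_uniq// => i j /eqP; rewrite eqr_nat => /eqP.
- by rewrite size_map size_iota leqnSn.
Qed.

Lemma sum_even (V : zmodType) (F : nat -> V) n :
  (forall k, odd k -> F k = 0) ->
  \sum_(k < n.+1) F k = \sum_(i < n./2.+1) F i.*2.
Proof.
move=> F0; elim: n => [|n IH]; first by rewrite !big_ord1.
rewrite big_ord_recr /= IH uphalf_half.
have [on|en] := boolP (odd n); last by rewrite add0n F0 ?addr0//= en.
by rewrite add1n [RHS]big_ord_recr /= doubleS -[in F n.+1](odd_double_half n) on add1n.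
Qed.

(** The mean of cos^(2i) over a period. *)
Definition cos_moment (R : realType) (i : nat) : R := 'C(i.*2, i)%:R / 4 ^+ i.

Lemma cos_moment0 (R : realType) : cos_moment R 0 = 1.
Proof. by rewrite /cos_moment bin0 expr0 divr1. Qed.

Lemma cos_momentS (R : realType) i :
  cos_moment R i.+1 = (2 * i%:R + 1) / (2 * i%:R + 2) * cos_moment R i.
Proof.
rewrite /cos_moment.
have h1 : ('C(i.*2, i) * (i`! * i`!) = i.*2`!)%N.
  by rewrite -[in RHS](@bin_fact i.*2 i) -addnn ?leq_addr// addnK.
have h2 : ('C(i.+1.*2, i.+1) * (i.+1`! * i.+1`!) = i.+1.*2`!)%N.
  by rewrite -[in RHS](@bin_fact i.+1.*2 i.+1) -addnn ?leq_addr// addnK.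
rewrite doubleS in h2.
have {}h1 : 'C(i.*2, i)%:R * (i`!%:R * i`!%:R) = i.*2`!%:R :> R by rewrite -!natrM h1.
have {}h2 : 'C(i.*2.+2, i.+1)%:R * (i.+1`!%:R * i.+1`!%:R) = i.*2.+2`!%:R :> R.
  by rewrite -!natrM h2.
have f0 : i`!%:R != 0 :> R by rewrite pnatr_eq0 -lt0n fact_gt0.
have f1 : i.+1%:R != 0 :> R by rewrite pnatr_eq0.
have f2 : 2 * i%:R + 2 != 0 :> R by rewrite -natrM -natrD pnatr_eq0 addn2.
have e0 : 4 ^+ i != 0 :> R by rewrite expf_neq0 ?pnatr_eq0.
have hd : i.*2%:R = 2 * i%:R :> R by rewrite -mul2n natrM.
rewrite !factS !natrM -[i.*2.+2%:R]natr1 -[i.*2.+1%:R]natr1 hd -h1 in h2.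
rewrite doubleS.
have -> : 'C(i.*2.+2, i.+1)%:R = (2 * i%:R + 2) * (2 * i%:R + 1) / (i.+1%:R ^+ 2) * 'C(i.*2, i)%:R :> R.
  apply: (@mulIf _ (i.+1%:R * i`!%:R * (i.+1%:R * i`!%:R))); first by rewrite !mulf_neq0.
  by rewrite h2; field; rewrite nat1r.
by rewrite [4 ^+ i.+1]exprS -[i.+1%:R]natr1; field; rewrite e0 f2 natr1.
Qed.

Section Legendre.
Variable R : realType.
Implicit Types (p q : {poly R}) (x t : R) (l n : nat).

Let P := legendreP R.
Let w : {poly R} := 'X^2 - 1.

Let cst n : R := 2 ^+ n * n`!%:R.

Let cst_neq0 n : cst n != 0.
Proof. by rewrite mulf_neq0 ?expf_neq0 ?pnatr_eq0// -lt0n fact_gt0. Qed.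

Let cstS n : cst n.+1 = (2 * n.+1%:R) * cst n.
Proof. by rewrite /cst exprS factS natrM; ring. Qed.

Let derivw : w^`() = 2 *: 'X.
Proof. by rewrite /w derivB derivXn derivC subr0 expr1 -scaler_nat. Qed.

Let derivwX n : (w ^+ n.+1)^`() = (2 * n.+1%:R) *: ('X * w ^+ n).
Proof.
by rewrite deriv_exp derivw -scalerAl -scaler_nat scalerA mulrC.
Qed.

Let PE l : P l = (cst l)^-1 *: derivn l (w ^+ l).
Proof. by []. Qed.

Lemma legendreP0 : P 0 = 1.
Proof. by rewrite PE /cst expr0 mul1r invr1 scale1r expr0. Qed.

Let PSE l : P l.+1 = (cst l)^-1 *: derivn l ('X * w ^+ l).
Proof.
by rewrite PE derivSn derivwX derivnZ scalerA cstS invfM mulrAC mulVf ?mul1r ?mulf_neq0 ?pnatr_eq0.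
Qed.

Lemma legendreP1 : P 1 = 'X.
Proof. by rewrite PSE expr0 mulr1 /derivn/= /cst expr0 mul1r invr1 scale1r. Qed.

(* the antiderivative of P_(l+1) given by Rodrigues' formula, normalised alike;
   eliminating it between two expressions of P_(l+2) yields the recurrence *)
Let U l : {poly R} := (cst l.+1)^-1 *: derivn l (w ^+ l.+1).

Let derivU l : (U l)^`() = P l.+1.
Proof. by rewrite /U derivZ -derivnS. Qed.

Let legendre_U1 l : P l.+2 = 'X * P l.+1 + l.+1%:R *: U l.
Proof.
rewrite PSE derivnMX scalerDr scalerAr; congr (_ + _).
by rewrite /U !scalerA mulrC.
Qed.

Let legendre_U2 l : P l.+2 = (2 * l.+1%:R + 1) *: U l + P l.
Proof.
rewrite PE derivSn derivwX derivSn derivZ derivnZ scalerA derivM derivX mul1r derivwX.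
have -> : 'X * ((2 * l.+1%:R) *: ('X * w ^+ l)) =
          (2 * l.+1%:R) *: w ^+ l.+1 + (2 * l.+1%:R) *: w ^+ l.
  have -> : w ^+ l.+1 = 'X * ('X * w ^+ l) - w ^+ l.
    by rewrite exprS {1}/w mulrBl mul1r expr2 mulrA.
  by rewrite -scalerDr subrK -scalerAr.
rewrite addrA -{1}[w ^+ l.+1]scale1r -scalerDl [1 + _]addrC derivnD !derivnZ.
rewrite scalerDr !scalerA PE !cstS.
have h1 := cst_neq0 l; have h2 : 2 * l.+1%:R != 0 :> R by rewrite mulf_neq0 ?pnatr_eq0.
have h3 : 2 * l.+2%:R != 0 :> R by rewrite mulf_neq0 ?pnatr_eq0.
by congr (_ *: _ + _ *: _); field; rewrite h1 nat1r -natrD !pnatr_eq0.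
Qed.

Lemma legendreP_rec l :
  l.+2%:R *: P l.+2 = (2 * l.+1%:R + 1) *: ('X * P l.+1) - l.+1%:R *: P l.
Proof.
have h1 := legendre_U1 l; have h2 := legendre_U2 l.
have {}h1 : (2 * l.+1%:R + 1) *: P l.+2 =
  (2 * l.+1%:R + 1) *: ('X * P l.+1) + l.+1%:R *: (P l.+2 - P l).
  by rewrite {1}h1 h2 addrK scalerDr !scalerA [(_ + 1) * _]mulrC.
apply/eqP; rewrite -subr_eq0; apply/eqP.
rewrite -[l.+2%:R]natr1.
move: h1 => /eqP; rewrite -subr_eq0 => /eqP <-.
by rewrite -!mul_polyC !polyCD !polyCM; ring.
Qed.

(** Exactness makes the integral of P_(l+1) over [-1, 1] a difference of
endpoint values, which are powers of -1. *)
Lemma legendreP_deriv l :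
  (2 * l.+1%:R + 1) *: P l.+1 = (P l.+2 - P l)^`().
Proof. by rewrite legendre_U2 addrK derivZ derivU. Qed.

Lemma legendreP_horner_rec l x :
  l.+2%:R * (P l.+2).[x] =
  (2 * l.+1%:R + 1) * (x * (P l.+1).[x]) - l.+1%:R * (P l).[x].
Proof.
have /(congr1 (fun p => p.[x])) := legendreP_rec l.
by rewrite !(hornerE, hornerZ).
Qed.

(* A Turan-type quadratic form.  It equals
   (1 - x^2) P_(l+1)^2 + (x P_(l+1) - P_l)^2, and the recurrence shows that
   passing from l to l + 1 shrinks the last square by ((l+1) / (l+2))^2. *)
Let E l x := (P l).[x] ^+ 2 - 2 * x * (P l).[x] * (P l.+1).[x] + (P l.+1).[x] ^+ 2.

Let E_le l x : E l x <= 1 - x ^+ 2.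
Proof.
elim: l => [|l IH].
  by rewrite /E legendreP0 legendreP1 !hornerE; lra.
apply: le_trans IH; rewrite /E.
have := legendreP_horner_rec l x.
set a := (P l).[x]; set b := (P l.+1).[x]; set c := (P l.+2).[x] => h.
have n0 : l.+2%:R != 0 :> R by rewrite pnatr_eq0.
have n0' : 0 < l.+2%:R :> R by rewrite ltr0n.
have -> : c = x * b + l.+1%:R / l.+2%:R * (x * b - a).
  by apply: (mulfI n0); rewrite h; field; rewrite -natrD pnatr_eq0.
set r := l.+1%:R / l.+2%:R.
have r0 : 0 <= r by rewrite divr_ge0.
have r1 : r <= 1 by rewrite ler_pdivrMr// mul1r ler_nat.
have -> : b ^+ 2 - 2 * x * b * (x * b + r * (x * b - a)) + (x * b + r * (x * b - a)) ^+ 2 =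
  (1 - x ^+ 2) * b ^+ 2 + r ^+ 2 * (x * b - a) ^+ 2 by ring.
have -> : a ^+ 2 - 2 * x * a * b + b ^+ 2 =
  (1 - x ^+ 2) * b ^+ 2 + (x * b - a) ^+ 2 by ring.
by rewrite lerD2l ler_piMl ?sqr_ge0// expr_le1.
Qed.

Lemma horner_legendreP1 l : (P l).[1] = 1.
Proof.
suff : (P l).[1] = 1 /\ (P l.+1).[1] = 1 by case.
elim: l => [|l [IH1 IH2]].
  by rewrite legendreP0 legendreP1 !hornerE.
split=> //; have n0 : l.+2%:R != 0 :> R by rewrite pnatr_eq0.
apply: (mulfI n0); rewrite legendreP_horner_rec IH1 IH2 -[l.+2%:R]natr1; ring.
Qed.

Lemma horner_legendrePN1 l : (P l).[-1] = (-1) ^+ l.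
Proof.
suff : (P l).[-1] = (-1) ^+ l /\ (P l.+1).[-1] = (-1) ^+ l.+1 by case.
elim: l => [|l [IH1 IH2]].
  by rewrite legendreP0 legendreP1 !hornerE.
split=> //; have n0 : l.+2%:R != 0 :> R by rewrite pnatr_eq0.
apply: (mulfI n0); rewrite legendreP_horner_rec IH1 IH2 -[l.+2%:R]natr1 !exprS; ring.
Qed.

(** The quadratic form E l x dominates (1 - x^2) P_l(x)^2 and is at most
1 - x^2. *)
Lemma legendreP_le1 l x : -1 <= x <= 1 -> `|(P l).[x]| <= 1.
Proof.
move=> /andP[x1 x2].
have [->|xN1] := eqVneq x (-1); first by rewrite horner_legendrePN1 normrX normrN1 expr1n.
have [->|xn1] := eqVneq x 1; first by rewrite horner_legendreP1 normr1.
have {}x1 : -1 < x by rewrite lt_neqAle eq_sym xN1.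
have {}x2 : x < 1 by rewrite lt_neqAle xn1.
have x0 : 0 < 1 - x ^+ 2.
  have -> : 1 - x ^+ 2 = (1 - x) * (1 + x) by ring.
  by rewrite mulr_gt0//; lra.
rewrite -(@expr_le1 _ 2)// real_normK ?num_real//.
rewrite -(ler_pM2l x0) mulr1; apply: le_trans (E_le l x).
rewrite /E -subr_ge0.
have -> : (P l).[x] ^+ 2 - 2 * x * (P l).[x] * (P l.+1).[x] + (P l.+1).[x] ^+ 2 -
  (1 - x ^+ 2) * (P l).[x] ^+ 2 = (x * (P l).[x] - (P l.+1).[x]) ^+ 2
  by ring.
exact: sqr_ge0.
Qed.

(** By the bound on the quadratic form, P_l - x P_(l+1) is of size
sqrt(1 - x^2); what is left, (1 - x) P_(l+1), is at most a multiple of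
sqrt(1 - x). *)
Lemma legendrePB_le l x : -1 <= x <= 1 ->
  `|(P l).[x] - (P l.+1).[x]| <= 4 * Num.sqrt (1 - x).
Proof.
move=> x1; have := E_le l x; have := legendreP_le1 l.+1 x1.
rewrite /E; set a := (P l).[x]; set b := (P l.+1).[x] => hb hE.
move/andP: x1 => [x1 x2].
have s0 : 0 <= 1 - x by lra.
rewrite -(@ler_pXn2r _ 2) ?nnegrE ?mulr_ge0 ?sqrtr_ge0//.
rewrite exprMn sqr_sqrtr// real_normK ?num_real//.
have b2 : b ^+ 2 <= 1.
  by rewrite -(real_normK (num_real b)) expr_le1.
have h1 : (a - x * b) ^+ 2 <= 1 - x ^+ 2.
  apply: le_trans hE; rewrite -subr_ge0.
  have -> : a ^+ 2 - 2 * x * a * b + b ^+ 2 - (a - x * b) ^+ 2 = ((1 - x) * (1 + x)) * b ^+ 2 by ring.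
  by rewrite mulr_ge0 ?sqr_ge0// mulr_ge0//; lra.
have h2 : ((1 - x) * b) ^+ 2 <= 2 * (1 - x).
  rewrite exprMn; apply: (@le_trans _ _ ((1 - x) ^+ 2)).
    by rewrite ler_piMr ?sqr_ge0.
  by rewrite expr2 ler_pM//; lra.
have h3 : 1 - x ^+ 2 <= 2 * (1 - x).
  have -> : 1 - x ^+ 2 = (1 + x) * (1 - x) by ring.
  by rewrite ler_pM//; lra.
have h4 : 0 <= ((a - x * b) + (1 - x) * b) ^+ 2 by exact: sqr_ge0.
have h5 : (a - b) ^+ 2 <= 2 * (a - x * b) ^+ 2 + 2 * ((1 - x) * b) ^+ 2.
  rewrite -subr_ge0.
  have -> : 2 * (a - x * b) ^+ 2 + 2 * ((1 - x) * b) ^+ 2 - (a - b) ^+ 2 =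
    ((a - x * b) + (1 - x) * b) ^+ 2 by ring.
  exact: h4.
by apply: le_trans h5 _; lra.
Qed.

(* Both sides are the coefficient of h^l in
   w(x + h)^l = (w(x) + h (2 x + h))^l. *)
Let nderivw l x : (w ^+ l)^`N(l).[x] =
  \sum_(i < l.+1) ('C(l, i) * 'C(l - i, i))%:R * w.[x] ^+ i * (2 * x) ^+ (l - i - i).
Proof.
have : \sum_(i < size (w ^+ l)) (w ^+ l)^`N(i).[x] *: 'X^i =
   \sum_(i < l.+1) (w.[x]%:P ^+ (l - i) * ('X^i * ((2 * x)%:P + 'X) ^+ i)) *+ 'C(l, i).
  apply: horner_inj => h.
  have -> : \sum_(i < l.+1) (w.[x]%:P ^+ (l - i) * ('X^i * ((2 * x)%:P + 'X) ^+ i)) *+ 'C(l, i)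
     = (w.[x]%:P + 'X * ((2 * x)%:P + 'X)) ^+ l.
    by rewrite exprDn; apply: eq_bigr => i _; rewrite exprMn.
  transitivity ((w ^+ l).[x + h]).
    rewrite (nderiv_taylor _ (mulrC _ _)) horner_sum; apply: eq_bigr => i _.
    by rewrite hornerZ hornerXn.
  rewrite !horner_exp; congr (_ ^+ l).
  by rewrite /w !hornerE; ring.
move=> /(congr1 (fun p => p`_l)).
rewrite coef_sum.
have -> : \sum_(i < size (w ^+ l)) ((w ^+ l)^`N(i).[x] *: 'X^i)`_l = (w ^+ l)^`N(l).[x].
  have sz : (l < size (w ^+ l))%N.
    have ws : size w = 3 by rewrite /w size_XnsubC.
    have := size_exp w l; rewrite ws /= => sl.
    have : (0 < size (w ^+ l))%N by rewrite size_poly_gt0 expf_neq0 -?size_poly_gt0 ?ws.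
    by move: sl; case: size => // k /= -> _; rewrite ltnS leq_pmull.
  rewrite (bigD1 (Ordinal sz)) //= coefZ coefXn eqxx mulr1 big1 ?addr0// => i /eqP ni.
  rewrite coefZ coefXn; case: eqP => [li|]; last by rewrite mulr0.
  by exfalso; apply: ni; apply/val_inj.
move=> ->; rewrite coef_sum (reindex_inj rev_ord_inj) /=; apply: eq_bigr => i _.
have il : (i <= l)%N by rewrite -ltnS.
rewrite subSS subKn// bin_sub// coefMn -polyC_exp coefCM coefXnM ltnNge leq_subr /= subKn//.
have -> : (((2 * x)%:P + 'X) ^+ (l - i))`_i = (2 * x) ^+ (l - i - i) *+ 'C(l - i, i).
  rewrite exprDn coef_sum.
  have [ii|ii] := leqP i (l - i); last first.
    rewrite bin_small// mulr0n big1// => j _.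
    rewrite coefMn -polyC_exp coefCM coefXn; case: eqP => [E1|]; last by rewrite mulr0 mul0rn.
    by have := ltn_ord j; rewrite -E1 ltnS leqNgt ii.
  rewrite (bigD1 (Ordinal (ii : (i < (l - i).+1)%N)))//= coefMn -polyC_exp coefCM coefXn eqxx mulr1.
  rewrite big1 ?addr0// => j /eqP ji.
  rewrite coefMn -polyC_exp coefCM coefXn; case: eqP => [E1|]; last by rewrite mulr0 mul0rn.
  by exfalso; apply: ji; apply/val_inj.
by rewrite mulrnAr -mulrnA -[LHS]mulr_natr !natrM; ring.
Qed.

(** Laplace's integral of (x + sqrt(x^2 - 1) cos(t))^l, expanded by the binomial
formula: odd powers of the cosine have mean zero.  It is this form of P_l that
appears when a power of one coordinate on the sphere is averaged around
another axis. *)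
Lemma legendreP_laplace l x : (P l).[x] =
  \sum_(i < l./2.+1) 'C(l, i.*2)%:R * cos_moment R i * (x ^+ 2 - 1) ^+ i * x ^+ (l - i.*2).
Proof.
rewrite PE nderivn_def hornerZ hornerMn nderivw.
have -> : (cst l)^-1 * ((\sum_(i < l.+1) ('C(l, i) * 'C(l - i, i))%:R * w.[x] ^+ i *
    (2 * x) ^+ (l - i - i)) *+ l`!) =
  (2 ^+ l)^-1 * \sum_(i < l.+1) ('C(l, i) * 'C(l - i, i))%:R * w.[x] ^+ i *
    (2 * x) ^+ (l - i - i).
  have f0 : l`!%:R != 0 :> R by rewrite pnatr_eq0 -lt0n fact_gt0.
  have e0 : 2 ^+ l != 0 :> R by rewrite expf_neq0 ?pnatr_eq0.
  by rewrite -[_ *+ l`!]mulr_natr /cst; field; rewrite e0 f0.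
have lE : (l./2.+1 <= l.+1)%N by rewrite ltnS leq_half_double -addnn -addnS leq_addr.
rewrite -(big_mkord xpredT (fun i => ('C(l, i) * 'C(l - i, i))%:R * w.[x] ^+ i *
    (2 * x) ^+ (l - i - i))) (big_cat_nat _ lE)//= [X in _ + X]big_nat_cond [X in _ + X]big1 ?addr0; last first.
  move=> i; rewrite andbT => /andP[li il].
  rewrite (@bin_small (l - i)) ?muln0 ?mul0r//.
  by lia.
rewrite big_mkord mulr_sumr; apply: eq_bigr => i _.
have i2 : (i.*2 <= l)%N by rewrite -geq_half_double -ltnS.
have -> : ('C(l, i) * 'C(l - i, i) = 'C(l, i.*2) * 'C(i.*2, i))%N.
  have il : (i <= l)%N by rewrite (leq_trans _ i2)// -addnn leq_addr.
  have h1 := bin_fact il; have h2 := bin_fact i2.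
  have /bin_fact h3 : (i <= l - i)%N by rewrite leq_subRL// addnn.
  have /bin_fact h4 : (i <= i.*2)%N by rewrite -addnn leq_addr.
  have e1 : (i.*2 - i = i)%N by rewrite -addnn addnK.
  have e2 : (l - i - i = l - i.*2)%N by rewrite -subnDA addnn.
  rewrite e1 in h4; rewrite e2 in h3.
  apply/eqP; rewrite -(@eqn_pmul2r (i`! * (i`! * (l - i.*2)`!))) ?muln_gt0 ?fact_gt0//.
  apply/eqP; transitivity l`!; first by rewrite -h1 -h3; ring.
  by rewrite -h2 -h4; ring.
have -> : w.[x] = x ^+ 2 - 1 by rewrite /w !hornerE expr2.
rewrite /cos_moment -subnDA addnn exprMn natrM.
have -> : 2 ^+ l = 2 ^+ (l - i.*2) * 4 ^+ i :> R.
  rewrite -[in LHS](subnK i2) exprD -mul2n exprM; congr (_ * _ ^+ _); ring.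
have e1 : 2 ^+ (l - i.*2) != 0 :> R by rewrite expf_neq0 ?pnatr_eq0.
have e2 : 4 ^+ i != 0 :> R by rewrite expf_neq0 ?pnatr_eq0.
by field; rewrite e1 e2.
Qed.

End Legendre.

(** * Orthogonality on the segment, algebraically *)

Section Moment.
Variable R : realType.
Implicit Types (p q : {poly R}) (l m n : nat).

Definition moment n : R := (1 - (-1) ^+ n.+1) / n.+1%:R.

(** The integral of p over [-1, 1], as an algebraic functional: orthogonality of
the Legendre polynomials needs linearity and the fundamental theorem for
polynomials only. *)
Definition mom p : R := \sum_(i < size p) p`_i * moment i.

Lemma mom_wide n p : (size p <= n)%N -> mom p = \sum_(i < n) p`_i * moment i.
Proof.
move=> pn; rewrite /mom (big_ord_widen _ (fun i => p`_i * moment i) pn).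
rewrite big_mkcond /=; apply: eq_bigr => i _.
by case: ltnP => // /(nth_default 0) ->; rewrite mul0r.
Qed.

Lemma momD p q : mom (p + q) = mom p + mom q.
Proof.
rewrite (mom_wide (size_polyD p q)) (mom_wide (leq_maxl (size p) (size q))).
rewrite (mom_wide (leq_maxr (size p) (size q))) -big_split /=.
by apply: eq_bigr => i _; rewrite coefD mulrDl.
Qed.

Lemma momZ (c : R) p : mom (c *: p) = c * mom p.
Proof.
rewrite (mom_wide (size_scale_leq c p)) /mom mulr_sumr.
by apply: eq_bigr => i _; rewrite coefZ -mulrA.
Qed.

Lemma momB p q : mom (p - q) = mom p - mom q.
Proof. by rewrite -[- q]scaleN1r momD momZ mulN1r. Qed.

Lemma mom0 : mom 0 = 0.
Proof. by rewrite /mom size_poly0 big_ord0. Qed.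

Lemma mom_sum I (r : seq I) (F : I -> {poly R}) :
  mom (\sum_(i <- r) F i) = \sum_(i <- r) mom (F i).
Proof. exact: (big_morph mom momD mom0). Qed.

Lemma momXn n : mom 'X^n = moment n.
Proof.
rewrite (@mom_wide n.+1) ?size_polyXn// big_ord_recr /= coefXn eqxx mul1r.
by rewrite big1 ?add0r// => i _; rewrite coefXn ltn_eqF ?mul0r.
Qed.

Lemma mom1 : mom 1 = 2.
Proof. by rewrite -(expr0 'X) momXn /moment expr1 opprK divr1. Qed.

Lemma mom_deriv p : mom p^`() = p.[1] - p.[-1].
Proof.
rewrite -[p]coefK poly_def linear_sum /= mom_sum !horner_sum -sumrB.
apply: eq_bigr => i _; rewrite derivZ momZ !hornerZ -mulrBr; congr (_ * _).
rewrite !hornerXn expr1n derivXn; case: (nat_of_ord i) => [|k].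
  by rewrite mulr0n mom0 expr0 subrr.
by rewrite -scaler_nat momZ momXn /moment mulrC divfK// pnatr_eq0.
Qed.

End Moment.

Section RecurrenceOrthogonality.
Variables (R : realType) (P : nat -> {poly R}).
Hypotheses (P0E : P 0 = 1) (P1E : P 1 = 'X).
Hypothesis rec : forall l,
  l.+2%:R *: P l.+2 = (2 * l.+1%:R + 1) *: ('X * P l.+1) - l.+1%:R *: P l.
Hypothesis momP : forall l, mom (P l.+1) = 0.

Let momlin (a b : R) (p q : {poly R}) : mom (a *: p + b *: q) = a * mom p + b * mom q.
Proof. by rewrite momD 2!momZ. Qed.

Let XPE l : (2 * l.+1%:R + 1) *: ('X * P l.+1) = l.+2%:R *: P l.+2 + l.+1%:R *: P l.
Proof. by rewrite rec subrK. Qed.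

(** The recurrence makes multiplication by X symmetric and tridiagonal, which
reduces the integral of P_l P_(m+2) to those of P_(l+-1) P_(m+1) and P_l P_m. *)
Lemma mom_orth_rec m : forall l, (m < l)%N -> mom (P l * P m) = 0.
Proof.
suff : (forall l, (m < l)%N -> mom (P l * P m) = 0) /\
  (forall l, (m.+1 < l)%N -> mom (P l * P m.+1) = 0) by case.
elim: m => [|m [IH1 IH2]].
  split=> [[|l]//|[|[|l]]//] _; first by rewrite P0E mulr1 momP.
  have n0 : 2 * l.+2%:R + 1 != 0 :> R by rewrite -natrM natr1 pnatr_eq0.
  apply: (mulfI n0); rewrite mulr0 P1E [_ * 'X]mulrC -momZ XPE momlin.
  by rewrite !momP !mulr0 addr0.
split=> // -[//|l] lm.
have n0 : 2 * l.+1%:R + 1 != 0 :> R by rewrite -natrM natr1 pnatr_eq0.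
have n1 : m.+2%:R != 0 :> R by rewrite pnatr_eq0.
apply: (mulfI n1); rewrite mulr0 -momZ scalerAr rec mulrBr -!scalerAr -scaleNr momlin IH1 ?mulr0 ?addr0; last by rewrite -ltnS ltnW// ltnW.
have -> : mom (P l.+1 * ('X * P m.+1)) = 0.
  apply: (mulfI n0); rewrite mulr0 mulrCA mulrA -momZ scalerAl XPE.
  rewrite mulrDl -!scalerAl momlin !IH2 ?mulr0 ?addr0//; lia.
by rewrite mulr0.
Qed.

Lemma mom_sqr_rec l : (2 * l%:R + 1) * mom (P l ^+ 2) = 2.
Proof.
elim: l => [|l IH]; first by rewrite P0E expr1n mom1; ring.
have n1 : l.+1%:R != 0 :> R by rewrite pnatr_eq0.
apply: (mulfI n1).
rewrite -[X in _ = _ * X]IH.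
have e0 : 2 * l.+1%:R + 1 != 0 :> R by rewrite -natrM natr1 pnatr_eq0.
(* X P_l P_(l+1) is integrated in two ways, expanding X P_l or X P_(l+1) *)
have h : (2 * l.+1%:R + 1) * mom ('X * P l.+1 * P l) = l.+1%:R * mom (P l ^+ 2).
  rewrite -momZ scalerAl XPE mulrDl -!scalerAl momlin mom_orth_rec// mulr0 add0r.
  by rewrite expr2.
have h2 : l.+1%:R * mom (P l.+1 ^+ 2) = (2 * l%:R + 1) * mom ('X * P l.+1 * P l).
  rewrite expr2; case: l {IH n1 e0 h} => [|l].
    by rewrite P1E P0E mulr1; ring.
  rewrite -!momZ scalerAr rec mulrBr -!scalerAr -scaleNr momlin.
  by rewrite mom_orth_rec// mulr0 addr0 momZ mulrA [P _ * 'X]mulrC.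
by rewrite mulrCA h2 mulrCA h; ring.
Qed.

End RecurrenceOrthogonality.

Section LegendreMoment.
Variable R : realType.
Implicit Types (p q : {poly R}) (l m n : nat).
Let P := legendreP R.

Lemma size_legendreP l : size (P l) = l.+1.
Proof.
suff : (size (P l) = l.+1) /\ (size (P l.+1) = l.+2) by case.
elim: l => [|l [IH1 IH2]]; first by rewrite /P legendreP0 legendreP1 size_poly1 size_polyX.
split=> //.
have n0 : l.+2%:R != 0 :> R by rewrite pnatr_eq0.
have n1 : 2 * l.+1%:R + 1 != 0 :> R by rewrite -natrM natr1 pnatr_eq0.
have s1 : size ((2 * l.+1%:R + 1) *: ('X * P l.+1)) = l.+3.
  by rewrite size_scale// mulrC size_mulX -?size_poly_gt0 IH2.
have s2 : size (- (l.+1%:R *: P l)) = l.+1.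
  by rewrite size_polyN size_scale ?pnatr_eq0.
by rewrite -(size_scale _ n0) legendreP_rec size_polyDl ?s1 ?s2.
Qed.

(** P_0, ..., P_(n-1) span the polynomials of degree less than n, as their
degrees are consecutive. *)
Lemma legendreP_ind (Q : {poly R} -> Prop) n :
  Q 0 -> (forall c p q, Q p -> Q q -> Q (c *: p + q)) ->
  (forall l, (l < n)%N -> Q (P l)) -> forall p, (size p <= n)%N -> Q p.
Proof.
move=> Q0 Qlin; elim: n => [|n IH] QP p pn.
  by move: pn; rewrite leqn0 size_poly_eq0 => /eqP ->.
have sP := size_legendreP n.
have lP : lead_coef (P n) != 0 by rewrite lead_coef_eq0 -size_poly_gt0 sP.
pose c := p`_n / lead_coef (P n).
rewrite -(subrK (c *: P n) p) addrC; apply: Qlin; first exact: QP.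
apply: IH => [l ln|]; first by apply: QP; rewrite ltnW// ltnS.
apply/leq_sizeP => j; rewrite leq_eqVlt => /orP[/eqP <-|nj].
  rewrite coefB coefZ.
  have -> : (P n)`_n = lead_coef (P n) by rewrite lead_coefE sP.
  by rewrite /c divfK ?subrr.
by rewrite coefB coefZ !nth_default ?mulr0 ?subrr// ?sP// (leq_trans pn).
Qed.

Lemma mom_legendreP l : mom (P l.+1) = 0.
Proof.
have n0 : 2 * l.+1%:R + 1 != 0 :> R by rewrite -natrM natr1 pnatr_eq0.
apply: (mulfI n0); rewrite mulr0 -momZ legendreP_deriv mom_deriv.
by rewrite !hornerD !hornerN !horner_legendreP1 !horner_legendrePN1 !exprS; ring.
Qed.

Lemma mom_legendreP_lt l q : (size q <= l)%N -> mom (P l * q) = 0.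
Proof.
move=> ql; apply: (@legendreP_ind (fun q => mom (P l * q) = 0) l) => //.
- by rewrite mulr0 mom0.
- by move=> c p1 p2 h1 h2; rewrite mulrDr momD -scalerAr momZ h1 h2 mulr0 addr0.
- move=> m; exact: (mom_orth_rec (legendreP0 R) (legendreP1 R) (@legendreP_rec R) mom_legendreP).
Qed.

Lemma mom_legendreP_sqr l : (2 * l%:R + 1) * mom (P l ^+ 2) = 2.
Proof.
exact: (mom_sqr_rec (legendreP0 R) (legendreP1 R) (@legendreP_rec R) mom_legendreP).
Qed.

End LegendreMoment.

(** * The sphere: measurability, rotations and integrals *)

Lemma continuous_mx (K : numFieldType) (T : topologicalType) m n
  (f : T -> 'M[K]_(m, n)) :
  (forall i j, continuous (fun x => f x i j)) -> continuous f.
Proof.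
move=> cf x U /= [P hP sPU]; apply: (filterS (P := fun y => forall i j, P i j (f y i j))).
  by move=> y Py; apply: sPU.
apply: filter_forall => i; apply: filter_forall => j.
exact: (cf i j x (P i j) (hP i j)).
Qed.

Lemma det3 (F : comNzRingType) (A : 'M[F]_3) (o := @Ordinal 3) :
  \det A =
    A 0 0 * (A 1 1 * A (o 2 isT) (o 2 isT) - A 1 (o 2 isT) * A (o 2 isT) 1)
  - A 0 1 * (A 1 0 * A (o 2 isT) (o 2 isT) - A 1 (o 2 isT) * A (o 2 isT) 0)
  + A 0 (o 2 isT) * (A 1 0 * A (o 2 isT) 1 - A 1 1 * A (o 2 isT) 0).
Proof.
pose a i j := A (inord i) (inord j).
have aE i j : A i j = a i j by rewrite /a !inord_val.
rewrite (expand_det_row _ ord0) !big_ord_recl big_ord0 /cofactor.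
rewrite !(expand_det_row _ ord0) !big_ord_recl !big_ord0 /cofactor.
by rewrite !det_mx11 !mxE !aE /= /bump /=; ring.
Qed.

Section SphereBasics.
Variable R : realType.
Implicit Types (x y : sphere R) (f g : sphere R -> R).

Lemma sphereP x : dotp (set_val x) (set_val x) = 1.
Proof. exact: (set_valP x). Qed.

Lemma sdotC x y : sdot x y = sdot y x.
Proof. by apply: eq_bigr => i _; rewrite mulrC. Qed.

Lemma dotp3 (u v : 'rV[R]_3) :
  dotp u v = u 0 0 * v 0 0 + u 0 1 * v 0 1 + u 0 (@Ordinal 3 2 isT) * v 0 (@Ordinal 3 2 isT).
Proof.
rewrite /dotp !big_ord_recl big_ord0 addr0 -addrA.
by congr (_ + (_ + _)); congr (_ * _); congr (fun_of_matrix _ _ _); apply/val_inj.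
Qed.

Lemma sdot_sqr_le1 x y : sdot x y ^+ 2 <= 1.
Proof.
have := sphereP x; have := sphereP y; rewrite /sdot !dotp3.
set a := set_val x 0 0; set b := set_val x 0 1; set c := set_val x 0 _.
set a' := set_val y 0 0; set b' := set_val y 0 1; set c' := set_val y 0 _.
move=> h1 h2; rewrite -subr_ge0.
have -> : 1 - (a * a' + b * b' + c * c') ^+ 2 =
  (a' * a' + b' * b' + c' * c') * (a * a + b * b + c * c) - (a * a' + b * b' + c * c') ^+ 2.
  by rewrite h1 h2 mulr1.
have -> : (a' * a' + b' * b' + c' * c') * (a * a + b * b + c * c) - (a * a' + b * b' + c * c') ^+ 2
  = (a * b' - b * a') ^+ 2 + (a * c' - c * a') ^+ 2 + (b * c' - c * b') ^+ 2 by ring.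
by rewrite !addr_ge0 ?sqr_ge0.
Qed.

Lemma sdot_itv x y : -1 <= sdot x y <= 1.
Proof.
by rewrite -ler_norml -(@expr_le1 _ 2)// real_normK ?num_real// sdot_sqr_le1.
Qed.

Lemma continuous_sphere_coord (i : 'I_3) : continuous (fun x => (set_val x : 'rV[R]_3) 0 i).
Proof.
move=> x; apply: (@continuous_comp (sphere R) 'rV[R]_3 R set_val (fun M => M 0 i)).
  exact: initial_continuous.
exact: coord_continuous.
Qed.

Lemma continuous_dotp (v : 'rV[R]_3) : continuous (fun x => dotp (set_val x) v).
Proof.
rewrite (_ : (fun x => _) = (fun x => (set_val x : 'rV[R]_3) 0 0 * v 0 0
    + (set_val x : 'rV[R]_3) 0 1 * v 0 1
    + (set_val x : 'rV[R]_3) 0 (@Ordinal 3 2 isT) * v 0 (@Ordinal 3 2 isT))).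
  move=> x; have h i c : (fun y : sphere R => (set_val y : 'rV[R]_3) 0 i * c) @ x
      --> (set_val x : 'rV[R]_3) 0 i * c.
    exact: (cvgM (@continuous_sphere_coord i x) (@cvg_cst _ c _ _ _)).
  exact: (cvgD (cvgD (h _ _) (h _ _)) (h _ _)).
by apply/funext => x; rewrite dotp3.
Qed.

Lemma measurable_continuous_sphere f :
  continuous f -> measurable_fun [set: sphere R] f.
Proof.
move=> /continuousP cf; apply: (measurability _ (RGenOpens.measurableE R)).
move=> _ [_ [a [b ->]] <-]; rewrite setTI; apply: sub_sigma_algebra.
by apply: cf; exact: interval_open.
Qed.

(** Bounded measurable functions are integrable for the finite measure sigma and,
unlike integrable ones, closed under products. *)
Definition bmeas f := measurable_fun [set: sphere R] f /\ exists M, forall x, `|f x| <= M.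

Lemma bmeas_cst (c : R) : bmeas (fun=> c).
Proof. by split; [exact: measurable_cst|exists `|c|]. Qed.

Lemma bmeasD f g : bmeas f -> bmeas g -> bmeas (fun x => f x + g x).
Proof.
move=> [mf [M fM]] [mg [N gN]]; split; first exact: measurable_funD.
by exists (M + N) => x; apply: le_trans (ler_normD _ _) _; exact: lerD.
Qed.

Lemma bmeasM f g : bmeas f -> bmeas g -> bmeas (fun x => f x * g x).
Proof.
move=> [mf [M fM]] [mg [N gN]]; split; first exact: measurable_funM.
by exists (M * N) => x; rewrite normrM; exact: ler_pM.
Qed.

Lemma bmeasZ (c : R) f : bmeas f -> bmeas (fun x => c * f x).
Proof. exact: bmeasM (bmeas_cst c). Qed.

Lemma bmeasB f g : bmeas f -> bmeas g -> bmeas (fun x => f x - g x).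
Proof.
move=> bf bg; have := bmeasD bf (bmeasZ (-1) bg).
by under [X in bmeas X -> _]funext do rewrite mulN1r.
Qed.

Lemma bmeasX f n : bmeas f -> bmeas (fun x => f x ^+ n).
Proof.
move=> bf; elim: n => [|n IH]; first exact: bmeas_cst.
by under [X in bmeas X]funext do rewrite exprS; exact: bmeasM.
Qed.

Lemma bmeas_sum I (r : seq I) (F : I -> sphere R -> R) :
  (forall i, bmeas (F i)) -> bmeas (fun x => \sum_(i <- r) F i x).
Proof.
move=> bF; elim: r => [|i r IH].
  by under [X in bmeas X]funext do rewrite big_nil; exact: bmeas_cst.
by under [X in bmeas X]funext do rewrite big_cons; exact: bmeasD.
Qed.

Lemma bmeas_horner (p : {poly R}) f : bmeas f -> bmeas (fun x => p.[f x]).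
Proof.
move=> bf; under [X in bmeas X]funext do rewrite horner_coef.
by apply: bmeas_sum => i; apply: bmeasZ; exact: bmeasX.
Qed.

Lemma bmeas_coord (i : 'I_3) : bmeas (fun x => (set_val x : 'rV[R]_3) 0 i).
Proof.
split; first by apply: measurable_continuous_sphere; exact: continuous_sphere_coord.
exists 1 => x; rewrite -(@expr_le1 _ 2)// real_normK ?num_real//.
have x1 : dotp (set_val x) (set_val x) <= 1 by rewrite sphereP.
apply: le_trans x1.
rewrite /dotp (bigD1 i)//= -expr2 lerDl; apply: sumr_ge0 => j _.
by rewrite -expr2 sqr_ge0.
Qed.

Lemma continuous_sdot y : continuous (fun x => sdot x y).
Proof. exact: continuous_dotp. Qed.

Lemma bmeas_sdot y : bmeas (fun x => sdot x y).
Proof.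
split; first by apply: measurable_continuous_sphere; exact: continuous_sdot.
by exists 1 => x; rewrite ler_norml sdot_itv.
Qed.

Section Rotation.
Variables (Q : 'M[R]_3) (rQ : is_rotation Q).

Lemma sph_rot_subproof x : (set_val x : 'rV[R]_3) *m Q \in [set v : 'rV[R]_3 | dotp v v = 1].
Proof.
rewrite inE /=; have dE (u v : 'rV[R]_3) : dotp u v = (u *m v^T) 0 0.
  by rewrite !mxE; apply: eq_bigr => i _; rewrite mxE.
by rewrite dE trmx_mul mulmxA -(mulmxA _ Q) rQ.1 mulmx1 -dE sphereP.
Qed.

Definition sph_rot x : sphere R := SigSub (sph_rot_subproof x).

Lemma continuous_sph_rot : continuous sph_rot.
Proof.
apply: continuous_comp_initial; apply: continuous_mx => i j.
rewrite (_ : (fun x => _) = (fun x => dotp (set_val x) (\row_k Q k j))).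
  exact: continuous_dotp.
apply/funext => x; rewrite /= !mxE (ord1 i); apply: eq_bigr => k _.
by rewrite mxE.
Qed.

Lemma measurable_sph_rot : measurable_fun [set: sphere R] sph_rot.
Proof.
apply: (measurability (@open (sphere R))) => // _ [U oU <-].
rewrite setTI; apply: sub_sigma_algebra.
by move/continuousP : continuous_sph_rot; apply.
Qed.

End Rotation.

End SphereBasics.

Section SphereIntegral.
Variables (R : realType) (sigma : {measure set (sphere R) -> \bar R}).
Hypothesis sigmaP : is_surface_measure sigma.
Implicit Types (x y : sphere R) (f g : sphere R -> R).

Lemma surface_lty : (sigma [set: sphere R] < +oo)%E.
Proof. by rewrite sigmaP.1 ltry. Qed.

Lemma bmeas_integrable f : bmeas f -> sigma.-integrable [set: sphere R] (EFin \o f).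
Proof.
move=> [mf [M fM]]; apply: measurable_bounded_integrable => //; first exact: surface_lty.
exists M; split; first exact: num_real.
by move=> N MN x _; apply: le_trans (fM x) (ltW MN).
Qed.

Notation I f := (\int[sigma]_x f x).

Lemma sphintD f g : bmeas f -> bmeas g -> I (fun x => f x + g x) = I f + I g.
Proof. by move=> bf bg; rewrite RintegralD//; exact: bmeas_integrable. Qed.

Lemma sphintZ (c : R) f : bmeas f -> I (fun x => c * f x) = c * I f.
Proof. by move=> bf; rewrite RintegralZl//; exact: bmeas_integrable. Qed.

Lemma sphintB f g : bmeas f -> bmeas g -> I (fun x => f x - g x) = I f - I g.
Proof. by move=> bf bg; rewrite RintegralB//; exact: bmeas_integrable. Qed.

Lemma sphint_cst (c : R) : I (fun=> c) = c * (4 * pi).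
Proof. by rewrite Rintegral_cst// sigmaP.1. Qed.

Lemma sphint_sum J (r : seq J) (F : J -> sphere R -> R) :
  (forall j, bmeas (F j)) -> I (fun x => \sum_(j <- r) F j x) = \sum_(j <- r) I (F j).
Proof.
move=> bF; elim: r => [|j r IH].
  under eq_Rintegral do rewrite big_nil.
  by rewrite big_nil sphint_cst mul0r.
under eq_Rintegral do rewrite big_cons.
by rewrite sphintD// ?IH ?big_cons//; exact: bmeas_sum.
Qed.

Lemma sphint_le f (M : R) : bmeas f -> (forall x, `|f x| <= M) -> `|I f| <= M * (4 * pi).
Proof.
move=> bf fM; rewrite -sphint_cst.
apply: le_trans; first by apply: le_normr_Rintegral => //; exact: bmeas_integrable.
apply: le_Rintegral => //.
- have [mf [N fN]] := bf; apply: bmeas_integrable; split.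
    exact: measurableT_comp.
  by exists N => x; rewrite normr_id.
- exact/bmeas_integrable/bmeas_cst.
Qed.

(** The left side is an integral against the image of sigma, which is sigma: a
preimage under Q is an image under its transpose. *)
Lemma sphint_rot (Q : 'M[R]_3) (rQ : is_rotation Q) f : bmeas f ->
  I (fun x => f (sph_rot rQ x)) = I f.
Proof.
move=> bf; rewrite /Rintegral; congr fine.
have [mf _] := bf.
have bfr : bmeas (f \o sph_rot rQ).
  have [_ [M fM]] := bf; split; last by exists M => x; exact: fM.
  by apply: measurableT_comp => //; exact: measurable_sph_rot.
transitivity (\int[pushforward sigma (sph_rot rQ)]_(x in [set: sphere R]) (f x)%:E)%E.
  rewrite (@integral_pushforward _ _ _ _ R _ (measurable_sph_rot rQ) sigma setT (EFin \o f))//.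
  - exact/measurable_EFinP.
  - by rewrite preimage_setT; exact: bmeas_integrable.
apply: eq_measure_integral; first exact: measurable_sph_rot.
move=> mr A mA _.
have QtQ : Q^T *m Q = 1%:M by apply: mulmx1C; exact: rQ.1.
have rQt : is_rotation Q^T by split; [rewrite trmxK QtQ|rewrite det_tr rQ.2].
rewrite /pushforward -(sigmaP.2 Q^T A rQt mA); congr (sigma _).
apply/seteqP; split => x /=.
  move=> Ax; exists (sph_rot rQ x) => //.
  by rewrite /sph_rot [set_val (SigSub _)]/= -mulmxA rQ.1 mulmx1.
move=> [y Ay xy]; suff -> : sph_rot rQ x = y by [].
by apply/val_inj; rewrite /= xy -mulmxA QtQ mulmx1.
Qed.

End SphereIntegral.

(** * Orthonormal frames *)

Section Frames.
Variable R : realType.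
Implicit Types (x y : sphere R) (u v : 'rV[R]_3).

Let o2 : 'I_3 := @Ordinal 3 2 isT.

Let ord3P (i : 'I_3) : [\/ i = 0, i = 1 | i = o2].
Proof.
by case: i => -[|[|[|//]]] p; [apply: Or31|apply: Or32|apply: Or33]; apply/val_inj.
Qed.

Let sum3 (F : 'I_3 -> R) : \sum_i F i = F 0 + F 1 + F o2.
Proof.
rewrite !big_ord_recl big_ord0 addr0 -addrA.
by congr (_ + (_ + _)); congr F; apply/val_inj.
Qed.

Let vec3 (a b c : R) : 'rV[R]_3 := \row_i (if i == 0 then a else if i == 1 then b else c).

Let vec3E a b c : (vec3 a b c 0 0 = a) * (vec3 a b c 0 1 = b) * (vec3 a b c 0 o2 = c).
Proof. by rewrite !mxE. Qed.

(** The third axis is the cross product, which makes the determinant 1. *)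
Lemma exists_frame u v : dotp u u = 1 -> dotp v v = 1 -> dotp u v = 0 ->
  exists2 Q : 'M[R]_3, is_rotation Q &
    forall w : 'rV[R]_3, (w *m Q) 0 0 = dotp w u /\ (w *m Q) 0 1 = dotp w v.
Proof.
rewrite !dotp3.
set a := u 0 0; set b := u 0 1; set c := u 0 _.
set a' := v 0 0; set b' := v 0 1; set c' := v 0 _ => uu vv uv.
pose w := vec3 (b * c' - c * b') (c * a' - a * c') (a * b' - b * a').
pose Q : 'M[R]_3 := \matrix_(i, j) (if j == 0 then u 0 i else if j == 1 then v 0 i else w 0 i).
have ww : (b * c' - c * b') ^+ 2 + (c * a' - a * c') ^+ 2 + (a * b' - b * a') ^+ 2 = 1.
  have -> : (b * c' - c * b') ^+ 2 + (c * a' - a * c') ^+ 2 + (a * b' - b * a') ^+ 2 =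
    (a * a + b * b + c * c) * (a' * a' + b' * b' + c' * c') - (a * a' + b * b' + c * c') ^+ 2
    by ring.
  by rewrite uu vv uv; ring.
exists Q; first split.
- apply: mulmx1C; apply/matrixP => i j; rewrite mxE sum3 ![Q^T _ _]mxE.
  case: (ord3P i) => ->; case: (ord3P j) => ->; rewrite !mxE /= -?/a -?/b -?/c -?/a' -?/b' -?/c' //.
  + ring.
  + by rewrite -[RHS]uv; ring.
  + ring.
  + ring.
  + ring.
- rewrite det3 !mxE /= -/a -/b -/c -/a' -/b' -/c' -ww; ring.
move=> z; split; rewrite mxE /dotp; apply: eq_bigr => i _; by rewrite mxE.
Qed.

Lemma exists_orthogonal u : dotp u u = 1 -> exists2 v, dotp v v = 1 & dotp u v = 0.
Proof.
rewrite dotp3; set a := u 0 0; set b := u 0 1; set c := u 0 _ => uu.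
have [ab0|ab0] := eqVneq (a ^+ 2 + b ^+ 2) 0; last first.
  set s := Num.sqrt (a ^+ 2 + b ^+ 2).
  have s2 : s ^+ 2 = a ^+ 2 + b ^+ 2 by rewrite sqr_sqrtr// addr_ge0 ?sqr_ge0.
  have s0 : s != 0 by apply: contraNneq ab0 => s0; rewrite -s2 s0 expr0n.
  exists (vec3 (- b / s) (a / s) 0); rewrite dotp3 !vec3E; last by rewrite -/a -/b; ring.
  have -> : - b / s * (- b / s) + a / s * (a / s) + 0 * 0 = (a ^+ 2 + b ^+ 2) / s ^+ 2.
    by field.
  by rewrite s2 divff.
move/eqP: ab0; rewrite paddr_eq0 ?sqr_ge0// !sqrf_eq0 => /andP[/eqP a0 /eqP b0].
exists (vec3 1 0 0); rewrite dotp3 !vec3E; first by ring.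
by rewrite -/a a0; ring.
Qed.

Lemma exists_rot01 (a b : R) : a ^+ 2 + b ^+ 2 = 1 ->
  exists2 Q : 'M[R]_3, is_rotation Q &
    forall w : 'rV[R]_3, (w *m Q) 0 0 = a * w 0 0 + b * w 0 1.
Proof.
move=> ab; have [|||Q rQ QE] := @exists_frame (vec3 a b 0) (vec3 (- b) a 0).
- by rewrite dotp3 !vec3E -ab; ring.
- by rewrite dotp3 !vec3E -ab; ring.
- by rewrite dotp3 !vec3E; ring.
by exists Q => // w; have [-> _] := QE w; rewrite dotp3 !vec3E; ring.
Qed.

Lemma exists_rot12 (a b : R) : a ^+ 2 + b ^+ 2 = 1 ->
  exists2 Q : 'M[R]_3, is_rotation Q &
    forall w : 'rV[R]_3, (w *m Q) 0 0 = w 0 0 /\ (w *m Q) 0 1 = a * w 0 1 + b * w 0 o2.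
Proof.
move=> ab; have [|||Q rQ QE] := @exists_frame (vec3 1 0 0) (vec3 0 a b).
- by rewrite dotp3 !vec3E; ring.
- by rewrite dotp3 !vec3E -ab; ring.
- by rewrite dotp3 !vec3E; ring.
by exists Q => // w; have [-> ->] := QE w; rewrite !dotp3 !vec3E; split; ring.
Qed.

(** Gram-Schmidt on the pair (x, y).  When the points are collinear the second
axis is arbitrary and r = 0. *)
Lemma exists_rot_pair x y :
  exists2 Q : 'M[R]_3, is_rotation Q & exists2 r : R, r ^+ 2 = 1 - sdot x y ^+ 2 &
    forall w : 'rV[R]_3, dotp w (set_val x) = (w *m Q) 0 0 /\
      dotp w (set_val y) = sdot x y * (w *m Q) 0 0 + r * (w *m Q) 0 1.
Proof.
set t := sdot x y; set u := set_val x; set v := set_val y.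
have uu : dotp u u = 1 by exact: sphereP.
have vv : dotp v v = 1 by exact: sphereP.
have uv : dotp u v = t by [].
have t1 : 0 <= 1 - t ^+ 2 by rewrite subr_ge0 sdot_sqr_le1.
set r := Num.sqrt (1 - t ^+ 2).
have r2 : r ^+ 2 = 1 - t ^+ 2 by rewrite sqr_sqrtr.
have dE (a b c : 'rV[R]_3) (k l : R) : dotp a (k *: b + l *: c) = k * dotp a b + l * dotp a c.
  by rewrite !dotp3 !mxE; ring.
have dC (a b : 'rV[R]_3) : dotp a b = dotp b a by apply: eq_bigr => i _; rewrite mulrC.
have [r0|r0] := eqVneq r 0.
  have [z zz uz] := exists_orthogonal uu.
  have [Q rQ QE] := exists_frame uu zz uz.
  exists Q => //; exists r => // w; have [-> _] := QE w; split=> //.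
  have vE : v = t *: u.
    have : dotp (v - t *: u) (v - t *: u) = 0.
      have -> : v - t *: u = 1 *: v + (- t) *: u by rewrite scale1r scaleNr.
      rewrite dE ![dotp (_ + _) _]dC !dE uu vv [dotp v u]dC uv.
      by rewrite r0 expr0n /= in r2; rewrite -[RHS]/(0%R) (_ : 0 = 1 - t ^+ 2)//; ring.
    move=> h; apply/eqP; rewrite -subr_eq0; apply/eqP/rowP => i; rewrite [RHS]mxE.
    move/eqP: h; rewrite psumr_eq0 => [|j _]; last by rewrite -expr2 sqr_ge0.
    by move=> /allP/(_ i); rewrite mem_index_enum => /(_ isT); rewrite -expr2 sqrf_eq0 => /eqP.
  by rewrite r0 mul0r addr0 vE -[t *: u]addr0 -(scale0r u) dE mul0r addr0.
pose z := (- t / r) *: u + r^-1 *: v.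
have uz : dotp u z = 0 by rewrite dE uu uv; field.
have zz : dotp z z = 1.
  rewrite dE ![dotp z _]dC uz mulr0 add0r dE [dotp v u]dC uv vv.
  have -> : r^-1 * (- t / r * t + r^-1 * 1) = (1 - t ^+ 2) / r ^+ 2 by field.
  by rewrite r2 divff// -r2 expf_neq0.
have [Q rQ QE] := exists_frame uu zz uz.
exists Q => //; exists r => // w; have [-> ->] := QE w; split=> //.
by rewrite dE; field.
Qed.

End Frames.

(** * Zonal integrals from rotation invariance *)

Section SphereMoments.
Variables (R : realType) (sigma : {measure set (sphere R) -> \bar R}).
Hypothesis sigmaP : is_surface_measure sigma.
Implicit Types (x y : sphere R) (f g : sphere R -> R) (p q : {poly R}).

Notation I f := (\int[sigma]_x f x).

(** By homogeneity the integral of W (u + b v)^(2h+2) is a multiple of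
(1 + b^2)^(h+1); the coefficients of b^2 of the two sides relate the two
moments. *)
Lemma moment_transfer (W u v : sphere R -> R) h : bmeas W -> bmeas u -> bmeas v ->
  (forall a b : R, a ^+ 2 + b ^+ 2 = 1 ->
     I (fun x => W x * (a * u x + b * v x) ^+ h.+1.*2) = I (fun x => W x * u x ^+ h.+1.*2)) ->
  (2 * h%:R + 1) * I (fun x => W x * (u x ^+ h.*2 * v x ^+ 2)) =
  I (fun x => W x * u x ^+ h.+1.*2).
Proof.
move=> bW bu bv inv; set n := h.+1.*2.
pose m i := I (fun x => W x * (u x ^+ (n - i) * v x ^+ i)).
have bm i : bmeas (fun x => W x * (u x ^+ (n - i) * v x ^+ i)).
  by apply: bmeasM => //; apply: bmeasM; exact: bmeasX.
have m0 : m 0 = I (fun x => W x * u x ^+ n).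
  by apply: eq_Rintegral => x _; rewrite subn0 expr0 mulr1.
rewrite -m0.
have -> : I (fun x => W x * (u x ^+ h.*2 * v x ^+ 2)) = m 2.
  by apply: eq_Rintegral => x _; rewrite /n doubleS subSS subSS subn0.
have key : \sum_(i < n.+1) ('C(n, i)%:R * m i) *: 'X^i =
    m 0 *: (1 + 'X^2) ^+ h.+1 :> {poly R}.
  apply: horner_inj => b.
  rewrite horner_sum hornerZ horner_exp.
  have -> : (1 + 'X^2).[b] = 1 + b ^+ 2 by rewrite !hornerE.
  have s0 : 0 < 1 + b ^+ 2 by rewrite ltr_pwDl// sqr_ge0.
  set s := Num.sqrt (1 + b ^+ 2).
  have sn0 : s != 0 by rewrite gt_eqF// sqrtr_gt0.
  have s2 : s ^+ 2 = 1 + b ^+ 2 by rewrite sqr_sqrtr// ltW.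
  have -> : (1 + b ^+ 2) ^+ h.+1 = s ^+ n by rewrite -s2 -exprM mul2n.
  transitivity (I (fun x => W x * (u x + b * v x) ^+ n)).
    have -> : I (fun x => W x * (u x + b * v x) ^+ n) =
        I (fun x => \sum_(i < n.+1) ('C(n, i)%:R * b ^+ i) * (W x * (u x ^+ (n - i) * v x ^+ i))).
      apply: eq_Rintegral => x _; rewrite exprDn mulr_sumr; apply: eq_bigr => i _.
      by rewrite -mulr_natr exprMn; ring.
    rewrite sphint_sum// => [|i]; last exact: bmeasZ.
    apply: eq_bigr => i _; rewrite hornerZ hornerXn sphintZ// /m.
    by rewrite mulrAC.
  have -> : I (fun x => W x * (u x + b * v x) ^+ n) =
      I (fun x => s ^+ n * (W x * (s^-1 * u x + b / s * v x) ^+ n)).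
    apply: eq_Rintegral => x _; rewrite [RHS]mulrCA -exprMn; congr (_ * _ ^+ _).
    by field.
  rewrite sphintZ//; last first.
    by apply: bmeasM => //; apply: bmeasX; apply: bmeasD; exact: bmeasZ.
  rewrite inv; first by rewrite m0 mulrC.
  have -> : s^-1 ^+ 2 + (b / s) ^+ 2 = (1 + b ^+ 2) / s ^+ 2 by field.
  by rewrite s2 divff// gt_eqF.
move: key => /(congr1 (fun p => p`_2)).
rewrite coefZ exprDn coef_sum.
have n2 : (2 < n.+1)%N by rewrite /n doubleS.
rewrite (bigD1 (Ordinal n2)) //= coefZ coefXn eqxx mulr1 big1 ?addr0 => [|i ni]; last first.
  rewrite coefZ coefXn; case: eqP => [i2|]; last by rewrite mulr0.
  by case/eqP: ni; apply/val_inj.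
rewrite coef_sum (bigD1 (lift ord0 ord0)) //= big1 ?addr0 => [|i ni]; last first.
  rewrite expr1n mul1r coefMn -exprM coefXn; case: eqP => [i2|]; last by rewrite mul0rn.
  by case/eqP: ni; apply/val_inj => /=; rewrite /bump /=; lia.
rewrite expr1n mul1r coefMn -exprM coefXn eqxx bin1.
have h1 : h.+1%:R != 0 :> R by rewrite pnatr_eq0.
have -> : 'C(n, 2)%:R = h.+1%:R * (2 * h%:R + 1) :> R.
  have -> : 'C(n, 2) = (h.+1 * h.*2.+1)%N by rewrite bin2 /n -doubleMl doubleK.
  by rewrite natrM -[h.*2.+1%:R]natr1 -mul2n natrM.
by move=> E; apply: (mulfI h1); rewrite mulrA E; exact: mulrC.
Qed.

Notation c0 x := ((set_val x : 'rV[R]_3) 0 0).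
Notation c1 x := ((set_val x : 'rV[R]_3) 0 1).
Notation c2 x := ((set_val x : 'rV[R]_3) 0 (@Ordinal 3 2 isT)).

Let J p k := I (fun x => p.[c0 x] * c1 x ^+ k).

Let bc i : bmeas (fun x => (set_val x : 'rV[R]_3) 0 i) := @bmeas_coord R i.

Let bJ p k : bmeas (fun x => p.[c0 x] * c1 x ^+ k).
Proof. by apply: bmeasM; [exact/bmeas_horner/bc|exact/bmeasX/bc]. Qed.

Let coord_sqr x : c2 x ^+ 2 = 1 - c0 x ^+ 2 - c1 x ^+ 2.
Proof. by have := sphereP x; rewrite dotp3; lra. Qed.

(** Rotating the plane of the last two coordinates by a half-turn changes the
sign. *)
Lemma moment_odd p k : odd k -> J p k = 0.
Proof.
move=> ok; have [|Q rQ QE] := @exists_rot12 R (-1) 0.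
  by rewrite sqrrN expr1n expr0n addr0.
have JN : J p k = - J p k.
  rewrite -[LHS](sphint_rot sigmaP rQ) // -mulN1r -sphintZ//.
  apply: eq_Rintegral => x _ /=.
  have [-> ->] := QE (set_val x).
  by rewrite mul0r addr0 exprMn -signr_odd ok expr1 mulrCA.
by apply/eqP; rewrite -[_ == _](mulrn_eq0 _ 2) mulr2n {1}JN addNr.
Qed.

(** The square of the third coordinate is 1 minus the other two squares, so the
moment with c2^2 is known in two ways. *)
Lemma moment_step p i :
  J p i.+1.*2 = (2 * i%:R + 1) / (2 * i%:R + 2) * J (p * (1 - 'X^2)) i.*2.
Proof.
have tr : (2 * i%:R + 1) * I (fun x => p.[c0 x] * (c1 x ^+ i.*2 * c2 x ^+ 2)) = J p i.+1.*2.
  apply: moment_transfer; [exact/bmeas_horner/bc|exact: bc|exact: bc|].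
  move=> a b ab; have [Q rQ QE] := exists_rot12 ab.
  rewrite -[RHS](sphint_rot sigmaP rQ) //; apply: eq_Rintegral => x _ /=.
  by have [-> ->] := QE (set_val x).
have e : I (fun x => p.[c0 x] * (c1 x ^+ i.*2 * c2 x ^+ 2)) =
    J (p * (1 - 'X^2)) i.*2 - J p i.+1.*2.
  rewrite -sphintB//; apply: eq_Rintegral => x _.
  have wE : (1 - 'X^2).[c0 x] = 1 - c0 x ^+ 2 by rewrite !hornerE.
  by rewrite hornerM wE coord_sqr doubleS !exprS; ring.
rewrite e in tr.
have n0 : 2 * i%:R + 2 != 0 :> R by rewrite -natrM -natrD pnatr_eq0 addn2.
apply: (mulfI n0); rewrite mulrA [_ * (_ / _)]mulrC divfK//.
move: tr; set X := J _ i.*2; set Y := J _ _ => tr.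
have -> : (2 * i%:R + 2) * Y = (2 * i%:R + 1) * Y + Y by ring.
by rewrite -{2}tr; ring.
Qed.

Lemma moment_even p i :
  J p i.*2 = cos_moment R i * I (fun x => (p * (1 - 'X^2) ^+ i).[c0 x]).
Proof.
elim: i p => [|i IH] p.
  rewrite cos_moment0 mul1r expr0 mulr1; apply: eq_Rintegral => x _.
  by rewrite expr0 mulr1.
by rewrite moment_step IH cos_momentS [(1 - 'X^2) ^+ _.+1]exprS [p * (_ * _)]mulrA [LHS]mulrA.
Qed.

Let c n := I (fun x => c0 x ^+ n).

Let bcX n : bmeas (fun x => c0 x ^+ n).
Proof. exact/bmeasX/bc. Qed.

Let c_odd n : odd n -> c n = 0.
Proof.
move=> on; have [|Q rQ QE] := @exists_rot01 R (-1) 0.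
  by rewrite sqrrN expr1n expr0n addr0.
have cN : c n = - c n.
  rewrite -[LHS](sphint_rot sigmaP rQ) // -mulN1r -sphintZ//.
  apply: eq_Rintegral => x _ /=.
  by rewrite QE mul0r addr0 exprMn -signr_odd on expr1.
by apply/eqP; rewrite -[_ == _](mulrn_eq0 _ 2) mulr2n {1}cN addNr.
Qed.

Let c_step i : (2 * i%:R + 1) * c i.*2 = (2 * i%:R + 3) * c i.+1.*2.
Proof.
have h1 : (2 * i%:R + 1) * I (fun x => 1 * (c0 x ^+ i.*2 * c1 x ^+ 2)) =
    I (fun x => 1 * c0 x ^+ i.+1.*2).
  apply: moment_transfer; [exact: bmeas_cst|exact: bc|exact: bc|].
  move=> a b ab; have [Q rQ QE] := exists_rot01 ab.
  have b1 : bmeas (fun x : sphere R => 1 * c0 x ^+ i.+1.*2) by apply: bmeasZ.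
  rewrite -[RHS](sphint_rot sigmaP rQ) //; apply: eq_Rintegral => x _ /=.
  by rewrite QE.
have h2 := moment_step ('X^(i.*2)) 0.
rewrite mulr0 !add0r in h2.
have e1 : I (fun x => 1 * (c0 x ^+ i.*2 * c1 x ^+ 2)) = J 'X^(i.*2) 2.
  by apply: eq_Rintegral => x _; rewrite hornerXn mul1r.
have e2 : J ('X^(i.*2) * (1 - 'X^2)) 0 = c i.*2 - c i.+1.*2.
  rewrite -sphintB//; apply: eq_Rintegral => x _.
  have wE : (1 - 'X^2).[c0 x] = 1 - c0 x ^+ 2 by rewrite !hornerE.
  by rewrite hornerM wE hornerXn doubleS !exprS; ring.
have e3 : I (fun x => 1 * c0 x ^+ i.+1.*2) = c i.+1.*2.
  by apply: eq_Rintegral => x _; rewrite mul1r.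
rewrite e1 e3 h2 e2 in h1.
move: h1; set X := c i.*2; set Y := c i.+1.*2 => h1.
have -> : (2 * i%:R + 3) * Y = (2 * i%:R + 1) * Y + 2 * Y by ring.
by rewrite -{2}h1; field.
Qed.

Let c_even i : (2 * i%:R + 1) * c i.*2 = 4 * pi.
Proof.
elim: i => [|i IH].
  rewrite mulr0 add0r mul1r -[RHS]mul1r -(sphint_cst sigmaP).
  by apply: eq_Rintegral => x _; rewrite expr0.
by rewrite -IH [RHS]c_step -[i.+1%:R]natr1; congr (_ * _); ring.
Qed.

(* Archimedes: a coordinate is uniformly distributed on [-1, 1] *)
Let zonal_coord p : I (fun x => p.[c0 x]) = 2 * pi * mom p.
Proof.
rewrite -[p]coefK poly_def.
under eq_Rintegral => x _ do rewrite horner_sum.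
rewrite sphint_sum// => [|i]; last first.
  by under [X in bmeas X]funext do rewrite hornerZ hornerXn; exact: bmeasZ.
rewrite mom_sum mulr_sumr; apply: eq_bigr => i _; rewrite momZ momXn.
under eq_Rintegral => x _ do rewrite hornerZ hornerXn.
rewrite sphintZ// mulrCA; congr (_ * _); rewrite -/(c i) /moment.
have [oi|ei] := boolP (odd i).
  by rewrite c_odd// exprS -signr_odd oi expr1 mulN1r opprK subrr mul0r mulr0.
rewrite exprS -signr_odd (negbTE ei) expr0 mulr1 opprK.
have := c_even i./2; rewrite even_halfK// -natrM mul2n even_halfK// natr1 => E.
have n0 : i.+1%:R != 0 :> R by rewrite pnatr_eq0.
by apply: (mulfI n0); rewrite E; field.
Qed.

(** In a frame adapted to y and z, <x, z> = t c0 + r c1 with r^2 = 1 - t^2; the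
even powers of c1 are averaged around the axis y, which produces the same
cosine moments as in Laplace's formula. *)
Lemma sphint_pair p n y z : I (fun x => p.[sdot x y] * sdot x z ^+ n) =
  2 * pi * \sum_(i < n./2.+1) 'C(n, i.*2)%:R * cos_moment R i * (1 - sdot y z ^+ 2) ^+ i *
    sdot y z ^+ (n - i.*2) * mom (p * 'X^(n - i.*2) * (1 - 'X^2) ^+ i).
Proof.
set t := sdot y z.
have [Q rQ [r r2 QE]] := exists_rot_pair y z.
have b1 : bmeas (fun x : sphere R => p.[c0 x] * (t * c0 x + r * c1 x) ^+ n).
  apply: bmeasM; first exact/bmeas_horner/bc.
  by apply: bmeasX; apply: bmeasD; exact/bmeasZ/bc.
transitivity (I (fun x => p.[c0 x] * (t * c0 x + r * c1 x) ^+ n)).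
  rewrite -[RHS](sphint_rot sigmaP rQ)//; apply: eq_Rintegral => x _.
  by have [h1 h2] := QE (set_val x); rewrite /sdot h1 h2.
pose F k := 'C(n, k)%:R * t ^+ (n - k) * r ^+ k * J (p * 'X^(n - k)) k.
have -> : I (fun x => p.[c0 x] * (t * c0 x + r * c1 x) ^+ n) = \sum_(k < n.+1) F k.
  have -> : I (fun x => p.[c0 x] * (t * c0 x + r * c1 x) ^+ n) =
    I (fun x => \sum_(k < n.+1) ('C(n, k)%:R * t ^+ (n - k) * r ^+ k) *
        ((p * 'X^(n - k)).[c0 x] * c1 x ^+ k)).
    apply: eq_Rintegral => x _; rewrite exprDn mulr_sumr; apply: eq_bigr => k _.
    by rewrite hornerM hornerXn -mulr_natr !exprMn; ring.
  rewrite sphint_sum// => [|k]; last exact: bmeasZ.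
  by apply: eq_bigr => k _; rewrite sphintZ.
rewrite sum_even => [|k ok]; last by rewrite /F moment_odd// mulr0.
rewrite mulr_sumr; apply: eq_bigr => i _; rewrite /F moment_even zonal_coord.
by rewrite -mul2n exprM r2 mul2n; ring.
Qed.

Let degree_bound (a b e d : nat) :
  (b.*2 <= a -> a < e -> d <= b.*2.+1 -> ((a - b.*2).+1 + d).-1 <= e)%N.
Proof. lia. Qed.

(** Averaging a polynomial of degree n in <x, z> around the axis y gives a
polynomial of degree n in <x, y>, to which P_l is orthogonal. *)
Lemma sphint_legendreP_lt l q y z : (size q <= l)%N ->
  I (fun x => (legendreP R l).[sdot x y] * q.[sdot x z]) = 0.
Proof.
move=> ql.
have -> : I (fun x => (legendreP R l).[sdot x y] * q.[sdot x z]) =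
  I (fun x => \sum_(n < size q) q`_n * ((legendreP R l).[sdot x y] * sdot x z ^+ n)).
  apply: eq_Rintegral => x _; rewrite [q.[_]]horner_coef mulr_sumr.
  by apply: eq_bigr => n _; rewrite mulrCA.
have b1 n : bmeas (fun x => (legendreP R l).[sdot x y] * sdot x z ^+ n).
  by apply: bmeasM; [apply: bmeas_horner|apply: bmeasX]; exact: bmeas_sdot.
rewrite sphint_sum// => [|n]; last exact: bmeasZ.
rewrite big1// => n _; rewrite sphintZ// sphint_pair big1 ?mulr0// => i _.
have nl : (n < l)%N by rewrite (leq_trans (ltn_ord n)).
have i2 : (i.*2 <= n)%N by rewrite -geq_half_double -ltnS.
rewrite -(mulrA (legendreP R l)) mom_legendreP_lt ?mulr0//.
apply: leq_trans (size_polyMleq _ _) _; rewrite size_polyXn.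
pose w : {poly R} := 1 - 'X^2.
have : (size (w ^+ i)%R <= i.*2.+1)%N.
  have s3 : (size w <= 3)%N.
    by rewrite (leq_trans (size_polyD _ _))// geq_max size_poly1 size_polyN size_polyXn.
  rewrite (leq_trans (size_poly_exp_leq _ _))// ltnS -mul2n leq_mul2r -subn1 leq_subLR s3.
  by rewrite orbT.
exact: degree_bound i2 nl.
Qed.

Let size_monicB p q n : p \is monic -> q \is monic -> size p = n.+1 -> size q = n.+1 ->
  (size (p - q)%R <= n)%N.
Proof.
move=> /monicP pm /monicP qm sp sq; apply/leq_sizeP => j.
rewrite leq_eqVlt coefB => /orP[/eqP <-|nj].
  by move: pm qm; rewrite !lead_coefE sp sq /= => -> ->; rewrite subrr.
by rewrite !nth_default ?subrr ?sp ?sq.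
Qed.

(* against P_l only the leading coefficient counts *)
Let mom_lead l i : (i.*2 <= l)%N ->
  mom (legendreP R l * 'X^(l - i.*2) * (1 - 'X^2) ^+ i) =
  (-1) ^+ i * mom (legendreP R l * 'X^l).
Proof.
move=> il; have -> : (1 - 'X^2 : {poly R}) ^+ i = (-1) ^+ i *: ('X^2 - 1) ^+ i.
  by rewrite -[1 - _]opprB -scaleN1r exprZn.
rewrite -scalerAr momZ; congr (_ * _).
apply/eqP; rewrite -subr_eq0 -momB -mulrA -mulrBr mom_legendreP_lt//.
have m1 : ('X^2 - 1 : {poly R}) \is monic by apply: monicXnsubC.
have m2 : ('X^2 - 1 : {poly R}) ^+ i \is monic by exact: monic_exp.
apply: size_monicB; rewrite ?monicMl ?monicXn ?size_polyXn//.
rewrite size_monicM ?monicXn// ?monic_neq0// size_polyXn addSn /=.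
have := size_exp ('X^2 - 1 : {poly R}) i; rewrite size_XnsubC//= => s.
have : (0 < size (('X^2 - 1 : {poly R}) ^+ i)%R)%N by rewrite size_poly_gt0 monic_neq0.
by move: s; case: size => // k /= -> _; rewrite mul2n addnS subnK.
Qed.

(** Modulo lower degree, which does not contribute, P_l(<x, z>) is a multiple of
<x, z>^l; averaging the latter around the axis y, the sum that remains is
Laplace's formula for P_l(<y, z>). *)
Lemma sphint_legendreP_diag l y z :
  I (fun x => (legendreP R l).[sdot x y] * (legendreP R l).[sdot x z]) =
  2 * pi * mom (legendreP R l ^+ 2) * (legendreP R l).[sdot y z].
Proof.
set P := legendreP R l; set a := lead_coef P.
have sP : size P = l.+1 by exact: size_legendreP.
pose q := P - a *: 'X^l.
have sq : (size q <= l)%N.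
  apply/leq_sizeP => j; rewrite leq_eqVlt coefB (coefZ a) coefXn => /orP[/eqP <-|lj].
    by rewrite eqxx mulr1 /a lead_coefE sP subrr.
  by rewrite gtn_eqF// mulr0 nth_default ?subrr// sP.
have PE : P = a *: 'X^l + q by rewrite addrC subrK.
have bP w : bmeas (fun x : sphere R => P.[sdot x w]) by exact/bmeas_horner/bmeas_sdot.
have b1 : bmeas (fun x : sphere R => P.[sdot x y] * sdot x z ^+ l).
  by apply: bmeasM => //; exact/bmeasX/bmeas_sdot.
have b2 : bmeas (fun x : sphere R => P.[sdot x y] * q.[sdot x z]).
  by apply: bmeasM => //; exact/bmeas_horner/bmeas_sdot.
transitivity (a * I (fun x => P.[sdot x y] * sdot x z ^+ l)).
  transitivity (I (fun x => a * (P.[sdot x y] * sdot x z ^+ l) + P.[sdot x y] * q.[sdot x z])).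
    by apply: eq_Rintegral => x _; rewrite {2}PE hornerD hornerZ hornerXn; ring.
  rewrite sphintD//; last exact: bmeasZ.
  by rewrite sphintZ// sphint_legendreP_lt// addr0.
rewrite sphint_pair legendreP_laplace.
have -> : mom (P ^+ 2) = a * mom (P * 'X^l).
  by rewrite expr2 {2}PE mulrDr momD (mom_legendreP_lt sq) addr0 -scalerAr momZ.
have [m mE] : exists m, m = mom (P * 'X^l) by eexists.
rewrite -mE !mulr_sumr; apply: eq_bigr => i _.
rewrite mom_lead -?mE; last by rewrite -geq_half_double -ltnS.
have -> : (1 - sdot y z ^+ 2) ^+ i = (-1) ^+ i * (sdot y z ^+ 2 - 1) ^+ i.
  by rewrite -exprMn mulN1r opprB.
have e : (-1) ^+ i * (-1) ^+ i = 1 :> R by rewrite -exprMn mulrNN mulr1 expr1n.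
set s := (-1) ^+ i in e *.
apply: (@etrans _ _ (s * s * _)); last by rewrite e mul1r.
ring.
Qed.

End SphereMoments.

(** * Weierstrass approximation *)

Section Weierstrass.
Variable R : realType.

(** Heine's theorem: by compactness, in its covering form, the radii that work
near each point of the segment have a common lower bound. *)
Lemma uniform_continuity_segment (f : R -> R) (a b e : R) : 0 < e ->
  {within `[a, b], continuous f} ->
  exists2 d : R, 0 < d & forall x y, x \in `[a, b] -> y \in `[a, b] ->
    `|x - y| < d -> `|f x - f y| <= e.
Proof.
move=> e0 /subspace_continuousP cf.
have /compact_near_coveringP/near_covering_withinP := @segment_compact R a b.
move=> /(_ R (0 : R)^'+ (fun d x => forall y, y \in `[a, b] -> `|x - y| < d -> `|f x - f y| <= e)).
have h x : `[a, b]%classic x -> \forall x' \near x & d \near 0^'+, `[a, b]%classic x' ->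
    forall y, y \in `[a, b] -> `|x' - y| < d -> `|f x' - f y| <= e.
  move=> xab; have e20 : 0 < e / 2 by rewrite divr_gt0.
  have /cvgrPdist_lt/(_ _ e20) := cf x xab.
  rewrite near_withinE => /nbhs_ballP[r /= r0 hr].
  have r20 : 0 < r / 2 by rewrite divr_gt0.
  exists (ball x (r / 2), [set d | 0 < d < r / 2]); first split.
  - exact: nbhsx_ballx.
  - have h0 := nbhs_right_gt (0 : R).
    by have := nbhs_right_lt r20; apply: filterS2 h0 => d /= d0 dr; rewrite d0.
  move=> [x' d] /= [xx' /andP[d0 dr]] x'ab y yab x'y.
  have h1 : `|f x - f x'| < e / 2.
    by apply: hr => //; apply: le_ball xx'; rewrite ler_pdivrMr// ler_peMr// ?ler1n// ltW.
  have h2 : `|f x - f y| < e / 2.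
    apply: hr => //; rewrite /ball /=.
    have -> : x - y = (x - x') + (x' - y) by rewrite addrA subrK.
    rewrite (le_lt_trans (ler_normD _ _))// [r](splitr r) ltrD//.
    exact: lt_trans dr.
  have -> : f x' - f y = (f x - f y) - (f x - f x') by ring.
  apply: le_trans (ler_normB _ _) _; rewrite [e](splitr e) addrC; apply: lerD; exact: ltW.
have FF : Filter (0 : R)^'+ by typeclasses eauto.
move=> /(_ FF h) {}h.
have hI := filterI h (nbhs_right_gt (0 : R)).
have [d [hd d0]] := @filter_ex _ _ (at_right_proper_filter (0 : R)) _ (hI FF).
by exists d => // x y xab yab xy; exact: hd.
Qed.

Lemma within_continuous_bounded (f : R -> R) (a b : R) : a <= b ->
  {within `[a, b], continuous f} -> exists M, forall x, x \in `[a, b] -> `|f x| <= M.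
Proof.
move=> ab cf.
have [c _ fc] := EVT_max ab cf; have [d _ fd] := EVT_min ab cf.
exists (`|f c| + `|f d|) => x xab; rewrite ler_norml.
have := fc x xab; have := fd x xab; have := ler_norm (f c); have := ler_norm (- f d).
rewrite normrN; move: (normr_ge0 (f c)) (normr_ge0 (f d)) => ? ? ? ? ? ?; apply/andP; split; lra.
Qed.

Let bern n k (x : R) : R := 'C(n, k)%:R * x ^+ k * (1 - x) ^+ (n - k).

(* generating function; its derivatives at 1 are the factorial moments *)
Let bern_gen n x : (x *: 'X + (1 - x)%:P) ^+ n = \sum_(k < n.+1) bern n k x *: 'X^k.
Proof.
rewrite addrC exprDn; apply: eq_bigr => k _.
rewrite exprZn -polyC_exp mul_polyC scalerA -scaler_nat scalerA /bern.
by congr (_ *: _); ring.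
Qed.

Let L x : {poly R} := x *: 'X + (1 - x)%:P.

Let L1 x : (L x).[1] = 1.
Proof. by rewrite hornerD hornerZ hornerX hornerC; ring. Qed.

Let derivL x : (L x)^`() = x%:P.
Proof. by rewrite derivD derivZ derivX derivC addr0 alg_polyC. Qed.

Let bern_sum n x : \sum_(k < n.+1) bern n k x = 1.
Proof.
have /(congr1 (fun p => p.[1])) := bern_gen n x.
rewrite -/(L x) horner_exp L1 expr1n horner_sum => ->.
by apply: eq_bigr => k _; rewrite hornerZ hornerXn expr1n mulr1.
Qed.

Let bern_mean n x : \sum_(k < n.+1) k%:R * bern n k x = n%:R * x.
Proof.
have /(congr1 (fun p => p^`().[1])) := bern_gen n x.
rewrite -/(L x) deriv_exp derivL linear_sum /= horner_sum.
rewrite hornerMn hornerM horner_exp L1 hornerC expr1n mulr1 -[x *+ n]mulr_natl => ->.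
apply: eq_bigr => k _; rewrite derivZ derivXn hornerZ hornerMn hornerXn expr1n.
by rewrite mulrC.
Qed.

Let bern_mean2 n x :
  \sum_(k < n.+1) (k%:R * (k%:R - 1)) * bern n k x = n%:R * (n%:R - 1) * x ^+ 2.
Proof.
have natB m : m%:R * (m.-1)%:R = m%:R * (m%:R - 1) :> R.
  by case: m => [|m]; rewrite ?mul0r// -[m.+1%:R]natr1 addrK.
have /(congr1 (fun p => p^`()^`().[1])) := bern_gen n x.
rewrite -/(L x) deriv_exp derivL derivMn derivM derivC mul0r add0r deriv_exp derivL.
rewrite !linear_sum /= horner_sum.
rewrite hornerMn hornerM hornerMn hornerM horner_exp L1 hornerC expr1n mulr1.
have -> : x * (x *+ n.-1) *+ n = n%:R * (n%:R - 1) * x ^+ 2.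
  by rewrite -natB -[_ *+ n]mulr_natl -[x *+ n.-1]mulr_natl; ring.
move=> ->; apply: eq_bigr => k _.
rewrite !derivZ derivXn derivMn derivXn hornerZ !hornerMn hornerXn expr1n.
by rewrite -natB -mulrnA natrM; ring.
Qed.

Let bern_var n x : \sum_(k < n.+1) (k%:R - n%:R * x) ^+ 2 * bern n k x = n%:R * x * (1 - x).
Proof.
transitivity (\sum_(k < n.+1) ((k%:R * (k%:R - 1)) * bern n k x
   + ((1 - 2 * (n%:R * x)) * (k%:R * bern n k x) + (n%:R * x) ^+ 2 * bern n k x))).
  by apply: eq_bigr => k _; ring.
by rewrite !big_split /= -!mulr_sumr bern_sum bern_mean bern_mean2; ring.
Qed.

Let bern_ge0 n k x : 0 <= x <= 1 -> 0 <= bern n k x.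
Proof.
by move=> /andP[x0 x1]; rewrite /bern !mulr_ge0// exprn_ge0// subr_ge0.
Qed.

(** Bernstein's proof: the polynomial averages f under the binomial law of
parameter (1 + u) / 2.  Nodes within d of u contribute at most e / 2 by uniform
continuity, the others at most 2 M times their probability, which Chebyshev's
inequality bounds through the variance. *)
Theorem weierstrass_approximation (f : R -> R) (e : R) : 0 < e ->
  {within `[-1, 1], continuous f} ->
  exists p : {poly R}, forall u, u \in `[-1, 1] -> `|f u - p.[u]| <= e.
Proof.
move=> e0 cf; have N11 : -1 <= 1 :> R by lra.
have [M fM] := within_continuous_bounded N11 cf.
have e20 : 0 < e / 2 by rewrite divr_gt0.
have [d d0 fd] := uniform_continuity_segment e20 cf.
have M0 : 0 <= M by apply: le_trans (fM 1 _); rewrite // in_itv/= lexx andbT.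
pose n := (Num.truncn (16 * M / (e * d ^+ 2))).+1.
have n0 : n%:R != 0 :> R by rewrite pnatr_eq0.
have n0' : 0 < n%:R :> R by rewrite ltr0n.
have nM : 16 * M / (e * d ^+ 2) < n%:R by rewrite /n truncnS_gt.
pose a k : R := 2 * (k%:R / n%:R) - 1.
pose h : R -> R := fun u => (1 + u) / 2.
pose p : {poly R} := \sum_(k < n.+1) (f (a k) * 'C(n, k)%:R) *:
   ((2^-1 *: (1 + 'X)) ^+ k * (1 - 2^-1 *: (1 + 'X)) ^+ (n - k)).
exists p => u ui.
have hu : 0 <= h u <= 1.
  by move: ui; rewrite in_itv /= /h => /andP[u1 u2]; apply/andP; split; lra.
have pE : p.[u] = \sum_(k < n.+1) f (a k) * bern n k (h u).
  rewrite horner_sum; apply: eq_bigr => k _.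
  have hE : (2^-1 *: (1 + 'X)).[u] = h u by rewrite hornerZ hornerD hornerX hornerC /h mulrC.
  rewrite hornerZ hornerM !horner_exp hornerD hornerN hE hornerC /bern; ring.
have fE : f u = \sum_(k < n.+1) f u * bern n k (h u) by rewrite -mulr_sumr bern_sum mulr1.
rewrite fE pE -sumrB.
apply: le_trans (ler_norm_sum _ _ _) _.
have ak k : (k < n.+1)%N -> a k \in `[-1, 1].
  rewrite ltnS => kn; rewrite in_itv /= /a.
  have : 0 <= k%:R / n%:R :> R by rewrite divr_ge0.
  have : k%:R / n%:R <= 1 :> R by rewrite ler_pdivrMr// mul1r ler_nat.
  by move=> ? ?; apply/andP; split; lra.
apply: (@le_trans _ _ (\sum_(k < n.+1) ((e / 2) * bern n k (h u) +
   (8 * M / (d ^+ 2 * n%:R ^+ 2)) * ((k%:R - n%:R * h u) ^+ 2 * bern n k (h u))))).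
  apply: ler_sum => k _; rewrite -mulrBl normrM (ger0_norm (bern_ge0 _ _ hu)).
  rewrite [_ * (_ ^+ 2 * _)]mulrA -mulrDl; apply: ler_wpM2r; first exact: bern_ge0.
  have r0 : 0 <= 8 * M / (d ^+ 2 * n%:R ^+ 2) * (k%:R - n%:R * h u) ^+ 2.
    apply: mulr_ge0; last exact: sqr_ge0.
    by apply: divr_ge0; apply: mulr_ge0; rewrite ?sqr_ge0.
  have [ud|ud] := ltP `|u - a k| d.
    by apply: (le_trans (fd _ _ ui (ak k (ltn_ord k)) ud)); rewrite lerDl.
  apply: (@le_trans _ _ (2 * M)).
    apply: le_trans (ler_normB _ _) _; rewrite mulr_natl mulr2n.
    by apply: lerD; apply: fM => //; exact: ak.
  have -> : (k%:R - n%:R * h u) ^+ 2 = n%:R ^+ 2 / 4 * `|u - a k| ^+ 2.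
    by rewrite real_normK ?num_real// /a /h; field.
  have -> : 8 * M / (d ^+ 2 * n%:R ^+ 2) * (n%:R ^+ 2 / 4 * `|u - a k| ^+ 2) =
     2 * M * (`|u - a k| ^+ 2 / d ^+ 2) by field; rewrite n0 gt_eqF.
  apply: (@le_trans _ _ (2 * M * (`|u - a k| ^+ 2 / d ^+ 2))).
    rewrite ler_peMr// ?mulr_ge0// ler_pdivlMr ?exprn_gt0// mul1r.
    by rewrite ler_pXn2r// ?nnegrE// ltW.
  by rewrite lerDr ltW.
rewrite big_split /= -!mulr_sumr bern_sum bern_var mulr1.
have hh : h u * (1 - h u) <= 1.
  by case/andP: hu => h0 h1; rewrite mulr_ile1//; lra.
apply: (@le_trans _ _ (e / 2 + e / 2)); last by rewrite -splitr.
rewrite lerD2l.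
have -> : 8 * M / (d ^+ 2 * n%:R ^+ 2) * (n%:R * h u * (1 - h u)) =
   8 * M / (d ^+ 2 * n%:R) * (h u * (1 - h u)) by field; rewrite n0 gt_eqF.
apply: (@le_trans _ _ (8 * M / (d ^+ 2 * n%:R))).
  rewrite ler_piMr//.
  by apply: divr_ge0; apply: mulr_ge0; rewrite ?sqr_ge0.
have ed : 0 < e * d ^+ 2 by rewrite mulr_gt0// exprn_gt0.
rewrite ler_pdivrMr ?mulr_gt0 ?exprn_gt0//.
move: nM; rewrite ltr_pdivrMr// => nM.
have -> : e / 2 * (d ^+ 2 * n%:R) = n%:R * (e * d ^+ 2) / 2 by ring.
by rewrite ler_pdivlMr//; apply: ltW; apply: le_lt_trans nM; lra.
Qed.

End Weierstrass.

(** * The Funk-Hecke formula *)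

Section FunkHecke.
Variable R : realType.

Local Notation leb := (@lebesgue_measure R).

Lemma integrable_segment (f : R -> R) : {within `[-1, 1], continuous f} ->
  leb.-integrable `[-1, 1] (EFin \o f).
Proof.
by move=> cf; apply: continuous_compact_integrable => //; exact: segment_compact.
Qed.

Lemma within_continuous_horner (p : {poly R}) : {within `[-1, 1], continuous (horner p)}.
Proof. by apply: continuous_subspaceT; exact: continuous_horner. Qed.

Lemma within_continuousM (f g : R -> R) : {within `[-1, 1], continuous f} ->
  {within `[-1, 1], continuous g} -> {within `[-1, 1], continuous (fun u => f u * g u)}.
Proof. by move=> cf cg x; apply: cvgM; [exact: cf|exact: cg]. Qed.

Lemma within_continuousB (f g : R -> R) : {within `[-1, 1], continuous f} ->
  {within `[-1, 1], continuous g} -> {within `[-1, 1], continuous (fun u => f u - g u)}.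
Proof. by move=> cf cg x; apply: cvgB; [exact: cf|exact: cg]. Qed.

Lemma Rintegral_horner (p : {poly R}) :
  \int[leb]_(u in `[-1, 1]) p.[u] = mom p.
Proof.
pose q : {poly R} := \poly_(i < (size p).+1) (p`_i.-1 / i%:R).
have qp : q^`() = p.
  apply/polyP => i; rewrite coef_deriv coef_poly ltnS.
  case: ltnP => [ip|pi]; last by rewrite mul0rn nth_default.
  by rewrite -[LHS]mulr_natr divfK// pnatr_eq0.
have -> : mom p = q.[1] - q.[-1] by rewrite -mom_deriv qp.
have N11 : -1 < 1 :> R by lra.
rewrite /Rintegral (continuous_FTC2 (F := horner q) N11)//.
- exact: within_continuous_horner.
- split=> [x _||]; first exact: derivable_horner.
    by apply: cvg_at_right_filter; exact: continuous_horner.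
  by apply: cvg_at_left_filter; exact: continuous_horner.
- by move=> x _; rewrite derive1E derive_val qp.
Qed.

Variable sigma : {measure set (sphere R) -> \bar R}.
Hypothesis sigmaP : is_surface_measure sigma.
Notation I f := (\int[sigma]_x f x).

Lemma bmeas_zonal (f : R -> R) (y : sphere R) : {within `[-1, 1], continuous f} ->
  bmeas (fun x => f (sdot x y)).
Proof.
move=> cf; split.
  have mf : measurable_fun (`[-1, 1]%classic : set R) f by exact: subspace_continuous_measurable_fun.
  have sub : [set sdot x y | x in [set: sphere R]] `<=` (`[-1, 1]%classic : set R).
    by move=> _ [x _ <-] /=; rewrite in_itv /= sdot_itv.
  exact: (measurable_comp _ sub mf (bmeas_sdot y).1).
have N11 : -1 <= 1 :> R by lra.
have [M fM] := within_continuous_bounded N11 cf.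
by exists M => x; apply: fM; rewrite in_itv /= sdot_itv.
Qed.

Let funk_hecke_poly l (p : {poly R}) (y z : sphere R) :
  I (fun x => p.[sdot x y] * (legendreP R l).[sdot x z]) =
  2 * pi * mom (p * legendreP R l) * (legendreP R l).[sdot y z].
Proof.
have bp (r : {poly R}) w : bmeas (fun x => r.[sdot x w]) by exact/bmeas_horner/bmeas_sdot.
apply: (@legendreP_ind R (fun p => I (fun x => p.[sdot x y] * (legendreP R l).[sdot x z]) =
  2 * pi * mom (p * legendreP R l) * (legendreP R l).[sdot y z]) (size p)) => //.
- rewrite mul0r mom0 mulr0 mul0r.
  under eq_Rintegral do rewrite horner0 mul0r.
  by rewrite (sphint_cst sigmaP) mul0r.
- move=> c q r hq hr.
  transitivity (I (fun x => c * (q.[sdot x y] * (legendreP R l).[sdot x z]) +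
      r.[sdot x y] * (legendreP R l).[sdot x z])).
    by apply: eq_Rintegral => x _; rewrite hornerD hornerZ; ring.
  rewrite (sphintD sigmaP); [|by apply: bmeasZ; apply: bmeasM|by apply: bmeasM].
  rewrite (sphintZ sigmaP); last by apply: bmeasM.
  by rewrite hq hr [(_ + _) * legendreP R l]mulrDl momD -(scalerAl c) momZ; ring.
move=> m _; have [ml|lm|->] := ltngtP m l.
- under eq_Rintegral do rewrite mulrC.
  rewrite (sphint_legendreP_lt sigmaP) ?size_legendreP//.
  by rewrite mulrC [_ * legendreP R l]mulrC mom_legendreP_lt ?size_legendreP// !mulr0.
- rewrite (sphint_legendreP_lt sigmaP) ?size_legendreP//.
  by rewrite mom_legendreP_lt ?size_legendreP// mulr0 mul0r.
- by rewrite (sphint_legendreP_diag sigmaP) expr2.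
Qed.

(** For a polynomial f, expand it in the basis P_m: only the component along P_l
contributes to either side.  Both sides are continuous in f for the uniform
norm, so the formula passes to continuous f. *)
Theorem funk_hecke l (f : R -> R) (y z : sphere R) : {within `[-1, 1], continuous f} ->
  I (fun x => f (sdot x y) * (legendreP R l).[sdot x z]) =
  2 * pi * (\int[leb]_(u in `[-1, 1]) (f u * (legendreP R l).[u])) * (legendreP R l).[sdot y z].
Proof.
move=> cf; set P := legendreP R l; set t := sdot y z.
have cP : {within `[-1, 1], continuous (horner P)} by exact: within_continuous_horner.
have ifP : leb.-integrable `[-1, 1] (EFin \o (fun u => f u * P.[u])).
  by apply: integrable_segment; exact: within_continuousM.
have bP w : bmeas (fun x => P.[sdot x w]) by exact/bmeas_horner/bmeas_sdot.
have bf := bmeas_zonal y cf.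
have Ple1 u : u \in `[-1, 1] -> `|P.[u]| <= 1 by rewrite in_itv /= => ui; exact: legendreP_le1.
apply/eqP; rewrite -subr_eq0 -normr_le0; apply/ler_addgt0Pr => e e0; rewrite add0r.
have e10 : 0 < e / (8 * pi) by rewrite divr_gt0// mulr_gt0// pi_gt0.
have [p fp] := weierstrass_approximation e10 cf.
have cp : {within `[-1, 1], continuous (horner p)} by exact: within_continuous_horner.
have ipP : leb.-integrable `[-1, 1] (EFin \o (fun u => p.[u] * P.[u])).
  by apply: integrable_segment; exact: within_continuousM.
have bp : bmeas (fun x => p.[sdot x y]) by exact/bmeas_horner/bmeas_sdot.
have e1 : I (fun x => f (sdot x y) * P.[sdot x z]) - I (fun x => p.[sdot x y] * P.[sdot x z]) =
    I (fun x => (f (sdot x y) - p.[sdot x y]) * P.[sdot x z]).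
  rewrite -(sphintB sigmaP); [|exact: bmeasM|exact: bmeasM].
  by apply: eq_Rintegral => x _; rewrite mulrBl.
have e2 : \int[leb]_(u in `[-1, 1]) (f u * P.[u]) - mom (p * P) =
    \int[leb]_(u in `[-1, 1]) ((f u - p.[u]) * P.[u]).
  rewrite -Rintegral_horner.
  rewrite -[X in _ - X](@eq_Rintegral _ _ _ leb `[-1, 1] (fun u => (p * P).[u]) (fun u => p.[u] * P.[u])); last first.
    by move=> u _; rewrite hornerM.
  rewrite -RintegralB//; by apply: eq_Rintegral => u _; rewrite mulrBl.
have b1 : `|I (fun x => (f (sdot x y) - p.[sdot x y]) * P.[sdot x z])| <= e / (8 * pi) * (4 * pi).
  apply: (sphint_le sigmaP); first by apply: bmeasM => //; exact: bmeasB.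
  move=> x; rewrite normrM -[leRHS]mulr1; apply: ler_pM => //.
    by apply: fp; rewrite in_itv /= sdot_itv.
  by apply: Ple1; rewrite in_itv /= sdot_itv.
have b2 : `|\int[leb]_(u in `[-1, 1]) ((f u - p.[u]) * P.[u])| <= e / (8 * pi) * 2.
  have ii : leb.-integrable `[-1, 1] (EFin \o (fun u => (f u - p.[u]) * P.[u])).
    by apply: integrable_segment; apply: within_continuousM => //; exact: within_continuousB.
  apply: le_trans (le_normr_Rintegral _ ii) _ => //.
  have -> : e / (8 * pi) * 2 = \int[leb]_(u in `[-1, 1]) (e / (8 * pi)).
    have lE : leb (`[-1, 1]%classic : set R) = 2%:E.
      rewrite lebesgue_measure_itv /= lte_fin ifT; last by lra.
      by rewrite -EFinD opprK.
    by rewrite Rintegral_cst// -[2]/(fine 2%:E) -lE.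
  apply: le_Rintegral => //.
  - by apply: integrable_norm.
  - by apply: integrable_segment => x; exact: cvg_cst.
  move=> u ui; rewrite normrM -[leRHS]mulr1; apply: ler_pM => //; first exact: fp.
  exact: Ple1.
have := funk_hecke_poly l p y z; rewrite -/P -/t => h.
rewrite -[X in X - _](subrK (I (fun x => p.[sdot x y] * P.[sdot x z]))) e1 h.
rewrite -addrA -mulrBl -mulrBr -opprB mulrN mulNr e2.
apply: le_trans (ler_normB _ _) _.
have pi0 : 0 < pi :> R := pi_gt0 R.
rewrite !normrM (ger0_norm (_ : 0 <= 2)) ?(ltW pi0)// (gtr0_norm pi0).
have b3 : 2 * pi * `|\int[leb]_(u in `[-1, 1]) ((f u - p.[u]) * P.[u])| * `|P.[t]| <= 2 * pi * (e / (8 * pi) * 2) * 1.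
  apply: ler_pM => //; [by rewrite !mulr_ge0// ltW| |by apply: Ple1; rewrite in_itv /= sdot_itv].
  by rewrite ler_pM2l// mulr_gt0.
apply: le_trans (lerD b1 b3) _.
have aux (q : R) : q != 0 -> e / (8 * q) * (4 * q) + 2 * q * (e / (8 * q) * 2) * 1 = e.
  by move=> q0; field.
by rewrite aux// gt_eqF.
Qed.

End FunkHecke.

(** * Localization of Legendre sums by summation by parts *)

Section Localization.
Variable R : realType.

Lemma abel_sum (a G : nat -> R) N :
  \sum_(l < N) a l * (G l.+1 - G l) =
  a N * G N - a 0%N * G 0%N - \sum_(l < N) (a l.+1 - a l) * G l.+1.
Proof.
elim: N => [|N IH]; first by rewrite !big_ord0; ring.
by rewrite !big_ord_recr /= IH; ring.
Qed.

Let P (x : R) l := (legendreP R l).[x].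

(** The degrees are shifted by i so that iterated differences, which raise the
index, keep the same form. *)
Definition legendre_sum (x : R) N i (a : nat -> R) : R :=
  \sum_(l < N) (2 * (l + i)%:R + 1) * a l * P x (l + i).

Definition flux i (a : nat -> R) l : R := (l + i).+1%:R * (a l - a l.+1).

(** By the recurrence, (1 - x) (2 m + 1) P_m is the increment
(m + 1) (P_m - P_(m+1)) - m (P_(m-1) - P_m); summation by parts moves the
difference to the coefficients. *)
Lemma legendre_sum_flux x N i a : a 0%N = 0 -> a N = 0 ->
  (1 - x) * legendre_sum x N i.+1 a =
  \sum_(l < N) flux i.+1 a l * (P x (l + i.+1) - P x (l + i.+1).+1).
Proof.
move=> a0 aN.
pose G l := (l + i.+1)%:R * (P x (l + i) - P x (l + i).+1).
rewrite /legendre_sum mulr_sumr.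
transitivity (\sum_(l < N) a l * (G l.+1 - G l)).
  apply: eq_bigr => l _; rewrite /G !addSn !addnS.
  have := legendreP_horner_rec (l + i) x; rewrite -/(P x _) -/(P x (l + i).+2) -/(P x (l + i)).
  set m := (l + i)%N => h.
  have e : (1 - x) * ((2 * m.+1%:R + 1) * a l * P x m.+1) =
     a l * ((2 * m.+1%:R + 1) * P x m.+1 - (2 * m.+1%:R + 1) * (x * P x m.+1)) by ring.
  rewrite e; congr (_ * _).
  have -> : (2 * m.+1%:R + 1) * (x * P x m.+1) = m.+2%:R * P x m.+2 + m.+1%:R * P x m.
    by rewrite h subrK.
  by rewrite -[m.+2%:R]natr1; ring.
rewrite abel_sum a0 aN !mul0r subrr sub0r -sumrN.
apply: eq_bigr => l _; rewrite /G /flux !addSn !addnS; ring.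
Qed.

Definition flux_diff i (a : nat -> R) l : R :=
  (flux i a l.+1 - flux i a l) / (2 * (l + i.+1)%:R + 1).

(** A second summation by parts turns the differences of Legendre polynomials
back into a Legendre sum. *)
Lemma legendre_sum_diff x N i a : a 0%N = 0 -> a 1%N = 0 -> a N = 0 -> a N.+1 = 0 ->
  (1 - x) * legendre_sum x N i.+1 a = legendre_sum x N i.+2 (flux_diff i.+1 a).
Proof.
move=> a0 a1 aN aN1; rewrite legendre_sum_flux//.
transitivity (- \sum_(l < N) flux i.+1 a l * (P x (l.+1 + i.+1) - P x (l + i.+1))).
  by rewrite -sumrN; apply: eq_bigr => l _; rewrite addSn; ring.
rewrite (abel_sum _ (fun l => P x (l + i.+1))) {1 2}/flux a0 a1 aN aN1 subrr !mulr0 !mul0r.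
rewrite subrr sub0r opprK; apply: eq_bigr => l _.
rewrite /flux_diff addSn -addnS.
rewrite [X in _ = X * _]mulrC divfK// -natrM -natrD pnatr_eq0 addn1//.
Qed.

(* j indexes a family of sequences and n j is its scale; all bounds are uniform
   in j *)
Variables (B : R) (n : nat -> R).
Hypotheses (B1 : 1 < B) (n1 : forall j, 1 <= n j).

Let n0 j : 0 < n j. Proof. exact: lt_le_trans (n1 j). Qed.
Let B0 : 0 < B. Proof. exact: lt_trans B1. Qed.

Implicit Types a b : nat -> nat -> R.

Definition bounded_family a := exists C : R, forall j l, `|a j l| <= C.

Definition scaled_diff a j l : R := n j * (a j l.+1 - a j l).

(** A discrete symbol class: a j behaves like the samples, at step 1 / n j, of
functions with k derivatives bounded uniformly in j. *)
Fixpoint symbol k a : Prop :=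
  if k is k'.+1 then bounded_family a /\ symbol k' (scaled_diff a) else bounded_family a.

(** The support lies in the band [n / B, B n], up to a fixed shift s which
absorbs the drift caused by differences. *)
Definition banded s a :=
  forall j l, a j l != 0 -> n j <= B * (l%:R + s) /\ l%:R <= B * n j.

Lemma symbol_bounded k a : symbol k a -> bounded_family a.
Proof. by case: k => [|k] // []. Qed.

Lemma bounded_familyD a b : bounded_family a -> bounded_family b ->
  bounded_family (fun j l => a j l + b j l).
Proof.
move=> [C aC] [D bD]; exists (C + D) => j l.
by apply: le_trans (ler_normD _ _) _; exact: lerD.
Qed.

Lemma symbolD k a b : symbol k a -> symbol k b -> symbol k (fun j l => a j l + b j l).
Proof.
elim: k a b => [|k IH] a b /=; first exact: bounded_familyD.
move=> [ba sa] [bb sb]; split; first exact: bounded_familyD.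
rewrite (_ : scaled_diff _ = fun j l => scaled_diff a j l + scaled_diff b j l); first exact: IH.
by apply/funext => j; apply/funext => l; rewrite /scaled_diff; ring.
Qed.

Lemma symbolZ k (c : R) a : symbol k a -> symbol k (fun j l => c * a j l).
Proof.
have bZ b : bounded_family b -> bounded_family (fun j l => c * b j l).
  by move=> [C bC]; exists (`|c| * C) => j l; rewrite normrM; exact: ler_wpM2l.
elim: k a => [|k IH] a /=; first exact: bZ.
move=> [ba sa]; split; first exact: bZ.
rewrite (_ : scaled_diff _ = fun j l => c * scaled_diff a j l); first exact: IH.
by apply/funext => j; apply/funext => l; rewrite /scaled_diff; ring.
Qed.

Lemma symbolW k a : symbol k.+1 a -> symbol k a.
Proof.
elim: k a => [|k IH] a; first by case.
by move=> [ba sa]; split => //; exact: IH.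
Qed.

Lemma symbol_shift k a : symbol k a -> symbol k (fun j l => a j l.+1).
Proof.
have bS b : bounded_family b -> bounded_family (fun j l => b j l.+1).
  by move=> [C bC]; exists C.
elim: k a => [|k IH] a /=; first exact: bS.
by move=> [ba sa]; split; [exact: bS|exact: (IH _ sa)].
Qed.

Lemma banded_diff s a : banded s a -> banded (s + 1) (scaled_diff a).
Proof.
move=> ba j l; rewrite /scaled_diff mulf_eq0 negb_or => /andP[_].
have [al|al _] := eqVneq (a j l) 0; last first.
  have [h1 h2] := ba j l al; split=> //; apply: le_trans h1 _.
  by rewrite ler_pM2l// addrA lerDl.
rewrite al subr0 => al1; have [] := ba j l.+1 al1.
rewrite -natr1 => h1 h2; split; first by rewrite [s + 1]addrC addrA.
by apply: le_trans h2; rewrite lerDl.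
Qed.

Lemma bandedM s a (w : nat -> nat -> R) : banded s a -> banded s (fun j l => a j l * w j l).
Proof. by move=> ba j l; rewrite mulf_eq0 negb_or => /andP[al _]; exact: ba. Qed.

Lemma bounded_familyM (D : R) a w : bounded_family a ->
  (forall j l, a j l != 0 -> `|w j l| <= D) -> bounded_family (fun j l => a j l * w j l).
Proof.
move=> [C aC] wD; exists (C * `|D|) => j l; rewrite normrM.
have C0 : 0 <= C := le_trans (normr_ge0 _) (aC 0%N 0%N).
have [->|al] := eqVneq (a j l) 0; first by rewrite normr0 mul0r mulr_ge0.
by apply: ler_pM => //; apply: le_trans (wD j l al) (ler_norm _).
Qed.

(** On the band the factor is bounded, and its scaled difference is 1. *)
Lemma symbol_mul_pos k s i a : symbol k a -> banded s a ->
  symbol k (fun j l => a j l * ((l + i).+1%:R / n j)).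
Proof.
elim: k s a => [|k IH] s a sa ba.
  apply: (@bounded_familyM (B + i.+1%:R)) => // j l /(ba j l)[_ h2].
  rewrite ger0_norm ?divr_ge0 ?(ltW (n0 j))// -addnS natrD mulrDl; apply: lerD.
    by rewrite ler_pdivrMr.
  by rewrite ler_pdivrMr// ler_peMr.
split.
  apply: (@bounded_familyM (B + i.+1%:R)) (symbol_bounded sa) _ => j l /(ba j l)[_ h2].
  rewrite ger0_norm ?divr_ge0 ?(ltW (n0 j))// -addnS natrD mulrDl; apply: lerD.
    by rewrite ler_pdivrMr.
  by rewrite ler_pdivrMr// ler_peMr.
rewrite (_ : scaled_diff _ = fun j l =>
    scaled_diff a j l * ((l + i).+1%:R / n j) + a j l.+1).
  apply: symbolD; last by apply: symbol_shift; exact: symbolW.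
  by apply: IH (banded_diff ba); case: sa.
apply/funext => j; apply/funext => l; rewrite /scaled_diff addSn -[(l + i).+2%:R]natr1.
by field; rewrite gt_eqF.
Qed.

Let w (c : R) j l : R := n j / (2 * l%:R + c).

Let w_bound s (c : R) a j l : 1 <= c -> banded s a -> a j l != 0 -> `|w c j l| <= B * (1 + `|s|).
Proof.
move=> c1 ba /(ba j l)[h1 _].
have l0 : 0 <= l%:R :> R by [].
have d0 : 0 < 2 * l%:R + c by lra.
rewrite /w ger0_norm ?divr_ge0 ?(ltW (n0 j)) ?(ltW d0)// ler_pdivrMr//; apply: le_trans h1 _.
rewrite -mulrA ler_pM2l//.
have s1 := ler_norm s; have s0 := normr_ge0 s.
rewrite mulrDl mul1r; apply: lerD; first lra.
by apply: le_trans s1 _; rewrite ler_peMr//; lra.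
Qed.

(** On the band the inverse weight is bounded, and its scaled difference is a
multiple of a product of two inverse weights. *)
Lemma symbol_mul_inv k s (c : R) a : 1 <= c -> symbol k a -> banded s a ->
  symbol k (fun j l => a j l * w c j l).
Proof.
elim: k s c a => [|k IH] s c a c1 sa ba.
  by apply: (@bounded_familyM (B * (1 + `|s|))) => // j l; exact: w_bound.
split; first by apply: (@bounded_familyM (B * (1 + `|s|))) (symbol_bounded sa) _ => j l; exact: w_bound.
have c3 : 1 <= c + 2 by lra.
rewrite (_ : scaled_diff _ = fun j l =>
    scaled_diff a j l * w (c + 2) j l + (-2) * ((a j l * w c j l) * w (c + 2) j l)).
  apply: symbolD; first by apply: IH (banded_diff ba) => //; case: sa.
  have h : symbol k (fun j l => a j l * w c j l) by apply: IH ba => //; exact: symbolW.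
  exact: (symbolZ (-2) (IH s (c + 2) _ c3 h (@bandedM s a (w c) ba))).
apply/funext => j; apply/funext => l; rewrite /scaled_diff /w -[l.+1%:R]natr1.
have l0 : 0 <= l%:R :> R by [].
by field; apply/andP; split; rewrite gt_eqF//; lra.
Qed.

Let N j := (Num.truncn (B * n j)).+1.

Let band_top s a j l : banded s a -> (N j <= l)%N -> a j l = 0.
Proof.
move=> ba Nl; apply/eqP; apply: contraTT isT => /(ba j l)[_ h].
have : B * n j < l%:R.
  by apply: lt_le_trans (_ : (N j)%:R <= _); rewrite ?ler_nat// truncnS_gt.
by move=> /(le_lt_trans h); rewrite ltxx.
Qed.

Let band_bottom s a j l : banded s a -> B * (l%:R + s) < n j -> a j l = 0.
Proof.
move=> ba nl; apply/eqP; apply: contraTT isT => /(ba j l)[h _].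
by have := le_lt_trans h nl; rewrite ltxx.
Qed.

Let N_le j : (N j)%:R <= 2 * B * n j.
Proof.
have Bn1 : 1 <= B * n j by rewrite -[leLHS]mul1r; apply: ler_pM => //; exact: ltW.
rewrite /N -natr1; have : (Num.truncn (B * n j))%:R <= B * n j.
  by rewrite truncn_le mulr_ge0// ltW.
by move=> h; lra.
Qed.

(* the number of terms is of order n j *)
Let sum_band (f : nat -> R) (C : R) j : (forall l, (l < N j)%N -> `|f l| <= C) ->
  `|\sum_(l < N j) f l| <= 2 * B * n j * C.
Proof.
move=> fC; have C0 : 0 <= C by apply: le_trans (fC 0%N isT).
apply: le_trans (ler_norm_sum _ _ _) _.
apply: (@le_trans _ _ (\sum_(l < N j) C)); first by apply: ler_sum => l _; exact: fC.
by rewrite sumr_const card_ord -[C *+ _]mulr_natl ler_wpM2r.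
Qed.

Let legendre_sum_bound i a : bounded_family a -> exists C : R, forall j (x : R), -1 <= x <= 1 ->
  `|legendre_sum x (N j) i (a j)| <= C * n j ^+ 2.
Proof.
move=> [C aC]; exists (2 * B * ((4 * B + 2 * i%:R + 1) * C)) => j x x1.
have C0 : 0 <= C := le_trans (normr_ge0 _) (aC 0%N 0%N).
rewrite (_ : _ * n j ^+ 2 = 2 * B * n j * ((4 * B + 2 * i%:R + 1) * n j * C)); last by ring.
rewrite /legendre_sum.
apply: (@sum_band (fun l => (2 * (l + i)%:R + 1) * a j l * P x (l + i))) => l lN; rewrite !normrM.
have h : `|2 * (l + i)%:R + 1| <= (4 * B + 2 * i%:R + 1) * n j.
  rewrite ger0_norm ?addr_ge0 ?mulr_ge0// natrD.
  have l1 : l%:R <= 2 * B * n j by apply: le_trans (N_le j); rewrite ler_nat ltnW.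
  have := n1 j; have : 0 <= i%:R :> R by [].
  move=> i0 nj.
  rewrite (_ : (_ + _ + 1) * n j = 2 * (2 * B * n j + i%:R * n j) + n j); last by ring.
  apply: lerD => //; rewrite ler_pM2l//; apply: lerD => //.
  by rewrite ler_peMr.
rewrite -[leRHS]mulr1; apply: ler_pM => //; rewrite ?mulr_ge0//; first exact: ler_pM.
exact: legendreP_le1.
Qed.

Let small_scale (m : nat) (D : R) i a : bounded_family a ->
  exists C : R, forall j (x : R), -1 <= x <= 1 -> n j <= D ->
  (n j * Num.sqrt (1 - x)) ^+ m * `|legendre_sum x (N j) i (a j)| <= C * n j ^+ 2.
Proof.
move=> /(legendre_sum_bound i)[C hC]; exists ((D * 2) ^+ m * C) => j x x1 nD.
rewrite -mulrA; apply: ler_pM => //; last exact: hC.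
  by rewrite exprn_ge0// mulr_ge0 ?sqrtr_ge0 ?ltW.
have nj0 : 0 <= n j := ltW (n0 j).
have D0 : 0 <= D := le_trans nj0 nD.
apply: lerXn2r; rewrite ?nnegrE ?mulr_ge0 ?sqrtr_ge0//.
apply: ler_pM; rewrite ?sqrtr_ge0//.
rewrite (_ : 2 = Num.sqrt (2 ^+ 2)); last by rewrite sqrtr_sqr ger0_norm.
by rewrite ler_wsqrtr//; case/andP: x1 => ? ?; lra.
Qed.

(** Induction in steps of two: legendre_sum_diff trades the factor
(n sqrt(1 - x))^2 for two scaled differences, that is for two orders of the
symbol.  The odd case ends with one summation by parts and the bound on
P_l - P_(l+1).  At the scales for which the band touches the first coefficients,
where boundary terms would appear, n is bounded and the trivial estimate
suffices. *)
Theorem legendre_localization M i s a : symbol M a -> banded s a ->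
  exists C : R, forall j (x : R), -1 <= x <= 1 ->
  (n j * Num.sqrt (1 - x)) ^+ M * `|legendre_sum x (N j) i.+1 (a j)| <= C * n j ^+ 2.
Proof.
elim/ltn_ind: M i s a => -[|[|M]] IH i s a sa ba.
- have [C hC] := legendre_sum_bound i.+1 (symbol_bounded sa).
  by exists C => j x x1; rewrite expr0 mul1r; exact: hC.
- have [C1 hC1] := small_scale 1 (B * (0 + s)) i.+1 (symbol_bounded sa).
  have se : symbol 0 (fun j l => scaled_diff a j l * ((l + i.+1).+1%:R / n j)).
    by apply: symbol_mul_pos (banded_diff ba); case: sa.
  have [C2 hC2] := se.
  have BC : 0 <= 8 * B * `|C2| by rewrite mulr_ge0// mulr_ge0// ltW.
  exists (`|C1| + 8 * B * `|C2|) => j x x1.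
  have n2 : 0 <= n j ^+ 2 by rewrite sqr_ge0.
  have [nB|nB] := leP (n j) (B * (0 + s)).
    apply: le_trans (hC1 j x x1 nB) _; apply: ler_wpM2r => //.
    by apply: le_trans (ler_norm C1) _; rewrite lerDl.
  apply: (@le_trans _ _ (8 * B * `|C2| * n j ^+ 2)); last first.
    by rewrite ler_wpM2r// lerDr.
  set S := legendre_sum _ _ _ _; set q := Num.sqrt (1 - x).
  have [x10|x10] := eqVneq q 0.
    by rewrite x10 mulr0 expr1 mul0r mulr_ge0.
  have q0 : 0 < q by rewrite lt_neqAle eq_sym x10 sqrtr_ge0.
  have q2 : q ^+ 2 = 1 - x by rewrite sqr_sqrtr//; case/andP: x1 => ? ?; lra.
  have a0 : a j 0%N = 0 by exact: (@band_bottom s a j 0%N ba nB).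
  have aN : a j (N j) = 0 by exact: (@band_top s a j (N j) ba (leqnn _)).
  have := legendre_sum_flux x i a0 aN; rewrite -/S -q2 => h.
  have b : `|q ^+ 2 * S| <= 2 * B * n j * (`|C2| * (4 * q)).
    rewrite h.
    apply: (@sum_band (fun l => flux i.+1 (a j) l * (P x (l + i.+1) - P x (l + i.+1).+1))) => l _.
    have -> : flux i.+1 (a j) l = - (scaled_diff a j l * ((l + i.+1).+1%:R / n j)).
      by rewrite /flux /scaled_diff; field; rewrite gt_eqF.
    rewrite normrM normrN; apply: ler_pM => //; last exact: legendrePB_le.
    exact: le_trans (hC2 j l) (ler_norm _).
  rewrite expr1 -(ler_pM2l q0).
  have -> : q * (n j * q * `|S|) = n j * `|q ^+ 2 * S|.
    by rewrite normrM (ger0_norm (sqr_ge0 q)); ring.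
  have -> : q * (8 * B * `|C2| * n j ^+ 2) = n j * (2 * B * n j * (`|C2| * (4 * q))) by ring.
  by rewrite ler_pM2l.
have [C1 hC1] := small_scale M.+2 (B * (1 + s)) i.+1 (symbol_bounded sa).
pose e j l := scaled_diff a j l * ((l + i.+1).+1%:R / n j).
pose c : R := 2 * i.+2%:R + 1.
have c1 : 1 <= c by rewrite lerDr mulr_ge0.
have be : banded (s + 1 + 1) (scaled_diff e).
  by apply: banded_diff; apply: (@bandedM (s + 1)); exact: banded_diff.
have se : symbol M.+1 e by apply: symbol_mul_pos (banded_diff ba); case: sa.
have sw : symbol M (fun j l => scaled_diff e j l * w c j l).
  by apply: symbol_mul_inv be => //; case: se.
have [C2 hC2] := IH M (leqnSn _) i.+1 _ _ sw (@bandedM _ _ (w c) be).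
exists (`|C1| + `|C2|) => j x x1.
have n2 : 0 <= n j ^+ 2 by rewrite sqr_ge0.
have [nB|nB] := leP (n j) (B * (1 + s)).
  apply: le_trans (hC1 j x x1 nB) _; apply: ler_wpM2r => //.
  by apply: le_trans (ler_norm C1) _; rewrite lerDl.
apply: (@le_trans _ _ (C2 * n j ^+ 2)); last first.
  by rewrite ler_wpM2r//; apply: le_trans (ler_norm C2) _; rewrite lerDr.
apply: le_trans (hC2 j x x1).
have a0 : a j 0%N = 0.
  apply: (@band_bottom s a j 0%N ba); apply: le_lt_trans nB.
  by rewrite ler_pM2l// lerD2r ler01.
have a1 : a j 1%N = 0 by exact: (@band_bottom s a j 1%N ba nB).
have aN : a j (N j) = 0 by exact: (@band_top s a j (N j) ba (leqnn _)).
have aN1 : a j (N j).+1 = 0 by exact: (@band_top s a j (N j).+1 ba (leqnSn _)).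
have h := legendre_sum_diff x i a0 a1 aN aN1.
set S := legendre_sum _ _ _ _; set q := Num.sqrt (1 - x).
have q2 : q ^+ 2 = 1 - x by rewrite sqr_sqrtr//; case/andP: x1 => ? ?; lra.
rewrite -q2 -/S in h.
have -> : (n j * q) ^+ M.+2 * `|S| = (n j * q) ^+ M * `|n j ^+ 2 * (q ^+ 2 * S)|.
  by rewrite normrM (ger0_norm (sqr_ge0 (n j))) normrM (ger0_norm (sqr_ge0 q)) !exprS; ring.
rewrite h le_eqVlt; apply/orP; left; apply/eqP; congr (_ * _).
rewrite -normrN /legendre_sum mulr_sumr -sumrN; congr (`|_|); apply: eq_bigr => l _.
have -> : n j ^+ 2 * ((2 * (l + i.+2)%:R + 1) * flux_diff i.+1 (a j) l * P x (l + i.+2)) =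
  (2 * (l + i.+2)%:R + 1) * (n j ^+ 2 * flux_diff i.+1 (a j) l) * P x (l + i.+2) by ring.
rewrite -mulNr -mulrN; congr (_ * _ * _).
rewrite /flux_diff /flux /w /c {1}/scaled_diff /e /scaled_diff natrD.
have d0 : 0 < 2 * (l%:R + i.+2%:R) + 1 :> R by rewrite ltr_wpDl// mulr_ge0// addr_ge0.
rewrite (_ : 2 * (l%:R + i.+2%:R) + 1 = 2 * l%:R + (2 * i.+2%:R + 1)) in d0 *; last by ring.
by rewrite addSn; field; rewrite -(natrD _ 2 i) !gt_eqF.
Qed.

End Localization.

(** * From smooth functions to discrete symbols *)

Section Tame.
Variables (R : realType) (n : nat -> R).
Hypothesis n1 : forall j, 1 <= n j.
Implicit Types F G : nat -> R -> R.

Let n0 j : 0 < n j. Proof. exact: lt_le_trans (n1 j). Qed.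

Definition bounded_pos F := exists C : R, forall j t, 0 < t -> `|F j t| <= C.

Fixpoint tame k F : Prop :=
  bounded_pos F /\ if k is k'.+1 then
    exists2 F', (forall j (t : R), 0 < t -> is_derive t 1 (F j) (F' j t)) & tame k' F'
  else True.

Lemma tame_bounded k F : tame k F -> bounded_pos F.
Proof. by case: k => [|k] []. Qed.

Lemma tameD k F G : tame k F -> tame k G -> tame k (fun j t => F j t + G j t).
Proof.
have bD F1 G1 : bounded_pos F1 -> bounded_pos G1 -> bounded_pos (fun j t => F1 j t + G1 j t).
  move=> [C FC] [D GD]; exists (C + D) => j t t0.
  by apply: le_trans (ler_normD _ _) _; apply: lerD; [exact: FC|exact: GD].
elim: k F G => [|k IH] F G [bF hF] [bG hG]; split => //; try exact: bD.
case: hF hG => F' dF tF [G' dG tG].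
exists (fun j t => F' j t + G' j t); last exact: IH.
by move=> j t t0; have := dF j t t0; have := dG j t t0 => dg df; exact: is_deriveD.
Qed.

Lemma tameZ k (c : R) F : tame k F -> tame k (fun j t => c * F j t).
Proof.
have bZ G : bounded_pos G -> bounded_pos (fun j t => c * G j t).
  by move=> [C GC]; exists (`|c| * C) => j t t0; rewrite normrM ler_wpM2l// GC.
elim: k F => [|k IH] F [bF hF]; split => //; try exact: bZ.
case: hF => F' dF tF; exists (fun j t => c * F' j t); last exact: IH.
by move=> j t t0; have df := dF j t t0; exact: is_deriveZ.
Qed.

Let dq F j (t : R) := n j * (F j (t + (n j)^-1) - F j t).

Let dq_bounded F F' : (forall j (t : R), 0 < t -> is_derive t 1 (F j) (F' j t)) ->
  bounded_pos F' -> bounded_pos (dq F).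
Proof.
move=> dF [C FC]; exists C => j t t0.
have h0 : 0 < (n j)^-1 by rewrite invr_gt0.
have tth : t < t + (n j)^-1 by rewrite ltrDl.
have [||c ct] := @MVT _ (F j) (F' j) t (t + (n j)^-1) tth.
- by move=> x; rewrite in_itv /= => /andP[tx _]; apply: dF; exact: lt_trans tx.
- apply: derivable_within_continuous => x; rewrite in_itv /= => /andP[tx _].
  by have [] := dF j x (lt_le_trans t0 tx).
rewrite addrAC subrr add0r /dq => ->; rewrite mulrCA divff ?mulr1 ?gt_eqF//.
by apply: FC; move: ct; rewrite in_itv /= => /andP[tc _]; exact: lt_trans tc.
Qed.

(* difference quotients cost one derivative *)
Let tame_dq k F : tame k.+1 F -> tame k (dq F).
Proof.
elim: k F => [|k IH] F [bF [F' dF tF]].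
  by split => //; exact: (dq_bounded dF tF.1).
split; first exact: (dq_bounded dF tF.1).
exists (dq F'); last exact: IH.
move=> j t t0; rewrite /dq.
have h0 : 0 < (n j)^-1 by rewrite invr_gt0.
have d1 : is_derive t 1 (F j) (F' j t) by exact: dF.
have d2 : is_derive (t + (n j)^-1) 1 (F j) (F' j (t + (n j)^-1)).
  by apply: dF; rewrite addr_gt0.
have d3 : is_derive t 1 (fun u => F j (u + (n j)^-1)) (F' j (t + (n j)^-1)).
  have := @is_derive1_comp _ (F j) (shift (n j)^-1) t _ _ d2 (is_derive_shift t 1 _).
  by rewrite mulr1.
have d4 : is_derive t 1 (fun u => F j (u + (n j)^-1) - F j u)
    (F' j (t + (n j)^-1) - F' j t) by exact: is_deriveB.
exact: is_deriveZ.
Qed.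

(** Scaled differences of the samples are samples of difference quotients, which
are bounded by the mean value theorem and have one derivative fewer. *)
Lemma tame_symbol k F : tame k F -> symbol n k (fun j l => F j (l.+1%:R / n j)).
Proof.
elim: k F => [|k IH] F tF.
  by have [C FC] := tame_bounded tF; exists C => j l; apply: FC; rewrite divr_gt0.
split.
  by have [C FC] := tame_bounded tF; exists C => j l; apply: FC; rewrite divr_gt0.
rewrite (_ : scaled_diff _ _ = fun j l => dq F j (l.+1%:R / n j)); first exact/IH/tame_dq.
apply/funext => j; apply/funext => l; rewrite /scaled_diff /dq.
by rewrite -[l.+2%:R]natr1 mulrDl mul1r.
Qed.

End Tame.

(** * Calculus at the edges of the window *)

Section Calculus.
Variable R : realType.
Implicit Types (f p : R -> R).

Lemma is_derive_cvg f (a l : R) :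
  (fun h => h^-1 *: (f (h *: 1 + a) - f a)) @ 0^' --> l -> is_derive a (1 : R) f l.
Proof.
move=> fl; apply: DeriveDef; first exact: cvgP fl.
by apply: cvg_lim => //; exact: fl.
Qed.

Lemma is_derive_cvgP f (a l : R) : is_derive a (1 : R) f l ->
  (fun h => h^-1 *: (f (h *: 1 + a) - f a)) @ 0^' --> l.
Proof. by move=> [df <-]; exact: df. Qed.

Lemma derive1_locally_cst f (a b c x : R) : (forall y, y \in `]a, b[ -> f y = c) ->
  x \in `]a, b[ -> f^`()%classic x = 0.
Proof.
move=> fc xab; rewrite derive1E.
rewrite (@near_eq_derive _ _ _ f (cst c) x 1) ?derive_cst//.
by near=> y; apply: fc; near: y; exact: near_in_itvoo.
Unshelve. all: end_near. Qed.

Lemma continuous_eq0_right f (a b : R) : {for a, continuous f} -> a < b ->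
  (forall y, y \in `]a, b[ -> f y = 0) -> f a = 0.
Proof.
move=> cf ab f0.
have h1 : f y @[y --> a^'+] --> f a by exact: cvg_at_right_filter.
have h2 : f y @[y --> a^'+] --> (0 : R).
  apply: cvg_near_cst; near=> y; apply: f0; rewrite in_itv /=; apply/andP; split.
    by near: y; exact: nbhs_right_gt.
  by near: y; exact: nbhs_right_lt.
exact: (cvg_unique _ h1 h2).
Unshelve. all: end_near. Qed.

Lemma continuous_eq0_left f (a b : R) : {for b, continuous f} -> a < b ->
  (forall y, y \in `]a, b[ -> f y = 0) -> f b = 0.
Proof.
move=> cf ab f0.
have h1 : f y @[y --> b^'-] --> f b by exact: cvg_at_left_filter.
have h2 : f y @[y --> b^'-] --> (0 : R).
  apply: cvg_near_cst; near=> y; apply: f0; rewrite in_itv /=; apply/andP; split.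
    by near: y; exact: nbhs_left_gt.
  by near: y; exact: nbhs_left_lt.
exact: (cvg_unique _ h1 h2).
Unshelve. all: end_near. Qed.

(** The bound makes p f an o(t - a) as soon as p is one, even where f oscillates. *)
Lemma is_derive_flat p f (a K : R) : 0 < a -> is_derive a 1 p 0 -> p a = 0 ->
  (forall t, 0 < t -> `|p t * f t| <= K * `|p t|) ->
  is_derive a 1 (fun t => p t * f t) 0.
Proof.
move=> a0 /is_derive_cvgP dp pa pK; apply: is_derive_cvg.
have K0 : 0 < `|K| + 1 by rewrite ltr_wpDl.
apply/cvgrPdist_lt => e e0; have eK : 0 < e / (`|K| + 1) by rewrite divr_gt0.
move/cvgrPdist_lt : dp => /(_ _ eK) dp.
have pos : \forall h \near (0 : R)^', 0 < h + a.
  rewrite near_withinE; apply/nbhs_ballP; exists a => //= h.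
  rewrite /ball /= sub0r normrN => ha _; have := ler_norm (- h); rewrite normrN; lra.
near=> h.
have h1 : 0 < h + a by near: h.
have h2 : `|0 - h^-1 *: (p (h *: 1 + a) - p a)| < e / (`|K| + 1) by near: h.
move: h2; rewrite pa mul0r !subr0 !sub0r !normrN /GRing.scale /= mulr1 => h2.
rewrite normrM; apply: (@le_lt_trans _ _ ((`|K| + 1) * `|h^-1 * p (h + a)|)).
  rewrite [`|h^-1 * p _|]normrM [leRHS]mulrCA; apply: ler_wpM2l => //; apply: le_trans (pK _ h1) _.
  by apply: ler_wpM2r => //; apply: le_trans (ler_norm K) _; rewrite lerDl.
by rewrite mulrC -ltr_pdivlMr.
Unshelve. all: end_near. Qed.

Lemma derive_within_interior f (a b x : R) : derivable_within `[a, b] f x ->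
  x \in `]a, b[ -> is_derive x 1 f (derive_within `[a, b] f x).
Proof.
rewrite /derivable_within /derive_within => cf; rewrite in_itv /= => /andP[ax xb].
have {}cf : diff_quot f x @ within `[a, b] x^' --> lim (diff_quot f x @ within `[a, b] x^') by [].
set l := lim _ in cf *; apply: is_derive_cvg; apply/cvgrPdist_lt => e e0.
move/cvgrPdist_lt : cf => /(_ _ e0).
rewrite !near_withinE => /nbhs_ballP[r /= r0 hr].
apply/nbhs_ballP; exists (Num.min r (Num.min (x - a) (b - x))) => /=.
  by rewrite !lt_min r0 !subr_gt0 ax xb.
move=> h; rewrite /ball /= sub0r normrN !lt_min => /and3P[h1 h2 h3] h0.
have := hr (h + x); rewrite /ball /= opprD addrCA subrr addr0 normrN => /(_ h1).
rewrite /diff_quot addrK.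
have -> : (h *: 1 + x : R) = h + x by rewrite /GRing.scale /= mulr1.
rewrite /GRing.scale /= [h^-1 * _]mulrC; apply.
  by rewrite -subr_eq0 addrK.
rewrite in_itv /=; move: h2 h3; rewrite !ltr_norml => /andP[? ?] /andP[? ?].
by apply/andP; split; lra.
Qed.

End Calculus.

(** * The coefficients of the needlet covariance are tame *)

Section WindowTerms.
Variables (R : realType) (B : R) (phi : R -> R).
Hypotheses (B1 : 1 < B) (phiP : is_window B phi).

Let B0 : 0 < B. Proof. exact: lt_trans B1. Qed.
Let BV1 : B^-1 < 1. Proof. by rewrite invf_lt1. Qed.
Let BV0 : 0 < B^-1. Proof. by rewrite invr_gt0. Qed.

Let D i : R -> R := derive1n i phi.

Let dD i (x : R) : is_derive x 1 (D i) (D i.+1 x).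
Proof.
have [dphi _ _ _ _] := phiP; have := dphi i x => /derivableP.
by rewrite /D derive1nS derive1E.
Qed.

Let contD i : continuous (D i).
Proof.
by move=> x; have [dphi _ _ _ _] := phiP; apply/differentiable_continuous/derivable1_diffP/dphi.
Qed.

Let D_gt1 i x : 1 < x -> D i x = 0.
Proof.
elim: i x => [|i IH] x x1.
  by have [_ _ _ h _] := phiP; apply: h; rewrite gtr0_norm// (lt_trans ltr01).
rewrite /D derive1nS; apply: (@derive1_locally_cst _ _ 1 (x + 1) 0).
  by move=> y; rewrite in_itv /= => /andP[y1 _]; exact: IH.
by rewrite in_itv /= x1 ltrDl ltr01.
Qed.

Let D_ge1 i x : 1 <= x -> D i x = 0.
Proof.
rewrite le_eqVlt => /orP[/eqP <-|]; last exact: D_gt1.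
apply: (@continuous_eq0_right _ _ 1 2); [exact: contD|lra|].
by move=> y; rewrite in_itv /= => /andP[y1 _]; exact: D_gt1.
Qed.

Let phi1 x : 0 < x -> x <= B^-1 -> phi x = 1.
Proof. by move=> x0 xB; have [_ _ _ _ [_ h]] := phiP; apply: h; rewrite gtr0_norm. Qed.

Let D_small_lt i x : 0 < x -> x < B^-1 -> D i.+1 x = 0.
Proof.
elim: i x => [|i IH] x x0 xB; rewrite /D derive1nS.
  apply: (@derive1_locally_cst _ _ 0 B^-1 1); last by rewrite in_itv /= x0.
  by move=> y; rewrite in_itv /= => /andP[y0 yB]; apply: phi1 => //; exact: ltW.
apply: (@derive1_locally_cst _ _ 0 B^-1 0); last by rewrite in_itv /= x0.
by move=> y; rewrite in_itv /= => /andP[y0 yB]; exact: IH.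
Qed.

Let D_small i x : 0 < x -> x <= B^-1 -> D i.+1 x = 0.
Proof.
move=> x0; rewrite le_eqVlt => /orP[/eqP ->|]; last exact: D_small_lt.
apply: (@continuous_eq0_left _ _ 0); [exact: contD|exact: BV0|].
by move=> y; rewrite in_itv /= => /andP[y0 yB]; exact: D_small_lt.
Qed.

(** The i-th derivative of b^2.  Working with b^2 avoids the square root in b,
which need not be smooth. *)
Definition window_deriv i (t : R) : R := B^-1 ^+ i * D i (t / B) - D i t.

Let q := window_deriv.

Lemma window_derivP i (t : R) : is_derive t 1 (q i) (q i.+1 t).
Proof.
have d1 := dD i t; have d2 := dD i (t / B).
have d3 : is_derive t 1 (fun u : R => u / B) B^-1.
  have h := @is_deriveZ R R R^o id B^-1 t 1 1 (is_derive_id t 1).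
  rewrite /GRing.scale /= mulr1 in h.
  by rewrite (_ : (fun u : R => u / B) = B^-1 \*: id)//; apply/funext => u /=; rewrite mulrC.
have d4 : is_derive t 1 (fun u => D i (u / B)) (D i.+1 (t / B) * B^-1).
  exact: (@is_derive1_comp _ (D i) (fun u => u / B) t).
have d5 : is_derive t 1 (fun u => B^-1 ^+ i * D i (u / B)) (B^-1 ^+ i * (D i.+1 (t / B) * B^-1)).
  exact: is_deriveZ.
rewrite /q /window_deriv exprSr.
rewrite (_ : B^-1 ^+ i / B * D i.+1 (t / B) = B^-1 ^+ i * (D i.+1 (t / B) * B^-1)); last by ring.
exact: is_deriveB.
Qed.

(** Derivatives of phi vanish beyond 1 and, of positive order, below 1/B; at the
two edges this follows by continuity. *)
Lemma window_deriv_out i t : 0 < t -> t \notin `]B^-1, B[ -> q i t = 0.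
Proof.
move=> t0; rewrite in_itv /= negb_and -!leNgt => /orP[tB|tB].
  have tBB : t / B <= B^-1 by apply: le_trans tB; rewrite ler_pdivrMr// ler_peMr// ltW.
  have tB0 : 0 < t / B by rewrite divr_gt0.
  rewrite /q /window_deriv; case: i => [|i].
    by rewrite expr0 mul1r /D /= !phi1 ?subrr.
  by rewrite !D_small// mulr0 subrr.
have tB1 : 1 <= t / B by rewrite ler_pdivlMr// mul1r.
by rewrite /q /window_deriv !D_ge1 ?mulr0 ?subrr// (le_trans _ tB)// ltW.
Qed.

Lemma window_bE x : 0 <= x -> window_b B phi x ^+ 2 = q 0 x.
Proof.
move=> x0; rewrite /window_b sqr_sqrtr /q /window_deriv ?expr0 ?mul1r//.
have [_ _ h _ _] := phiP; rewrite subr_ge0; apply: h.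
  by rewrite divr_ge0// ltW.
by rewrite ler_pdivrMr// ler_peMr// ltW.
Qed.

Lemma continuous_window_deriv0 : continuous (q 0).
Proof.
by move=> x; apply/differentiable_continuous/derivable1_diffP; have [] := window_derivP 0 x.
Qed.

Lemma window_deriv0_1 : q 0 1 = 1.
Proof.
rewrite /q /window_deriv expr0 mul1r (D_ge1 0 (lexx 1)) subr0 mul1r.
by apply: phi1.
Qed.

Variables (M : nat) (g : nat -> R -> R) (kappa : nat -> R).
Hypothesis gD : forall j, n_derivable_within `[B^-1, B] M (g j).
Hypothesis gB : forall r j u, (r <= M)%N -> u \in `[B^-1, B] ->
  `|derive_withinn `[B^-1, B] r (g j) u| <= kappa r.

Let G r j : R -> R := derive_withinn `[B^-1, B] r (g j).

(** By Leibniz' rule the span of these products is stable under differentiation,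
which replaces a formula for the derivatives of b^2(t) t^c g_j(t). *)
Definition window_term i (c : R) r j (t : R) : R := q i t * t `^ c * G r j t.

Let qpow i (c : R) (t : R) : R := q i t * t `^ c.

Let qpowP i c (t : R) : 0 < t ->
  is_derive t 1 (qpow i c) (q i.+1 t * t `^ c + c * (q i t * t `^ (c - 1))).
Proof.
move=> t0; have d1 := window_derivP i t.
have d2 : is_derive t 1 (@powR R ^~ c) (c * t `^ (c - 1)) by exact: is_derive1_powR.
have := is_deriveM d1 d2; rewrite /GRing.scale /=.
set v := (X in _ -> is_derive _ _ _ X).
suff -> : v = q i t * (c * t `^ (c - 1)) + t `^ c * q i.+1 t by [].
by rewrite /v; ring.
Qed.

Let qpow_bounded i c : exists C : R, forall t, t \in `[B^-1, B] -> `|qpow i c t| <= C.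
Proof.
apply: within_continuous_bounded; first by apply: ltW; exact: lt_trans B1.
apply: derivable_within_continuous => x; rewrite in_itv /= => /andP[xB _].
by have [] := @qpowP i c x (lt_le_trans BV0 xB).
Qed.

Let term_bounded i c r : (r <= M)%N -> bounded_pos (window_term i c r).
Proof.
move=> rM; have [C hC] := qpow_bounded i c.
exists (C * kappa r) => j t t0.
have mid : 1 \in `[B^-1, B] by rewrite in_itv /= !ltW.
have C0 : 0 <= C := le_trans (normr_ge0 _) (hC _ mid).
have k0 : 0 <= kappa r := le_trans (normr_ge0 _) (gB j rM mid).
have [ti|ti] := boolP (t \in `]B^-1, B[); last first.
  by rewrite /window_term -/q window_deriv_out// !mul0r normr0 mulr_ge0.
have ti' : t \in `[B^-1, B] by exact: subset_itv_oo_cc ti.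
by rewrite /window_term normrM; apply: ler_pM => //; [exact: hC|exact: gB].
Qed.

Let term_deriv i c r j (t : R) : (r < M)%N -> 0 < t ->
  is_derive t 1 (window_term i c r j)
    (window_term i.+1 c r j t + c * window_term i (c - 1) r j t + window_term i c r.+1 j t).
Proof.
move=> rM t0; have [ti|ti] := boolP (t \in `]B^-1, B[).
  have d1 := @qpowP i c t t0.
  have ti' : `[B^-1, B]%classic t by exact: subset_itv_oo_cc ti.
  have d2 : is_derive t 1 (G r j) (G r.+1 j t).
    exact: (derive_within_interior (gD rM ti') ti).
  have := is_deriveM d1 d2; rewrite /GRing.scale /= => d3.
  rewrite /window_term -/q.
  set v := (X in is_derive _ _ _ X).
  suff -> : v = qpow i c t * G r.+1 j t + G r j t * (q i.+1 t * t `^ c + c * (q i t * t `^ (c - 1))).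
    exact: d3.
  by rewrite /v /qpow; ring.
rewrite /window_term -/q !window_deriv_out// !mul0r mulr0 !addr0.
apply: (@is_derive_flat _ (qpow i c) (G r j) t (kappa r)) => //.
- by have := @qpowP i c t t0; rewrite !window_deriv_out// !mul0r mulr0 addr0.
- by rewrite /qpow window_deriv_out// mul0r.
move=> u u0; have [ui|ui] := boolP (u \in `]B^-1, B[); last first.
  by rewrite /qpow window_deriv_out// !mul0r normr0 mulr0.
rewrite normrM mulrC; apply: ler_wpM2r => //.
by apply: gB; [exact: ltnW|exact: subset_itv_oo_cc ui].
Qed.

(** Each differentiation raises i or r or lowers c.  At the edges of [1/B, B] the
function g_j has one-sided derivatives only, but there the factor derived from
b^2 vanishes with its derivative. *)
Lemma tame_window_term k i c r : (r + k <= M)%N -> tame k (window_term i c r).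
Proof.
elim: k i c r => [|k IH] i c r rk.
  by split => //; apply: term_bounded; rewrite -[r]addn0.
split; first by apply: term_bounded; apply: leq_trans rk; rewrite leq_addr.
exists (fun j t => window_term i.+1 c r j t + c * window_term i (c - 1) r j t + window_term i c r.+1 j t).
  move=> j t t0; apply: term_deriv => //.
  by apply: leq_trans rk; rewrite addnS ltnS leq_addr.
apply: tameD; last by apply: IH; rewrite addSnnS.
have rk' : (r + k <= M)%N by apply: leq_trans rk; rewrite leq_add2l.
by apply: tameD; [exact: IH|apply: tameZ; exact: IH].
Qed.

End WindowTerms.

(** * Random integrals over the sphere *)

Section RandomIntegrals.
Variables (R : realType) (sigma : {measure set (sphere R) -> \bar R}).
Hypothesis sigmaP : is_surface_measure sigma.

Let sigma_fin : fin_num_fun sigma.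
Proof.
move=> A mA; rewrite ge0_fin_numE ?measure_ge0//.
apply: le_lt_trans (surface_lty sigmaP).
by apply: le_measure; rewrite ?inE//; exact: subsetT.
Qed.

Let sgf : set (sphere R) -> \bar R := sigma.
(* sigma as a finite measure, the form in which Fubini's theorem applies *)
HB.instance Definition _ := Measure.copy sgf sigma.
HB.instance Definition _ := Measure_isFinite.Build _ _ _ sgf sigma_fin.

Let sg : {finite_measure set (sphere R) -> \bar R} := sgf.

Variables (d : measure_display) (Omega : measurableType d) (P : probability Omega R).
Variables (T : sphere R -> {RV P >-> R}) (K : R -> R).
Hypotheses (mT : measurable_field T) (isoT : isotropic T K).

Implicit Types (X Y : Omega -> R) (psi : sphere R -> R).

Definition L2 X := measurable_fun [set: Omega] X /\
  (\int[P]_w ((X w) ^+ 2)%:E < +oo)%E.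

Let sdotxx (x : sphere R) : sdot x x = 1. Proof. exact: sphereP. Qed.

Let ETT x y : (\int[P]_w (T x w * T y w)%:E = (K (sdot x y))%:E)%E.
Proof. by have := isoT x y; rewrite unlock. Qed.

Lemma L2_field x : L2 (T x).
Proof.
split; first exact: measurable_funPT.
by under eq_integral do rewrite expr2; rewrite ETT ltry.
Qed.

Let young (a b : R) : `|a * b| <= (a ^+ 2 + b ^+ 2) / 2.
Proof.
have h1 : 0 <= (a - b) ^+ 2 by exact: sqr_ge0.
have h2 : 0 <= (a + b) ^+ 2 by exact: sqr_ge0.
rewrite ler_norml; apply/andP; split; nra.
Qed.

Let sq_meas X : measurable_fun [set: Omega] X ->
  measurable_fun [set: Omega] (fun w => ((X w) ^+ 2)%:E).
Proof. by move=> mX; apply/measurable_EFinP; exact: measurable_funX. Qed.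

Let sq_ge0 X (w : Omega) : (0 <= ((X w) ^+ 2)%:E)%E.
Proof. by rewrite lee_fin sqr_ge0. Qed.

Let int_sqD X Y : measurable_fun [set: Omega] X -> measurable_fun [set: Omega] Y ->
  (\int[P]_w ((X w ^+ 2)%:E + (Y w ^+ 2)%:E) =
   \int[P]_w (X w ^+ 2)%:E + \int[P]_w (Y w ^+ 2)%:E)%E.
Proof.
by move=> mX mY; apply: ge0_integralD => //; try exact: sq_meas.
Qed.

Lemma L2_integrableM X Y : L2 X -> L2 Y -> P.-integrable [set: Omega] (EFin \o (fun w => X w * Y w)).
Proof.
move=> [mX X2] [mY Y2]; apply/integrableP; split.
  by apply/measurable_EFinP; exact: measurable_funM.
apply: (@le_lt_trans _ _ (\int[P]_w ((X w ^+ 2)%:E + (Y w ^+ 2)%:E)))%E.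
  apply: ge0_le_integral => //.
  - by apply: measurableT_comp => //; apply/measurable_EFinP; exact: measurable_funM.
  - by apply: emeasurable_funD; exact: sq_meas.
  move=> w _ /=; rewrite -EFinD lee_fin; apply: le_trans (young _ _) _.
  have := sqr_ge0 (X w); have := sqr_ge0 (Y w) => *; lra.
by rewrite int_sqD// lte_add_pinfty.
Qed.

Let swapTm : measurable_fun [set: sphere R * Omega] (fun p => T p.1 p.2).
Proof. exact: mT. Qed.

(* the kernel whose two iterated integrals are compared *)
Let ker X psi (p : sphere R * Omega) : \bar R := (X p.2 * (T p.1 p.2 * psi p.1))%:E.

Let ker_meas X psi : L2 X -> bmeas psi -> measurable_fun setT (ker X psi).
Proof.
move=> [mX _] [mpsi _]; apply/measurable_EFinP; apply: measurable_funM.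
  by apply: (measurableT_comp mX); exact: measurable_snd.
apply: measurable_funM => //.
by apply: (measurableT_comp mpsi); exact: measurable_fst.
Qed.

Let ker_integrable X psi : L2 X -> bmeas psi ->
  (sg \x P)%E.-integrable setT (ker X psi).
Proof.
move=> LX bpsi; apply/integrable12ltyP; first exact: ker_meas.
have [mX X2] := LX; have [mpsi [M psiM]] := bpsi.
have M0 : 0 <= M := le_trans (normr_ge0 _) (psiM point).
set EX := (\int[P]_w ((X w) ^+ 2)%:E)%E in X2.
have EX0 : (0 <= EX)%E by apply: integral_ge0 => w _; rewrite lee_fin sqr_ge0.
have EXfin : EX \is a fin_num by rewrite ge0_fin_numE.
apply: (@le_lt_trans _ _ (\int[sg]_x (M%:E * (EX + (K 1)%:E))))%E; last first.
  rewrite integral_cst//= -(fineK EXfin) -EFinD -EFinM.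
  by rewrite (_ : sgf _ = sigma setT)// sigmaP.1 -EFinM ltry.
apply: ge0_le_integral => //.
- by move=> x _; exact: integral_ge0.
- apply: (measurable_fun_fubini_tonelli_F (abse \o ker X psi)) => //=.
  by apply: measurableT_comp => //; exact: ker_meas.
move=> x _.
have -> : (EX + (K 1)%:E = \int[P]_w ((X w ^+ 2)%:E + (T x w ^+ 2)%:E))%E.
  rewrite int_sqD//; congr (_ + _)%E.
  by rewrite -(sdotxx x) -ETT; apply: eq_integral => w _; rewrite expr2.
rewrite -ge0_integralZl//; last 2 first.
- by apply: emeasurable_funD; exact: sq_meas.
- by move=> w _; rewrite adde_ge0.
apply: ge0_le_integral => //.
- apply: measurableT_comp => //.
  by apply: (measurableT_comp (ker_meas LX bpsi)); exact: measurable_pair1.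
- by apply: emeasurable_funM => //; apply: emeasurable_funD; exact: sq_meas.
move=> w _ /=; rewrite -EFinD -EFinM lee_fin mulrA normrM mulrC.
apply: ler_pM => //.
apply: le_trans (young _ _) _.
have := sqr_ge0 (X w); have := sqr_ge0 (T x w) => *; lra.
Qed.

Lemma measurable_random_integral psi : bmeas psi ->
  measurable_fun [set: Omega] (fun w => \int[sigma]_x (T x w * psi x)).
Proof.
move=> bpsi; have L1 : L2 (fun=> 1).
  split; first exact: measurable_cst.
  by rewrite integral_cst// expr1n mul1e (le_lt_trans (probability_le1 _ _))// ltry.
have := measurable_fubini_G (ker_integrable L1 bpsi).
move=> h; apply: measurableT_comp; first exact: fine_measurable.
rewrite [X in measurable_fun _ X](_ : _ = fubini_G sg (ker (fun=> 1) psi))//.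
by apply/funext => w; apply: eq_integral => x _; rewrite /ker mul1r.
Qed.

(** Fubini's theorem, applicable since |X T(x)| is dominated by
(X^2 + T(x)^2) / 2, whose expectation does not depend on x. *)
Lemma expectation_random_integral X psi : L2 X -> bmeas psi ->
  (\int[P]_w (X w * \int[sigma]_x (T x w * psi x))%:E =
   \int[sigma]_x (psi x * fine (\int[P]_w (X w * T x w)%:E))%:E)%E.
Proof.
move=> LX bpsi; have L1 : L2 (fun=> 1).
  split; first exact: measurable_cst.
  by rewrite integral_cst// expr1n mul1e (le_lt_trans (probability_le1 _ _))// ltry.
have iX := ker_integrable LX bpsi; have i1 := ker_integrable L1 bpsi.
have := Fubini iX.
have -> : (\int[sg]_x \int[P]_y ker X psi (x, y) =
   \int[sigma]_x (psi x * fine (\int[P]_w (X w * T x w)%:E))%:E)%E.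
  apply: eq_integral => x _; rewrite /ker /=.
  have iXT := L2_integrableM LX (L2_field x).
  rewrite EFinM fineK; last exact: integrable_fin_num.
  rewrite -integralZl//; apply: eq_integral => w _.
  by rewrite -EFinM /=; congr (_%:E); ring.
move=> ->; apply: ae_eq_integral => //.
- apply/measurable_EFinP; apply: measurable_funM; first by case: LX.
  exact: measurable_random_integral.
- exact: (measurable_fubini_G iX).
have := ae_integrable2 i1; apply: filterS => w /= iw _.
have iw' : sg.-integrable setT (EFin \o (fun x => T x w * psi x)).
  rewrite (_ : EFin \o _ = fun x => ker (fun=> 1) psi (x, w))//.
  by apply/funext => x; rewrite /ker /= mul1r.
rewrite /ker /= EFinM /Rintegral fineK; last exact: integrable_fin_num iw'.
by rewrite -integralZl.
Qed.

(* The variance of f for the uniform law is nonnegative. *)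
Let sqr_mean_le (f : sphere R -> R) : measurable_fun [set: sphere R] f ->
  (\int[sigma]_x (f x ^+ 2)%:E < +oo)%E ->
  (((\int[sigma]_x f x) ^+ 2)%:E <= (4 * pi)%:E * \int[sigma]_x (f x ^+ 2)%:E)%E.
Proof.
move=> mf f2; have pi0 : 0 < pi :> R := pi_gt0 R.
have if2 : sigma.-integrable setT (EFin \o (fun x => f x ^+ 2)).
  apply/integrableP; split; first by apply/measurable_EFinP; exact: measurable_funX.
  under eq_integral => x _ do rewrite /= ger0_norm ?sqr_ge0//.
  exact: f2.
have ic (c : R) : sigma.-integrable setT (EFin \o (fun _ : sphere R => c)).
  exact: (bmeas_integrable sigmaP (bmeas_cst c)).
have if1 : sigma.-integrable setT (EFin \o f).
  apply: (@le_integrable _ _ _ sigma setT _ _ (EFin \o (fun x => f x ^+ 2 + 1))) => //.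
  - exact/measurable_EFinP.
  - move=> x _ /=; rewrite lee_fin [leRHS]ger0_norm ?addr_ge0 ?sqr_ge0//.
    have := young (f x) 1; rewrite mulr1 expr1n => h; apply: le_trans h _.
    have := sqr_ge0 (f x) => *; lra.
  - by have := integrableD measurableT if2 (ic 1).
set m := (\int[sigma]_x f x) / (4 * pi).
have pi4 : 4 * pi != 0 :> R by rewrite gt_eqF// mulr_gt0.
have im : sigma.-integrable setT (EFin \o (fun x => - (2 * m) * f x)).
  by have := integrableZl measurableT (- (2 * m)) if1.
have var : 0 <= \int[sigma]_x (f x - m) ^+ 2 by apply: Rintegral_ge0 => x _; exact: sqr_ge0.
have e : \int[sigma]_x (f x - m) ^+ 2 =
    \int[sigma]_x (f x ^+ 2) + (- (2 * m) * \int[sigma]_x f x + m ^+ 2 * (4 * pi)).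
  transitivity (\int[sigma]_x (f x ^+ 2 + (- (2 * m) * f x + m ^+ 2))).
    by apply: eq_Rintegral => x _; ring.
  rewrite RintegralD//; last by have := integrableD measurableT im (ic (m ^+ 2)).
  by rewrite RintegralD// RintegralZl// (sphint_cst sigmaP).
have mE : \int[sigma]_x f x = m * (4 * pi) by rewrite divfK.
have fe : (\int[sigma]_x (f x ^+ 2)%:E = (\int[sigma]_x (f x ^+ 2))%:E)%E.
  by rewrite fineK//; exact: (integrable_fin_num _ if2).
rewrite fe -EFinM lee_fin.
move: var; rewrite e mE; set I2 := Rintegral _ _ _ => var.
have -> : (m * (4 * pi)) ^+ 2 = 4 * pi * (m ^+ 2 * (4 * pi)) by ring.
rewrite ler_pM2l ?mulr_gt0//.
suff -> : m ^+ 2 * (4 * pi) = I2 - (I2 + (- (2 * m) * (m * (4 * pi)) + m ^+ 2 * (4 * pi))).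
  by rewrite gerBl.
ring.
Qed.

Let meas_path (w : Omega) : measurable_fun [set: sphere R] (fun x => T x w).
Proof. exact: (measurableT_comp swapTm (measurable_pair2 w)). Qed.

(** The square of a path integral is at most the integral of the squares along the
path (up to constants), which Tonelli's theorem integrates over Omega. *)
Lemma L2_random_integral psi : bmeas psi ->
  L2 (fun w => \int[sigma]_x (T x w * psi x)).
Proof.
move=> bpsi; split; first exact: measurable_random_integral.
have [mpsi [M psiM]] := bpsi.
have M0 : 0 <= M := le_trans (normr_ge0 _) (psiM point).
have pi0 : 0 < pi :> R := pi_gt0 R.
pose S w := (\int[sg]_x (T x w ^+ 2)%:E)%E.
have mT2 : measurable_fun [set: sphere R * Omega] (fun p => (T p.1 p.2 ^+ 2)%:E).
  by apply/measurable_EFinP; apply: measurable_funX.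
have mS : measurable_fun setT S.
  by apply: (measurable_fun_fubini_tonelli_G (fun p => (T p.1 p.2 ^+ 2)%:E)) => // p; rewrite lee_fin sqr_ge0.
have S0 w : (0 <= S w)%E by apply: integral_ge0 => x _; rewrite lee_fin sqr_ge0.
pose C : R := 4 * pi * (M ^+ 2 + 1).
have C0 : 0 < C by rewrite mulr_gt0 ?mulr_gt0// ltr_wpDl// sqr_ge0.
have bound w : (((\int[sigma]_x (T x w * psi x)) ^+ 2)%:E <= C%:E * S w)%E.
  have [Sy|Sy] := eqVneq (S w) +oo%E; first by rewrite Sy gt0_muley ?lte_fin// leey.
  have mTp : measurable_fun setT (fun x => T x w * psi x) by apply: measurable_funM.
  have h1 : (\int[sigma]_x ((T x w * psi x) ^+ 2)%:E <= (M ^+ 2 + 1)%:E * S w)%E.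
    have mTw2 : measurable_fun setT (fun x => (T x w ^+ 2)%:E).
      by apply/measurable_EFinP; exact: measurable_funX.
    have p0 : (0 <= (M ^+ 2 + 1)%:E)%E by rewrite lee_fin addr_ge0 ?sqr_ge0.
    rewrite /S -ge0_integralZl//; try by move=> x _; rewrite lee_fin sqr_ge0.
    apply: ge0_le_integral => //.
    - by move=> x _; rewrite lee_fin sqr_ge0.
    - by apply/measurable_EFinP; exact: measurable_funX.
    - by apply: emeasurable_funM.
    move=> x _; rewrite -EFinM lee_fin exprMn mulrC; apply: ler_wpM2r; first exact: sqr_ge0.
    rewrite -(real_normK (num_real (psi x))).
    apply: (@le_trans _ _ (M ^+ 2)); last by rewrite lerDl.
    by rewrite ler_pXn2r// nnegrE.
  apply: le_trans (sqr_mean_le mTp _) _.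
    apply: le_lt_trans h1 _; apply: lte_mul_pinfty => //.
    - by rewrite lee_fin addr_ge0 ?sqr_ge0.
    - by rewrite ltey.
  rewrite /C (EFinM (4 * pi)) -muleA; apply: lee_wpmul2l => //.
  by rewrite lee_fin mulr_ge0// ltW.
apply: (@le_lt_trans _ _ (\int[P]_w (C%:E * S w)))%E.
  apply: ge0_le_integral => //.
  - by move=> w _; rewrite lee_fin sqr_ge0.
  - by apply: sq_meas; exact: measurable_random_integral.
  - by apply: emeasurable_funM.
rewrite ge0_integralZl//; last by rewrite lee_fin ltW.
apply: lte_mul_pinfty => //; first by rewrite lee_fin ltW.
rewrite /S -(@fubini_tonelli _ _ _ _ _ sg P (fun p => (T p.1 p.2 ^+ 2)%:E))//; try by
  move=> p; rewrite lee_fin sqr_ge0.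
apply: (@le_lt_trans _ _ (\int[sg]_x (K 1)%:E))%E.
  apply: ge0_le_integral => //.
  - by move=> x _; apply: integral_ge0 => w _; rewrite lee_fin sqr_ge0.
  - by apply: (measurable_fun_fubini_tonelli_F (fun p => (T p.1 p.2 ^+ 2)%:E)) => // p; rewrite lee_fin sqr_ge0.
  - move=> x _; rewrite -(sdotxx x) -ETT le_eqVlt; apply/orP; left; apply/eqP.
    by apply: eq_integral => w _; rewrite /= expr2.
rewrite integral_cst//= (_ : sgf _ = sigma setT)// sigmaP.1 -EFinM ltry//.
Qed.

(** The interchange of expectation and integral, applied to one integral after the
other. *)
Lemma covariance_random_integral psi psi' : bmeas psi -> bmeas psi' ->
  (\int[P]_w ((\int[sigma]_x (T x w * psi x)) * (\int[sigma]_x (T x w * psi' x)))%:E =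
   \int[sigma]_y (psi' y * (\int[sigma]_x (psi x * K (sdot x y))))%:E)%E.
Proof.
move=> bpsi bpsi'.
rewrite (expectation_random_integral (L2_random_integral bpsi) bpsi').
apply: eq_integral => y _; congr (_ * _)%:E.
rewrite [RHS]/Rintegral; congr fine.
transitivity (\int[P]_w (T y w * \int[sigma]_x (T x w * psi x))%:E)%E.
  by apply: eq_integral => w _; rewrite mulrC.
rewrite (expectation_random_integral (L2_field y) bpsi).
by apply: eq_integral => x _; rewrite ETT /= sdotC.
Qed.

End RandomIntegrals.

(** * Continuity of the covariance function *)

Section Covariance.
Variables (R : realType) (d : measure_display) (Omega : measurableType d).
Variables (P : probability Omega R) (T : sphere R -> {RV P >-> R}) (K : R -> R).
Hypotheses (isoT : isotropic T K) (mscT : mean_square_continuous T).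

Let sdotxx (x : sphere R) : sdot x x = 1. Proof. exact: sphereP. Qed.

Let Ex (f : Omega -> R) : R := \int[P]_w f w.
Let int (f : Omega -> R) := P.-integrable setT (EFin \o f).

Let int_TT x y : int (fun w => T x w * T y w).
Proof. by apply: L2_integrableM; exact: (L2_field isoT). Qed.

Let Ex_TT x y : Ex (fun w => T x w * T y w) = K (sdot x y).
Proof. by have := isoT x y; rewrite unlock /Ex /Rintegral => ->. Qed.

Let int_lin a f g : int f -> int g -> int (fun w => a * f w + g w).
Proof.
by move=> If Ig; have := integrableD measurableT (integrableZl measurableT a If) Ig.
Qed.

Let Ex_lin a f g : int f -> int g ->
  Ex (fun w => a * f w + g w) = a * Ex f + Ex g.
Proof.
move=> If Ig; have Iaf : int (fun w => a * f w) by have := integrableZl measurableT a If.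
by rewrite /Ex RintegralD// RintegralZl.
Qed.

(* nonnegativity of E (a T_x + b (T_y - T_z))^2, a form of Cauchy-Schwarz *)
Let quad_ge0 a b x y z :
  0 <= a ^+ 2 * K 1 + 2 * a * b * (K (sdot x y) - K (sdot x z)) +
       b ^+ 2 * (2 * K 1 - 2 * K (sdot y z)).
Proof.
have : 0 <= Ex (fun w => (a * T x w + b * (T y w - T z w)) ^+ 2).
  by apply: Rintegral_ge0 => w _; exact: sqr_ge0.
pose k w := a ^+ 2 * (T x w * T x w) + ((2 * a * b) * (T x w * T y w) +
  (- (2 * a * b) * (T x w * T z w) + (b ^+ 2 * (T y w * T y w) +
  (- (2 * b ^+ 2) * (T y w * T z w) + (b ^+ 2 * (T z w * T z w) + 0 * (T z w * T z w)))))).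
have -> : (fun w => (a * T x w + b * (T y w - T z w)) ^+ 2) = k.
  by apply/funext => w; rewrite /k; ring.
have i0 : int (fun w => 0 * (T z w * T z w)).
  by have := integrableZl measurableT 0 (int_TT z z).
rewrite /k !Ex_lin; try by do ![exact: int_TT | exact: i0 | apply: int_lin].
rewrite [Ex (fun w => 0 * _)]RintegralZl//; last exact: int_TT.
rewrite !Ex_TT !sdotxx => h; apply: le_trans h _.
rewrite le_eqVlt; apply/orP; left; apply/eqP; ring.
Qed.

Let increment_cvg y : (fun z => 2 * K 1 - 2 * K (sdot z y)) @ y --> (0 : R).
Proof.
have e z : ('E_P[(fun w => (T z w - T y w) ^+ 2)%R] = (2 * K 1 - 2 * K (sdot z y))%:E)%E.
  rewrite unlock; pose k w := 1 * (T z w * T z w) + (-2 * (T z w * T y w) + T y w * T y w).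
  have ik : int k by do ![exact: int_TT | apply: int_lin].
  have -> : (fun w => ((T z w - T y w) ^+ 2)%:E) = EFin \o k.
    by apply/funext => w; rewrite /k /=; congr (_%:E); ring.
  have -> : (\int[P]_w (EFin \o k) w = (Ex k)%:E)%E.
    by rewrite /Ex /Rintegral fineK//; exact: integrable_fin_num.
  congr (_%:E); rewrite /k !Ex_lin; try by do ![exact: int_TT | apply: int_lin].
  by rewrite !Ex_TT !sdotxx; ring.
have := @mscT y; rewrite (_ : (fun z => _) = fun z => (2 * K 1 - 2 * K (sdot z y))%:E).
  by move=> h; have [_] := iffLR (@fine_cvgP _ _ _ (nbhs_filter y) _ _) h.
by apply/funext => z; exact: e.
Qed.

Let continuous_cov x : continuous (fun y => K (sdot x y)).
Proof.
move=> y; apply: (iffRL (@cvgrPdist_lt _ _ _ _ (nbhs_filter y) _ _)) => e e0.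
have K1 : 0 <= K 1.
  by have := quad_ge0 1 0 x x x; rewrite expr1n expr0n mul1r mulr0 !mul0r !addr0.
have k0 : 0 < K 1 + 1 by rewrite ltr_wpDl.
pose a := e / (K 1 + 1); have a0 : 0 < a by rewrite divr_gt0.
have ae : a * K 1 + a = e by rewrite /a; field; rewrite gt_eqF.
have := iffLR (@cvgrPdist_lt _ _ _ _ (nbhs_filter y) _ _) (@increment_cvg y) (e * a).
rewrite mulr_gt0// => /(_ isT).
apply: (@filterS _ _ (nbhs_filter y)) => z; rewrite sub0r normrN => /ltr_normlW hz.
have h1 := quad_ge0 a 1 x z y; have h2 := quad_ge0 a (-1) x z y.
rewrite ltr_norml; apply/andP; split.
  rewrite -subr_gt0 -(pmulr_rgt0 _ a0); nra.
rewrite -subr_gt0 -(pmulr_rgt0 _ a0); nra.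
Qed.

(* the arc is parametrised by its height, clamped to be defined on the line *)
Let clamp (u : R) : R := (`|u + 1| - `|u - 1|) / 2.

Let clampE u : -1 <= u <= 1 -> clamp u = u.
Proof.
move=> /andP[u1 u2]; rewrite /clamp ger0_norm; last by lra.
by rewrite ler0_norm; [field|lra].
Qed.

Let clamp_sqr u : clamp u ^+ 2 <= 1.
Proof.
have [h1|h1] := lerP (-1) u; have [h2|h2] := lerP u 1.
- by rewrite clampE ?h1// expr2; nra.
- rewrite /clamp ger0_norm ?ger0_norm; [|lra|lra].
  by rewrite (_ : _ / 2 = 1) ?expr1n//; field.
- rewrite /clamp ler0_norm ?ler0_norm; [|lra|lra].
  by rewrite (_ : _ / 2 = -1) ?sqrrN ?expr1n//; field.
- lra.
Qed.

Let o2 : 'I_3 := @Ordinal 3 2 isT.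

Let arc_vec (u : R) : 'rV[R]_3 := \row_i
  (if i == 0 then Num.sqrt (1 - clamp u ^+ 2) else if i == 1 then 0 else clamp u).

Let arc_subproof u : arc_vec u \in [set v : 'rV[R]_3 | dotp v v = 1].
Proof.
rewrite inE /= dotp3 !mxE /= mulr0 addr0 -!expr2 sqr_sqrtr ?subr_ge0//.
by rewrite subrK.
Qed.

Let arc u : sphere R := SigSub (arc_subproof u).

Let continuous_arc : continuous arc.
Proof.
have cc : continuous clamp.
  move=> u; apply: cvgM; last exact: cvg_cst.
  by apply: cvgB; apply: cvg_norm; [apply: cvgD|apply: cvgB] => //; exact: cvg_cst.
apply: continuous_comp_initial; apply: continuous_mx => i j.
rewrite (_ : (fun x => _) = fun x => if j == 0 then Num.sqrt (1 - clamp x ^+ 2)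
  else if j == 1 then 0 else clamp x); last by apply/funext => x; rewrite /= mxE.
case: (j == 0); last by case: (j == 1) => //; exact: cst_continuous.
move=> x; apply: continuous_comp; last exact: sqrt_continuous.
apply: cvgB; first exact: cvg_cst.
by rewrite expr2; apply: cvgM; exact: cc.
Qed.

(** Mean square continuity makes the covariance with a fixed point continuous on
the sphere, and every value in [-1, 1] is the inner product of that point with
one moving continuously along an arc. *)
Lemma continuous_covariance : {within `[-1, 1], continuous K}.
Proof.
have cK : continuous (fun u => K (sdot (arc 1) (arc u))).
  by move=> u; apply: (@continuous_comp _ _ _ arc (fun y => K (sdot (arc 1) y)));
    [exact: continuous_arc|exact: continuous_cov].
have arcE u : -1 <= u <= 1 -> sdot (arc 1) (arc u) = u.
  move=> u1; have c1 : clamp 1 = 1 by apply: clampE; apply/andP; split; lra.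
  rewrite /sdot dotp3 !mxE /= c1 clampE//.
  by rewrite expr1n subrr sqrtr0 !mul0r mul1r !add0r.
have cw : {within `[-1, 1], continuous (fun u => K (sdot (arc 1) (arc u)))}.
  exact: continuous_subspaceT.
have eqK : {in [set` `[-1, 1]], (fun u => K (sdot (arc 1) (arc u))) =1 K}.
  by move=> u; rewrite inE /= in_itv/= => u1; rewrite arcE.
move=> u V; exact: (subspace_eq_continuous eqK cw).
Qed.

End Covariance.

(** * Covariance of the needlet coefficients *)

Section NeedletCovariance.
Variables (R : realType) (sigma : {measure set (sphere R) -> \bar R}).
Hypothesis sigmaP : is_surface_measure sigma.
Variables (B : R) (phi : R -> R).
Hypotheses (B1 : 1 < B) (phiP : is_window B phi).

Let B0 : 0 < B. Proof. exact: lt_trans B1. Qed.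

Lemma window_b_low x : 0 <= x <= B^-1 -> window_b B phi x = 0.
Proof.
move=> /andP[x0 xB]; have [_ _ _ _ [_ phi1]] := phiP.
rewrite /window_b !phi1 ?subrr ?sqrtr0//; first by rewrite ger0_norm.
rewrite ger0_norm; last by rewrite divr_ge0 ?(ltW B0).
apply: le_trans xB.
by rewrite ler_pdivrMr// ler_peMr// ltW.
Qed.

Lemma window_b_high x : B <= x -> window_b B phi x = 0.
Proof.
move=> xB; have x0 : 0 < x := lt_le_trans B0 xB.
apply/eqP; rewrite -sqrf_eq0 (window_bE B1 phiP (ltW x0)).
by rewrite (window_deriv_out B1 phiP)// in_itv/= negb_and -!leNgt xB orbT.
Qed.

Let L (l : nat) (t : R) : R := legendreL l t.
Let b (j l : nat) : R := window_b B phi (l%:R / B ^+ j).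
Let band (j : nat) : nat := (Num.truncn (B * B ^+ j)).+1.

Let b0 j : b j 0 = 0.
Proof. by apply: window_b_low; rewrite mul0r lexx invr_ge0 ltW. Qed.

Let b_high j l : (band j <= l)%N -> b j l = 0.
Proof.
move=> h; apply: window_b_high; rewrite ler_pdivlMr ?exprn_gt0// ltW//.
apply: lt_le_trans (_ : (band j)%:R <= _); last by rewrite ler_nat.
by rewrite truncnS_gt.
Qed.

(** The partial sums are eventually constant, as b vanishes from B on. *)
Lemma needlet_sum j xi lam x N : (band j <= N)%N ->
  needlet B phi j xi lam x = Num.sqrt lam * \sum_(l < N) b j l * L l (sdot x xi).
Proof.
move=> bN; rewrite /needlet; congr (_ * _); apply: lim_near_cst => //.
exists N => // n /= Nn; rewrite seriesEnat /= (big_cat_nat (leq0n N) Nn)//= [X in _ + X]big_nat_cond.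
rewrite [X in _ + X]big1 ?addr0 ?big_mkord//.
move=> l /andP[/andP[Nl _] _]; rewrite -/(b j l) b_high ?mul0r//.
exact: leq_trans Nl.
Qed.

Let bmeas_L l xi : bmeas (fun x : sphere R => L l (sdot x xi)).
Proof. by apply: bmeasM; [exact: bmeas_cst|apply: bmeas_horner; exact: bmeas_sdot]. Qed.

Lemma bmeas_needlet j xi lam : bmeas (needlet B phi j xi lam).
Proof.
rewrite (_ : needlet _ _ _ _ _ = fun x => Num.sqrt lam * \sum_(l < band j) b j l * L l (sdot x xi)).
  by apply: bmeasZ; apply: bmeas_sum => l; apply: bmeasZ.
by apply/funext => x; exact: needlet_sum.
Qed.

Let sphint_L l m xi xi' :
  \int[sigma]_x (L l (sdot x xi) * L m (sdot x xi')) =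
  if l == m then L l (sdot xi xi') else 0.
Proof.
have pi0 : pi != 0 :> R by rewrite gt_eqF// pi_gt0.
pose P k (x y : sphere R) : R := (legendreP R k).[sdot x y].
have bP k y : bmeas (fun x => P k x y) by apply: bmeas_horner; exact: bmeas_sdot.
pose c k : R := (2 * k%:R + 1) / (4 * pi).
transitivity (c l * c m * \int[sigma]_x (P l x xi * P m x xi')).
  rewrite -(sphintZ sigmaP); last exact: bmeasM.
  by apply: eq_Rintegral => x _; rewrite /L /legendreL -/(c l) -/(c m) /P mulrACA.
case: (ltngtP l m) => [lm|lm|<-]; last 1 first.
- rewrite (sphint_legendreP_diag sigmaP) /L /legendreL -/(c l).
  have := mom_legendreP_sqr R l; set I := mom _ => hI.
  have -> : c l * c l * (2 * pi * I * (legendreP R l).[sdot xi xi']) =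
    c l * (2 * pi / (4 * pi)) * ((2 * l%:R + 1) * I) * (legendreP R l).[sdot xi xi'].
    rewrite /c; move: (_.[sdot xi xi']) (I) pi0 => u J.
    by move: (pi : R) => p p0; field.
  rewrite hI; move: (_.[sdot xi xi']) (c l) pi0 => u v.
  by move: (pi : R) => p p0; field.
- rewrite (_ : (fun x => _) = fun x => P m x xi' * P l x xi); last first.
    by apply/funext => x; rewrite mulrC.
  by rewrite (sphint_legendreP_lt sigmaP) ?mulr0// size_legendreP.
- by rewrite (sphint_legendreP_lt sigmaP) ?mulr0// size_legendreP.
Qed.

Variables (d : measure_display) (Omega : measurableType d) (P : probability Omega R).
Variables (T : sphere R -> {RV P >-> R}) (K : R -> R).
Hypotheses (mT : measurable_field T) (isoT : isotropic T K).
Hypothesis mscT : mean_square_continuous T.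

Let sphint_LK l xi y :
  \int[sigma]_x (L l (sdot x xi) * K (sdot x y)) =
  power_spectrum K l * L l (sdot y xi).
Proof.
have pi0 : pi != 0 :> R by rewrite gt_eqF// pi_gt0.
have l0 : 2 * l%:R + 1 != 0 :> R by rewrite gt_eqF// ltr_wpDl.
have cK := continuous_covariance isoT mscT.
pose c : R := (2 * l%:R + 1) / (4 * pi).
have bK : bmeas (fun x : sphere R => K (sdot x y)) by exact: bmeas_zonal.
transitivity (c * \int[sigma]_x (K (sdot x y) * (legendreP R l).[sdot x xi])).
  rewrite -(sphintZ sigmaP); last first.
    by apply: bmeasM => //; apply: bmeas_horner; exact: bmeas_sdot.
  by apply: eq_Rintegral => x _; rewrite /L /legendreL -/c; ring.
rewrite (funk_hecke sigmaP)// /power_spectrum /L /legendreL -/c.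
have -> : \int[lebesgue_measure]_(u in `[-1, 1]) (K u * (c * (legendreP R l).[u])) =
    c * \int[lebesgue_measure]_(u in `[-1, 1]) (K u * (legendreP R l).[u]).
  rewrite -RintegralZl//; first by apply: eq_Rintegral => u _; ring.
  apply: integrable_segment; apply: within_continuousM => //.
  exact: within_continuous_horner.
set I := Rintegral _ _ _; rewrite /c; move: (_.[sdot y xi]) (I) l0 pi0 => u J.
move: (2 * l%:R + 1) (pi : R) => q p q0 p0; field.
by rewrite q0 p0.
Qed.

(** Integrating K against the second kernel multiplies degree l by C_l, and the
reproducing property removes the cross terms of the two needlets.  The degree
0 carries no mass, whence the shift of the index by 1. *)
Lemma needlet_covariance j xi xi' lam lam' :
  (\int[P]_w (needlet_coef sigma T B phi j xi lam w *
              needlet_coef sigma T B phi j xi' lam' w)%:E =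
   (Num.sqrt lam * Num.sqrt lam' / (4 * pi) *
    legendre_sum (sdot xi xi') (band j) 1
      (fun l => window_b B phi (l.+1%:R / B ^+ j) ^+ 2 * power_spectrum K l.+1))%:E)%E.
Proof.
rewrite /needlet_coef (covariance_random_integral sigmaP mT isoT); try exact: bmeas_needlet.
set psi := needlet B phi j xi lam; set psi' := needlet B phi j xi' lam'.
set N := (band j).+1; have jN : (band j <= N)%N by exact: leqnSn.
have inner y : \int[sigma]_x (psi x * K (sdot x y)) =
    Num.sqrt lam * \sum_(l < N) b j l * power_spectrum K l * L l (sdot y xi).
  have bK : bmeas (fun x : sphere R => K (sdot x y)).
    exact: (bmeas_zonal y (continuous_covariance isoT mscT)).
  transitivity (\int[sigma]_x (Num.sqrt lam *
      \sum_(l < N) b j l * (L l (sdot x xi) * K (sdot x y)))).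
    apply: eq_Rintegral => x _; rewrite /psi (needlet_sum xi lam x jN) -mulrA mulr_suml.
    by congr (_ * _); apply: eq_bigr => l _; rewrite mulrA.
  rewrite sphintZ//; last by apply: bmeas_sum => l; apply: bmeasZ; exact: bmeasM.
  rewrite sphint_sum//; last by move=> l; apply: bmeasZ; exact: bmeasM.
  congr (_ * _); apply: eq_bigr => l _; rewrite sphintZ//; last exact: bmeasM.
  by rewrite sphint_LK mulrA.
have outer : \int[sigma]_y (psi' y * \int[sigma]_x (psi x * K (sdot x y))) =
    Num.sqrt lam * Num.sqrt lam' *
    \sum_(l < N) b j l ^+ 2 * power_spectrum K l * L l (sdot xi xi').
  transitivity (\int[sigma]_y (Num.sqrt lam * Num.sqrt lam' *
      \sum_(l < N) \sum_(m < N) b j l * power_spectrum K l * b j m *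
         (L l (sdot y xi) * L m (sdot y xi')))).
    apply: eq_Rintegral => y _; rewrite inner /psi' (needlet_sum xi' lam' y jN).
    rewrite mulrACA [LHS]mulrC [_ * Num.sqrt lam]mulrC mulrC; congr (_ * _).
    rewrite [LHS]mulrC big_distrlr /=; apply: eq_bigr => l _; apply: eq_bigr => m _; ring.
  have bLL l m : bmeas (fun y => L l (sdot y xi) * L m (sdot y xi')) by exact: bmeasM.
  rewrite sphintZ//; last by apply: bmeas_sum => l; apply: bmeas_sum => m; exact: bmeasZ.
  congr (_ * _); rewrite sphint_sum//; last first.
    by move=> l; apply: bmeas_sum => m; exact: bmeasZ.
  apply: eq_bigr => l _; rewrite sphint_sum//; last by move=> m; exact: bmeasZ.
  rewrite (bigD1 l)//= [X in _ + X]big1 ?addr0.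
    by rewrite sphintZ// sphint_L eqxx; ring.
  by move=> m ml; rewrite sphintZ// sphint_L -[_ == _]/(l == m) eq_sym (negPf ml) mulr0.
transitivity ((\int[sigma]_y (psi' y * \int[sigma]_x (psi x * K (sdot x y))))%:E)%E.
  rewrite /Rintegral fineK//; apply: integrable_fin_num => //.
  apply: (bmeas_integrable sigmaP); apply: bmeasM; first exact: bmeas_needlet.
  rewrite (_ : (fun y => _) = fun y => Num.sqrt lam * \sum_(l < N) b j l * power_spectrum K l * L l (sdot y xi)); last exact/funext.
  by apply: bmeasZ; apply: bmeas_sum => l; exact: bmeasZ.
rewrite outer -[in RHS]mulrA; congr (_ * _)%:E.
rewrite /N big_ord_recl b0 expr0n !mul0r add0r /legendre_sum mulr_sumr.
apply: eq_bigr => l _; rewrite /L /legendreL /b addn1 lift0; set u := window_b _ _ _; set v := _.[_]; set w := power_spectrum _ _.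
ring.
Qed.

End NeedletCovariance.

(** * Angles and powers *)

Section Angles.
Variable R : realType.
Implicit Types (x y : R).

(** With x = cos(theta): if x >= 1/2, the mean value theorem for the sine gives
sin(theta) >= theta / 2, so that theta^2 <= 4 (1 - x^2) <= 8 (1 - x);
otherwise 1 - x is at least 1/2 while theta is at most pi < 4. *)
Lemma acos_sqr_le x : -1 <= x <= 1 -> acos x ^+ 2 <= 32 * (1 - x).
Proof.
move=> x1; have a0 := acos_ge0 x1; have api := acos_lepi x1.
have pi4 : pi < 4 :> R by have := pihalf_lt2 R; rewrite ltr_pdivrMr//; lra.
have [x2|x2] := ltP x 2^-1.
  have : acos x ^+ 2 <= 4 ^+ 2 by rewrite ler_pXn2r ?nnegrE//; lra.
  rewrite !expr2; lra.
have cs : {within `[0, acos x], continuous (@sin R)}.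
  by apply: continuous_subspaceT; exact: continuous_sin.
have [c] := @MVT_segment R sin cos 0 (acos x) a0 (fun y _ => is_derive_sin y) cs.
rewrite in_itv/= => /andP[c0 cx]; rewrite sin0 !subr0 => sE.
have cc : 2^-1 <= cos c.
  apply: le_trans x2 _; rewrite -{1}(acosK (x:=x)) ?in_itv//=.
  rewrite leNgt ltr_cos -?leNgt// in_itv/= ?c0 ?a0//=.
  exact: le_trans cx api.
have h : acos x <= 2 * sin (acos x) by rewrite sE; nra.
have e : sin (acos x) ^+ 2 = 1 - x ^+ 2.
  by have := cos2Dsin2 (acos x); rewrite acosK ?in_itv// => h2; rewrite -h2; ring.
have : acos x ^+ 2 <= (2 * sin (acos x)) ^+ 2 by rewrite ler_pXn2r ?nnegrE// (le_trans a0).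
rewrite exprMn e; move: x1 => /andP[]; nra.
Qed.

Lemma exprD1_le y M : 0 <= y -> (1 + y) ^+ M <= 2 ^+ M * (1 + y ^+ M).
Proof.
move=> y0; have [y1|/ltW y1] := leP y 1.
  apply: (@le_trans _ _ (2 ^+ M)); first by apply: lerXn2r; rewrite ?nnegrE; lra.
  by rewrite ler_peMr ?exprn_ge0// lerDl exprn_ge0.
apply: (@le_trans _ _ ((2 * y) ^+ M)); first by apply: lerXn2r; rewrite ?nnegrE; lra.
by rewrite exprMn ler_wpM2l ?exprn_ge0// lerDr.
Qed.

Lemma bernoulli_expr (B : R) j : 1 <= B -> 1 + j%:R * (B - 1) <= B ^+ j.
Proof.
move=> B1; elim: j => [|j IH]; first by rewrite mul0r addr0.
have : B * (1 + j%:R * (B - 1)) <= B ^+ j.+1.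
  by rewrite exprS ler_wpM2l// (le_trans _ B1).
have : 0 <= j%:R * (B - 1) ^+ 2 by rewrite mulr_ge0// sqr_ge0.
rewrite -natr1; nra.
Qed.

End Angles.

(** * Size of the covariance sums *)

Section Bounds.
Variables (R : realType) (B : R) (phi : R -> R).
Hypotheses (B1 : 1 < B) (phiP : is_window B phi).
Variables (M : nat) (alpha : R) (g : nat -> R -> R) (c1 : R) (kappa : nat -> R).
Variable C : nat -> R.
Hypotheses (alpha0 : 0 < alpha) (c10 : 0 < c1).
Hypothesis CE : forall j l : nat, B ^ (j%:Z - 1) < l%:R < B ^ (j%:Z + 1) ->
  C l = l%:R `^ (- alpha) * g j (l%:R / B ^+ j).
Hypothesis Clow : forall l : nat, (0 < l)%N -> c1 * l%:R `^ (- alpha) <= C l.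
Hypothesis gD : forall j, n_derivable_within `[B^-1, B] M (g j).
Hypothesis gB : forall r j u, (r <= M)%N -> u \in `[B^-1, B] ->
     `|derive_withinn `[B^-1, B] r (g j) u| <= kappa r.

Let B0 : 0 < B. Proof. exact: lt_trans B1. Qed.
Let n (j : nat) : R := B ^+ j.
Let n0 j : 0 < n j. Proof. exact: exprn_gt0. Qed.
Let n1 j : 1 <= n j. Proof. by rewrite exprn_ege1// ltW. Qed.
Let N j : nat := (Num.truncn (B * n j)).+1.

(** The covariance of two coefficients of level j, up to the weights, as a
function of the inner product of the cubature points. *)
Definition level_sum j (x : R) : R := legendre_sum x (N j) 1
  (fun l => window_b B phi (l.+1%:R / B ^+ j) ^+ 2 * C l.+1).

Let a (j l : nat) : R := window_term B phi g 0 (- alpha) 0 j (l.+1%:R / n j).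

Let coefE j l : window_b B phi (l.+1%:R / B ^+ j) ^+ 2 * C l.+1 = n j `^ (- alpha) * a j l.
Proof.
have t0 : 0 < l.+1%:R / n j :> R by rewrite divr_gt0.
rewrite (window_bE B1 phiP) ?(ltW t0)// /a /window_term -/(n j).
have [tB|tB] := boolP (l.+1%:R / n j \in `]B^-1, B[); last first.
  by rewrite (window_deriv_out B1 phiP)// !mul0r mulr0.
rewrite (CE (j := j)); last first.
  move: tB; rewrite in_itv/= ltr_pdivlMr// ltr_pdivrMr// => /andP[h1 h2].
  rewrite expfzDr ?gt_eqF// expfzDr ?gt_eqF// exprN1 expr1z.
  by rewrite -exprnP mulrC h1 mulrC.
have -> : l.+1%:R `^ (- alpha) = n j `^ (- alpha) * (l.+1%:R / n j) `^ (- alpha).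
  by rewrite -powRM ?(ltW (n0 j)) ?(ltW t0)// mulrC divfK// gt_eqF.
rewrite /derive_withinn /=; ring.
Qed.

Let level_sumE j x : level_sum j x = n j `^ (- alpha) * legendre_sum x (N j) 1 (a j).
Proof.
rewrite /level_sum /legendre_sum mulr_sumr; apply: eq_bigr => l _.
by rewrite coefE; ring.
Qed.

Let a_banded : banded B n 1 a.
Proof.
move=> j l; have t0 : 0 < l.+1%:R / n j :> R by rewrite divr_gt0.
rewrite /a /window_term.
have [tB _|tB] := boolP (l.+1%:R / n j \in `]B^-1, B[); last first.
  by rewrite (window_deriv_out B1 phiP)// !mul0r eqxx.
move: tB; rewrite in_itv/= ltr_pdivlMr// ltr_pdivrMr// natr1 => /andP[h1 h2]; split.
  by move/ltW: h1; rewrite ler_pdivrMl.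
by apply: le_trans (ltW h2); rewrite ler_nat.
Qed.

(** Localization is used with exponent M and, for nearby points, with exponent
0. *)
Lemma level_sum_upper : exists A : R, forall j x, -1 <= x <= 1 ->
  `|level_sum j x| * (1 + n j * acos x) ^+ M <= A * (n j `^ (- alpha) * n j ^+ 2).
Proof.
have sym k : (k <= M)%N -> symbol n k a.
  by move=> kM; apply: (tame_symbol n1); apply: (tame_window_term B1 phiP gD gB).
have [A0 h0] := legendre_localization B1 n1 0 (sym 0%N (leq0n _)) a_banded.
have [A1 h1] := legendre_localization B1 n1 0 (sym M (leqnn _)) a_banded.
exists (2 ^+ M * (A0 + 6 ^+ M * A1)) => j x x1.
have := h0 j x x1; have := h1 j x x1; rewrite expr0 mul1r -/(N j).
rewrite level_sumE normrM (ger0_norm (powR_ge0 _ _)).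
set S := `|legendre_sum _ _ _ _|; set s := Num.sqrt (1 - x) => i1 i0.
have S0 : 0 <= S by exact: normr_ge0.
have s0 : 0 <= s by exact: sqrtr_ge0.
have a0 := acos_ge0 x1.
have as6 : acos x <= 6 * s.
  rewrite -(ler_pXn2r (n := 2)) ?nnegrE ?mulr_ge0//.
  apply: le_trans (acos_sqr_le x1) _; rewrite exprMn sqr_sqrtr; first by nra.
  by rewrite subr_ge0; case/andP: x1.
have p0 : 0 <= n j `^ (- alpha) := powR_ge0 _ _.
rewrite -[leLHS]mulrA; rewrite [leRHS](mulrCA (2 ^+ M * _)); apply: ler_wpM2l => //.
have nj0 := ltW (n0 j).
have k1 : (1 + n j * acos x) ^+ M <= 2 ^+ M * (1 + 6 ^+ M * (n j * s) ^+ M).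
  apply: (@le_trans _ _ ((1 + 6 * (n j * s)) ^+ M)).
    apply: lerXn2r; rewrite ?nnegrE ?addr_ge0 ?mulr_ge0 ?mulr_ge0// lerD2l.
    by rewrite mulrCA ler_wpM2l.
  by rewrite -exprMn; apply: exprD1_le; rewrite !mulr_ge0.
apply: le_trans (ler_wpM2l S0 k1) _.
rewrite [leLHS]mulrCA -[leRHS]mulrA; apply: ler_wpM2l; first exact: exprn_ge0.
rewrite mulrDr mulr1 mulrDl; apply: lerD => //.
rewrite [leLHS]mulrCA -[leRHS]mulrA; apply: ler_wpM2l; first exact: exprn_ge0.
by rewrite mulrC.
Qed.

Let coef_ge0 j l : 0 <= window_b B phi (l.+1%:R / B ^+ j) ^+ 2 * C l.+1.
Proof.
rewrite mulr_ge0 ?sqr_ge0//; apply: le_trans (Clow (ltn0Sn l)).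
by rewrite mulr_ge0 ?powR_ge0// ltW.
Qed.

(** At x = 1 there are no cancellations; the degrees between (1 - D) n and n,
where b^2 is at least 1/2, already give the right order. *)
Lemma level_sum_lower : exists2 c : R, 0 < c & exists J, forall j, (J <= j)%N ->
  c * (n j `^ (- alpha) * n j ^+ 2) <= level_sum j 1.
Proof.
have [D D0 hD] : exists2 D : R, 0 < D <= 2^-1 &
    forall t : R, 1 - D < t <= 1 -> 2^-1 <= window_deriv B phi 0 t.
  have := continuous_window_deriv0 phiP (x := 1).
  move=> /cvgrPdist_lt /(_ 2^-1); rewrite invr_gt0 => /(_ ltac:(by [])).
  rewrite (window_deriv0_1 B1 phiP) => /nbhs_ballP[e /= e0 he].
  exists (Num.min e 2^-1); first by rewrite lt_min ge_min lexx orbT e0 andbT /= invr_gt0.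
  move=> t /andP[t1 t2]; have /he : ball (1 : R) e t.
    rewrite -ball_normE /ball_ /= ger0_norm ?subr_ge0//.
    have : Num.min e 2^-1 <= e by rewrite ge_min lexx.
    lra.
  by move=> /ltr_normlW; lra.
case/andP: D0 => D0 D2.
exists (D / 4 * c1); first by rewrite mulr_gt0// divr_gt0.
pose J := (Num.truncn (2 / D / (B - 1))).+1.
exists J => j Jj.
have nD : 2 <= D * n j.
  rewrite mulrC -ler_pdivrMr//; apply: le_trans (bernoulli_expr j (ltW B1)).
  have : 2 / D <= j%:R * (B - 1).
    rewrite -ler_pdivrMr ?subr_gt0//; apply: le_trans (_ : J%:R <= _); last by rewrite ler_nat.
    by rewrite ltW// truncnS_gt.
  lra.
pose m0 := Num.truncn ((1 - D) * n j); pose m1 := Num.truncn (n j).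
have nj0 := ltW (n0 j).
have m1n : m1%:R <= n j by rewrite truncn_le.
have nm1 : n j < m1.+1%:R by exact: truncnS_gt.
have m0n : m0%:R <= (1 - D) * n j by rewrite truncn_le mulr_ge0//; lra.
have m01 : (m0 <= m1)%N by apply: le_truncn; nra.
have m1N : (m1 <= N j)%N by apply: leqW; apply: le_truncn; rewrite ler_peMl// ltW.
have term l : (m0 <= l < m1)%N -> c1 / 2 * (n j `^ (- alpha) * n j) <=
    (2 * (l + 1)%:R + 1) * (window_b B phi (l.+1%:R / B ^+ j) ^+ 2 * C l.+1).
  move=> /andP[m0l lm1]; set m := l.+1; rewrite addn1 -/m.
  have mlow : (1 - D) * n j < m%:R.
    by apply: lt_le_trans (truncnS_gt _) _; rewrite ler_nat ltnS.
  have mhigh : m%:R <= n j by apply: le_trans m1n; rewrite ler_nat.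
  have t0 : 0 < m%:R / n j by rewrite divr_gt0.
  have b2 : 2^-1 <= window_b B phi (m%:R / B ^+ j) ^+ 2.
    rewrite (window_bE B1 phiP) ?(ltW t0)//; apply: hD.
    by rewrite ltr_pdivlMr// mlow ler_pdivrMr// mul1r.
  have pw : n j `^ (- alpha) <= m%:R `^ (- alpha).
    rewrite !powRN lef_pV2 ?posrE ?powR_gt0//.
    by apply: ge0_ler_powR; rewrite ?nnegrE ?(ltW alpha0).
  have Cm : c1 * n j `^ (- alpha) <= C m.
    by apply: le_trans (Clow (ltn0Sn l)); apply: ler_wpM2l => //; exact: ltW.
  have p0 : 0 <= c1 * n j `^ (- alpha) by rewrite mulr_ge0 ?powR_ge0// ltW.
  have bC : 2^-1 * (c1 * n j `^ (- alpha)) <= window_b B phi (m%:R / B ^+ j) ^+ 2 * C m.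
    by apply: ler_pM => //; rewrite invr_ge0.
  have mm : n j <= 2 * m%:R + 1 by nra.
  apply: le_trans (_ : n j * (2^-1 * (c1 * n j `^ (- alpha))) <= _).
    by rewrite le_eqVlt; apply/orP; left; apply/eqP; field.
  by apply: ler_pM => //; rewrite mulr_ge0// invr_ge0.
rewrite /level_sum /legendre_sum.
have -> : \sum_(l < N j) (2 * (l + 1)%:R + 1) *
    (window_b B phi (l.+1%:R / B ^+ j) ^+ 2 * C l.+1) * (legendreP R (l + 1)).[1] =
  \sum_(0 <= l < N j) (2 * (l + 1)%:R + 1) *
    (window_b B phi (l.+1%:R / B ^+ j) ^+ 2 * C l.+1).
  by rewrite big_mkord; apply: eq_bigr => l _; rewrite horner_legendreP1 mulr1.
set F := fun l : nat => (2 * (l + 1)%:R + 1) * (window_b B phi (l.+1%:R / B ^+ j) ^+ 2 * C l.+1).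
have F0 l : 0 <= F l by rewrite /F mulr_ge0// addr_ge0// mulr_ge0.
rewrite (@big_cat_nat _ _ _ m0)//=; last exact: leq_trans m01 m1N.
rewrite (@big_cat_nat _ _ _ m1 m0)//=.
apply: (@le_trans _ _ (\sum_(m0 <= l < m1) F l)); last first.
  rewrite addrCA lerDl addr_ge0//; apply: sumr_ge0 => l _; exact: F0.
apply: (@le_trans _ _ (\sum_(m0 <= l < m1) c1 / 2 * (n j `^ (- alpha) * n j))); last first.
  by apply: ler_sum_nat => l; exact: term.
rewrite sumr_const_nat -[leRHS]mulr_natl natrB//.
have p0 : 0 <= c1 * n j `^ (- alpha) by rewrite mulr_ge0 ?powR_ge0// ltW.
have cnt : D * n j / 2 <= m1%:R - m0%:R by move: nm1; rewrite -natr1; lra.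
have -> : D / 4 * c1 * (n j `^ (- alpha) * n j ^+ 2) =
    D * n j / 2 * (c1 / 2 * (n j `^ (- alpha) * n j)) by field.
apply: ler_wpM2r => //.
by rewrite !mulr_ge0 ?powR_ge0// ?invr_ge0// ltW.
Qed.

End Bounds.

(** * Correlation *)

Section Correlation.
Variables (R : realType) (sigma : {measure set (sphere R) -> \bar R}).
Hypothesis sigmaP : is_surface_measure sigma.
Variables (B : R) (phi : R -> R).
Hypotheses (B1 : 1 < B) (phiP : is_window B phi).
Variables (d : measure_display) (Omega : measurableType d) (P : probability Omega R).
Variables (T : sphere R -> {RV P >-> R}) (K : R -> R).
Hypotheses (mT : measurable_field T) (isoT : isotropic T K).
Hypothesis mscT : mean_square_continuous T.

Lemma needlet_correlation j xi xi' lam lam' : 0 < lam -> 0 < lam' ->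
  0 < level_sum B phi (power_spectrum K) j 1 ->
  correlation P (needlet_coef sigma T B phi j xi lam)
                (needlet_coef sigma T B phi j xi' lam') =
  level_sum B phi (power_spectrum K) j (sdot xi xi') /
  level_sum B phi (power_spectrum K) j 1.
Proof.
move=> l0 l0' S0; have pi0 := pi_gt0 R.
have cov x y a b : fine 'E_P[(fun w => needlet_coef sigma T B phi j x a w *
      needlet_coef sigma T B phi j y b w)%R]%E =
    Num.sqrt a * Num.sqrt b / (4 * pi) * level_sum B phi (power_spectrum K) j (sdot x y).
  by rewrite unlock (needlet_covariance sigmaP B1 phiP mT isoT mscT).
have sqE x a : fine 'E_P[(fun w => needlet_coef sigma T B phi j x a w ^+ 2)%R]%E =
    Num.sqrt a * Num.sqrt a / (4 * pi) * level_sum B phi (power_spectrum K) j 1.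
  have := cov x x a a; rewrite (_ : sdot x x = 1) => [<-|]; last exact: sphereP.
  by congr (fine 'E_P[_]%E); apply/funext => w; rewrite expr2.
move: (needlet_coef sigma T B phi j) cov sqE => X cov sqE.
rewrite /correlation cov !sqE.
set S1 := level_sum B phi (power_spectrum K) j 1 in S0 *.
have s0 : 0 < Num.sqrt lam by rewrite sqrtr_gt0.
have s0' : 0 < Num.sqrt lam' by rewrite sqrtr_gt0.
set s := Num.sqrt lam in s0 *; set s' := Num.sqrt lam' in s0' *.
have p0 : 0 < 4 * pi :> R by rewrite mulr_gt0.
move: (4 * pi) p0 => p p0; set S := level_sum _ _ _ _ _.
have -> : s * s / p * S1 * (s' * s' / p * S1) = (s * s' / p * S1) ^+ 2.
  by field; rewrite gt_eqF.
rewrite sqrtr_sqr ger0_norm; last by rewrite !mulr_ge0 ?invr_ge0// ltW.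
by field; rewrite !gt_eqF.
Qed.

End Correlation.

Theorem lemma3 (R : realType)
    (sigma : {measure set (sphere R) -> \bar R})
    (B : R) (phi : R -> R) (Z : nat -> nat)
    (xi : forall j, 'I_(Z j) -> sphere R) (lam : forall j, 'I_(Z j) -> R)
    (d : measure_display) (Omega : measurableType d) (P : probability Omega R)
    (T : sphere R -> {RV P >-> R}) (K : R -> R)
    (M : nat) (alpha : R) (g : nat -> R -> R) (c1 c2 : R) (kappa : nat -> R)
    (C := power_spectrum K)
    (beta := fun j (k : 'I_(Z j)) =>
               needlet_coef sigma T B phi j (xi j k) (lam j k)) :
  is_surface_measure sigma ->
  1 < B ->
  is_window B phi ->
  is_cubature sigma B xi lam ->
  measurable_field T ->
  centered_field T ->
  gaussian_field T ->
  mean_square_continuous T ->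
  isotropic T K ->
  (0 < M)%N ->
  2 < alpha ->
  0 < c1 ->
  0 < c2 ->
  (forall r, (r <= M)%N -> 0 < kappa r) ->
  (forall j l : nat, B ^ (j%:Z - 1) < l%:R < B ^ (j%:Z + 1) ->
     C l = l%:R `^ (- alpha) * g j (l%:R / B ^+ j)) ->
  (forall l : nat, (0 < l)%N ->
     c1 * l%:R `^ (- alpha) <= C l <= c2 * l%:R `^ (- alpha)) ->
  (forall j, n_derivable_within `[B^-1, B] M (g j)) ->
  (forall r j u, (r <= M)%N -> u \in `[B^-1, B] ->
     `|derive_withinn `[B^-1, B] r (g j) u| <= kappa r) ->
  exists CM : R, forall (j : nat) (k k' : 'I_(Z j)),
    'E_P[(fun w => beta j k w ^+ 2)%R]%E != 0%E ->
    'E_P[(fun w => beta j k' w ^+ 2)%R]%E != 0%E ->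
    `|correlation P (beta j k) (beta j k')| <=
      CM / (1 + B ^+ j * geodesic (xi j k) (xi j k')) ^+ M.
Proof.
move=> sigmaP B1 phiP [_ lam0 _ _] mT _ _ mscT isoT M0 alpha2 c10 _ _ CE Cb gD gB.
have alpha0 : 0 < alpha by apply: lt_trans alpha2.
have Clow l : (0 < l)%N -> c1 * l%:R `^ (- alpha) <= C l by move=> /Cb /andP[].
have [A hA] := level_sum_upper B1 phiP CE gD gB.
have [c c0 [J hJ]] := level_sum_lower B1 phiP alpha0 c10 Clow.
have n0 j : 0 < B ^+ j by rewrite exprn_gt0// (lt_trans _ B1).
pose D j k k' := 1 + B ^+ j * geodesic (xi j k) (xi j k').
pose cor j (k k' : 'I_(Z j)) := `|correlation P (beta j k) (beta j k')| * D j k k' ^+ M.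
have D0 j k k' : 0 < D j k k'.
  rewrite ltr_wpDr// mulr_ge0 ?(ltW (n0 j))//; apply: acos_ge0.
  exact: sdot_itv.
have cor0 j k k' : 0 <= cor j k k' by rewrite mulr_ge0 ?exprn_ge0// ltW.
pose F j := \sum_(k < Z j) \sum_(k' < Z j) cor j k k'.
have F0 j : 0 <= F j by apply: sumr_ge0 => k _; apply: sumr_ge0.
(* F j bounds the correlations of the finitely many pairs of level j *)
exists (`|A| / c + \sum_(j < J) F j) => j k k' _ _.
rewrite ler_pdivlMr; last by rewrite exprn_gt0 ?D0.
change (cor j k k' <= `|A| / c + \sum_(j < J) F j).
have [Jj|jJ] := leqP J j; last first.
  apply: (@le_trans _ _ (F j)).
    rewrite /F (bigD1 k)//= (bigD1 k')//= -addrA lerDl addr_ge0//; first exact: sumr_ge0.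
    by apply: sumr_ge0 => l _; exact: sumr_ge0.
  rewrite (bigD1 (Ordinal jJ))//= addrCA lerDl addr_ge0//; last exact: sumr_ge0.
  by rewrite divr_ge0// ltW.
have p0 : 0 < (B ^+ j) `^ (- alpha) * B ^+ j ^+ 2 by rewrite mulr_gt0 ?powR_gt0 ?exprn_gt0 ?(lt_trans _ B1).
have S1 := hJ j Jj; have S0 := lt_le_trans (mulr_gt0 c0 p0) S1.
have st : -1 <= sdot (xi j k) (xi j k') <= 1.
  exact: sdot_itv.
apply: (@le_trans _ _ (`|A| / c)); last by rewrite lerDl; exact: sumr_ge0.
have := needlet_correlation sigmaP B1 phiP mT isoT mscT (xi j k) (xi j k') (lam0 j k) (lam0 j k') S0.
rewrite /cor -/(beta j k) -/(beta j k') => ->; rewrite normrM normfV (gtr0_norm S0).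
rewrite mulrAC ler_pdivrMr// mulrAC ler_pdivlMr//.
apply: le_trans (ler_wpM2r (ltW c0) (hA j _ st)) _.
apply: le_trans (_ : `|A| * ((B ^+ j) `^ (- alpha) * B ^+ j ^+ 2) * c <= _).
  by rewrite ler_wpM2r ?(ltW c0)// ler_wpM2r ?(ltW p0)// ler_norm.
by rewrite -mulrA ler_wpM2l// mulrC.
Qed.
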